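(* Let $k$ be a field of characteristic $0$, let $\mathcal{G}=(\mathcal{G}_0,\mathcal{G}_1)$ be a finite groupoid and let $D=D(k[\mathcal{G}])$. Consider the following two conditions on a Frobenius object $((\rho,A),m,\Delta,\mu,\varepsilon)$ in $\mathrm{Rep}(D)$: (1) $\sum_{p\in\mathcal{G}_0}\sum_{g\in\Gamma^p}\rho(\gamma_g^{g})=\mathrm{id}_A$; (2) $\mathrm{Tr}\big(l_c\circ\rho(\gamma_{hgh^{-1}}^{h})\big)=\mathrm{Tr}\big(\rho(\gamma_h^{g^{-1}})\circ l_c\circ\rho(\gamma_h^{e_p})\big)$ for all $p\in\mathcal{G}_0$, all $g,h\in\Gamma^p$ and all $c\in\rho(\gamma_{ghg^{-1}h^{-1}}^{e_p})A$, where $\mathrm{Tr}$ is the trace and $l_c$ is the $k$-linear map defined by $l_c(v)=m(c\otimes v)$ for $v\in\rho(1^p)A$. Then every Frobenius object in $\mathrm{Rep}(D)$ satisfying (1) and (2) induces a $\mathcal{G}$-Frobenius algebra, namely its associated data $\langle\mathcal{G},(A,\bullet,\mathbf{1}_A),\eta,\varphi\rangle$ (defined in the context) is a $\mathcal{G}$-Frobenius algebra. Moreover every $\mathcal{G}$-Frobenius algebra is derived in this way from a Frobenius object in $\mathrm{Rep}(D)$ satisfying (1) and (2), i.e. it is equal to the associated data of some such Frobenius object.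
   Context: **Groupoid.** $\mathcal{G}$ has objects $\mathcal{G}_0$, morphisms $\mathcal{G}_1$, source and target maps $s,t$; $xy$ is defined iff $s(x)=t(y)$, and then $s(xy)=s(y)$, $t(xy)=t(x)$. For $p\in\mathcal{G}_0$, $e_p$ is the identity of $p$ and $\Gamma^p=\{g\in\mathcal{G}_1: s(g)=t(g)=p\}$. **The Drinfeld double.** $D=D(k[\mathcal{G}])$ is the $k$-vector space with basis $\{\gamma_g^x: g,x\in\mathcal{G}_1,\ s(g)=t(g)=t(x)\}$; product $\gamma_g^x\cdot\gamma_h^y=\delta_{x^{-1}gx,h}\,\gamma_g^{xy}$; unit $1=\sum_{p}1^p$ with $1^p=\sum_{g\in\Gamma^p}\gamma_g^{e_p}$; coproduct $\Delta_D(\gamma_g^x)=\sum_{g_1,g_2\in\Gamma^{t(x)},\,g_1g_2=g}\gamma_{g_1}^x\otimes\gamma_{g_2}^x$; counit $\varepsilon_D(\gamma_g^x)=\delta_{g,xx^{-1}}$; antipode $S(\gamma_g^x)=\gamma_{x^{-1}g^{-1}x}^{x^{-1}}$; R-matrix $R=\sum_{p}\sum_{g,h\in\Gamma^p}\gamma_g^{e_p}\otimes\gamma_h^{g}$. Write $\Delta_D(1)=1_{(1)}\otimes 1_{(2)}=\sum_p 1^p\otimes 1^p$. **$\mathrm{Rep}(D)$.** Objects are finite dimensional left $D$-modules $(\rho,A)$, morphisms are $D$-linear maps; write $h\rhd a=\rho(h)a$. For an object $A$ put $A^p=\rho(1^p)A$ and, for $g\in\Gamma^p$, $A^p_g=\rho(\gamma_g^{e_p})A$;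 one has $A=\bigoplus_pA^p$, $A^p=\bigoplus_{g\in\Gamma^p}A^p_g$. The monoidal product is $A\widehat{\otimes}B=\Delta_D(1)(A\otimes_kB)=\bigoplus_pA^p\otimes_kB^p$ with $D$ acting through $\Delta_D$; associators are trivial. The unit object $D_t$ is the image of $\varepsilon_t(h)=\varepsilon_D(1_{(1)}h)1_{(2)}$, with action $h\rhd z=\varepsilon_t(hz)$; concretely it has basis $\{1^p\}_{p\in\mathcal{G}_0}$. The unit maps are $l_A(1_{(1)}\rhd z\otimes1_{(2)}\rhd a)=z\rhd a$ and $r_A(1_{(1)}\rhd a\otimes1_{(2)}\rhd z)=S(z)\rhd a$; concretely $l_A(1^p\otimes a)=a=r_A(a\otimes1^p)$ for $a\in A^p$. The braiding is $c_{A,B}(a\otimes b)=R^{(2)}\rhd b\otimes R^{(1)}\rhd a$, where $R=R^{(1)}\otimes R^{(2)}$. **Frobenius objects.** A Frobenius object is $(A,m,\Delta,\mu,\varepsilon)$ with $A$ an object of $\mathrm{Rep}(D)$ and morphisms $m:A\widehat{\otimes}A\to A$, $\Delta:A\to A\widehat{\otimes}A$, $\mu:D_t\to A$, $\varepsilon:A\to D_t$ such that: $m(\mathrm{id}\otimes m)=m(m\otimes\mathrm{id})$, $m(\mu\otimes\mathrm{id})=l_A$, $m(\mathrm{id}\otimes\mu)=r_A$, $m\,c_{A,A}=m$; $(\mathrm{id}\otimes\Delta)\Delta=(\Delta\otimes\mathrm{id})\Delta$, $l_A(\varepsilon\otimes\mathrm{id})\Delta=\mathrm{id}_A=r_A(\mathrm{id}\otimes\varepsilon)\Delta$,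 $c_{A,A}\Delta=\Delta$; and $\Delta m=(m\otimes\mathrm{id})(\mathrm{id}\otimes\Delta)=(\mathrm{id}\otimes m)(\Delta\otimes\mathrm{id})$. **Associated data of a Frobenius object.** $a\bullet b=\sum_pm(a^p\otimes b^p)$ for $a=\sum a^p$, $b=\sum b^p$ with $a^p,b^p\in A^p$; $\mathbf{1}_A=\mu(1)=\sum_p\mu(1^p)$; $\varepsilon':A\to k$ is the linear map with $\varepsilon(a)=\sum_p\varepsilon'(a^p)1^p$, and $\eta(a,b)=\varepsilon'(a\bullet b)$; $\varphi(x)=\sum_{g\in\Gamma^{t(x)}}\rho(\gamma_g^x)|_{A^{s(x)}}$ for $x\in\mathcal{G}_1$. The grading of $A$ is by the subspaces $A^p$ and $A^p_g$. **$\mathcal{G}$-Frobenius algebras.** A $\mathcal{G}$-Frobenius algebra ($\mathcal{G}$-FA) is $\langle\mathcal{G},(A,\bullet,\mathbf{1}_A),\eta,\varphi\rangle$ where: $(A,\bullet,\mathbf{1}_A)$ is a finite dimensional unital associative $k$-algebra which is a direct sum of algebras $A=\bigoplus_{p\in\mathcal{G}_0}A^p$; $\eta:A\times A\to k$ is bilinear; $\varphi$ is a $\mathcal{G}$-action by algebra homomorphisms, i.e. $\varphi(x):A^{s(x)}\to A^{t(x)}$ is an algebra isomorphism for $x\in\mathcal{G}_1$, $\varphi(h)\varphi(g)=\varphi(hg)$ if $s(h)=t(g)$, and $\varphi(e_p)=\mathrm{id}_{A^p}$; and for all $p,q\in\mathcal{G}_0$: (i) $A^p=\bigoplus_{g\in\Gamma^p}A^p_g$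 is a $\Gamma^p$-graded algebra; (ii) for $a\in A^p$, $b\in A^q$: $a\bullet b=\delta_{p,q}\,a\bullet b\in A^p$; (iii) $\eta(a\bullet b,c)=\eta(a,b\bullet c)$; (iv) $\eta(\varphi(h)a,\varphi(h)b)=\eta(a,b)$ for $a,b\in A^p$, $s(h)=p$; (v) $\varphi(x)A^p_g\subset A^q_{xgx^{-1}}$ for $s(x)=p$, $t(x)=q$; (vi) for $g,h\in\Gamma^p$, $\eta|_{A^p_g\times A^p_h}$ is nondegenerate if $gh=e_p$ and zero otherwise; (vii) $a\bullet b=(\varphi(g)b)\bullet a\in A^p_{gh}$ for $a\in A^p_g$, $b\in A^p_h$; (viii) $\varphi(g)|_{A^p_g}=\mathrm{id}$; (ix) for $g,h\in\Gamma^p$, $c\in A^p_{ghg^{-1}h^{-1}}$ and $l_c$ left multiplication by $c$, $\mathrm{Tr}(l_c\circ\varphi(h)|_{A^p_g}:A^p_g\to A^p_g)=\mathrm{Tr}(\varphi(g^{-1})\circ l_c|_{A^p_h}:A^p_h\to A^p_h)$. *)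

(* Defs.v *)
From HB Require Import structures.
From mathcomp Require Import all_boot all_order all_algebra.

Set Implicit Arguments.
Unset Strict Implicit.
Unset Printing Implicit Defensive.

Import GRing.Theory VectorInternalTheory.
Local Open Scope ring_scope.

(* [gmul x y] is the composite xy, defined when [gsrc x = gtgt y]; the total
   function takes unspecified values on all other pairs. *)
Record finGroupoid := FinGroupoid {
  gob : finType;
  gmor : finType;
  gsrc : gmor -> gob;
  gtgt : gmor -> gob;
  gid : gob -> gmor;
  ginv : gmor -> gmor;
  gmul : gmor -> gmor -> gmor;
  gsrc_id : forall p, gsrc (gid p) = p;
  gtgt_id : forall p, gtgt (gid p) = p;
  gsrc_inv : forall x, gsrc (ginv x) = gtgt x;
  gtgt_inv : forall x, gtgt (ginv x) = gsrc x;
  gsrc_mul : forall x y, gsrc x = gtgt y -> gsrc (gmul x y) = gsrc y;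
  gtgt_mul : forall x y, gsrc x = gtgt y -> gtgt (gmul x y) = gtgt x;
  gmulA : forall x y z, gsrc x = gtgt y -> gsrc y = gtgt z ->
    gmul x (gmul y z) = gmul (gmul x y) z;
  gmul1x : forall x, gmul (gid (gtgt x)) x = x;
  gmulx1 : forall x, gmul x (gid (gsrc x)) = x;
  gmulVx : forall x, gmul (ginv x) x = gid (gsrc x);
  gmulxV : forall x, gmul x (ginv x) = gid (gtgt x)
}.

Declare Scope gpd_scope.
Delimit Scope gpd_scope with gpd.
Notation "x * y" := (gmul x y) : gpd_scope.
Notation "x ^-1" := (ginv x) : gpd_scope.

Definition vgroup (G : finGroupoid) (p : gob G) : pred (gmor G) :=
  [pred g | (gsrc g == p) && (gtgt g == p)].

Section GroupoidTheory.
Variable G : finGroupoid.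
Implicit Types x y g h : gmor G.

Lemma vgroupP p g : reflect (gsrc g = p /\ gtgt g = p) (g \in vgroup p).
Proof. by apply: (iffP andP) => [[/eqP-> /eqP->]|[-> ->]]. Qed.

Lemma gconj_src x g : gsrc g = gtgt x -> gtgt g = gtgt x ->
  (gsrc (x^-1 * (g * x)) = gsrc x)%gpd.
Proof. by move=> sg tg; rewrite !gsrc_mul ?gsrc_inv ?gtgt_mul. Qed.

Lemma gconj_tgt x g : gsrc g = gtgt x -> gtgt g = gtgt x ->
  (gtgt (x^-1 * (g * x)) = gsrc x)%gpd.
Proof. by move=> sg tg; rewrite gtgt_mul ?gtgt_inv // gsrc_inv gtgt_mul. Qed.

Lemma gmulKx x y : gsrc x = gtgt y -> (x^-1 * (x * y) = y)%gpd.
Proof. by move=> xy; rewrite gmulA ?gsrc_inv // gmulVx xy gmul1x. Qed.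

Lemma ginvM x y : gsrc x = gtgt y -> ((x * y)^-1 = y^-1 * x^-1)%gpd.
Proof.
move=> xy; have yx : gsrc (y^-1)%gpd = gtgt (x^-1)%gpd by rewrite gsrc_inv gtgt_inv.
have E : ((x * y) * (y^-1 * x^-1) = gid (gtgt x))%gpd.
  rewrite -gmulA ?gtgt_mul ?gtgt_inv ?gsrc_inv // (gmulA (x := y)) ?yx ?gtgt_inv //.
  by rewrite gmulxV -xy -gtgt_inv gmul1x gmulxV.
have := gmulKx (x := (x * y)%gpd) (y := (y^-1 * x^-1)%gpd).
rewrite E gsrc_mul // gtgt_mul // gtgt_inv => <- //.
by rewrite -(gtgt_mul xy) -gsrc_inv gmulx1.
Qed.

End GroupoidTheory.

Section Tensor.
Variable k : fieldType.
Implicit Types A B C : vectType k.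

(* A ⊗ B in coordinates; [tliftE] and [tens_ext] are its universal property. *)
Definition tens A B : Type := 'M[k]_(dim A, dim B).
HB.instance Definition _ A B := Vector.on (tens A B).

Definition tpure A B (a : A) (b : B) : tens A B := (v2r a)^T *m v2r b.

Definition tlift A B C (f : A -> B -> C) : 'Hom(tens A B, C) :=
  linfun (fun t : tens A B => \sum_i \sum_j
    t i j *: f (r2v (delta_mx 0 i)) (r2v (delta_mx 0 j))).

(* The matrix of [f : 'End(A)] in the standard basis of [A] is [f2mx f]. *)
Definition lftr A (f : 'End(A)) : k := \tr (f2mx f).

(* The trace of the restriction of f to U, for f mapping U to itself. *)
Definition lftr_on A (U : {vspace A}) (f : 'End(A)) : k :=
  lftr (linfun (fun u : subvs_of U => vsproj U (f (vsval u)))).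

End Tensor.

Notation "a \ot b" := (tpure a b) (at level 40, left associativity).

Section TensorTheory.
Variable k : fieldType.
Implicit Types A B C : vectType k.

Lemma tlift_linear A B C (f : A -> B -> C) : linear (fun t : tens A B => \sum_i \sum_j
    t i j *: f (r2v (delta_mx 0 i)) (r2v (delta_mx 0 j))).
Proof.
move=> c t u; rewrite scaler_sumr -big_split /=; apply: eq_bigr => i _.
rewrite scaler_sumr -big_split /=; apply: eq_bigr => j _.
by rewrite !mxE scalerDl scalerA.
Qed.

Lemma linfunE A B (f : A -> B) : linear f -> linfun f =1 f.
Proof.
move=> fL.
pose fM := GRing.isLinear.Build _ _ _ _ f fL.
pose f' : {linear A -> B} := HB.pack f fM.
exact: (lfunE f').
Qed.

Lemma vect_delta A (a : A) : a = \sum_i (v2r a) 0 i *: r2v (delta_mx 0 i).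
Proof.
rewrite -[LHS]v2rK {1}(row_sum_delta (v2r a)) linear_sum.
by apply: eq_bigr => i _; rewrite linearZ.
Qed.

Lemma tliftE A B C (f : A -> B -> C) (a : A) (b : B) :
  (forall a', linear (f a')) -> (forall b', linear (f^~ b')) ->
  tlift f (a \ot b) = f a b.
Proof.
move=> fr fl; rewrite linfunE; last exact: tlift_linear.
pose g a' : 'Hom(B, C) := linfun (f a').
have gE a' b' : g a' b' = f a' b' by rewrite linfunE.
pose h b' : 'Hom(A, C) := linfun (f^~ b').
have hE a' b' : h b' a' = f a' b' by rewrite linfunE.
rewrite -[f a b]hE {2}(vect_delta a) linear_sum; apply: eq_bigr => i _.
rewrite linearZ /= hE -[in RHS]gE {2}(vect_delta b) linear_sum scaler_sumr.
apply: eq_bigr => j _; rewrite linearZ scalerA /= gE; congr (_ *: _).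
by rewrite /tpure mxE big_ord1 mxE.
Qed.

Lemma tpure_linearr A B (a : A) : linear (fun b : B => a \ot b).
Proof. by move=> c b b'; rewrite /tpure linearP mulmxDr scalemxAr. Qed.

Lemma tpure_linearl A B (b : B) : linear (fun a : A => a \ot b).
Proof. by move=> c a a'; rewrite /tpure linearP linearP /= mulmxDl scalemxAl. Qed.

Lemma tens_ext A B C (f g : 'Hom(tens A B, C)) :
  (forall a b, f (a \ot b) = g (a \ot b)) -> f = g.
Proof.
move=> fg; apply/lfunP => t.
have -> : t = \sum_i \sum_j
    t i j *: ((r2v (delta_mx 0 i) : A) \ot (r2v (delta_mx 0 j) : B)).
  rewrite [LHS]matrix_sum_delta; apply: eq_bigr => i _; apply: eq_bigr => j _.
  by rewrite /tpure !r2vK trmx_delta mul_delta_mx.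
rewrite !linear_sum; apply: eq_bigr => i _; rewrite !linear_sum.
by apply: eq_bigr => j _; rewrite !linearZ /= fg.
Qed.

End TensorTheory.

Definition dbl_adm (G : finGroupoid) (gx : gmor G * gmor G) : bool :=
  (gsrc gx.1 == gtgt gx.1) && (gtgt gx.1 == gtgt gx.2).

Definition dbl_index (G : finGroupoid) := {gx : gmor G * gmor G | dbl_adm gx}.

(* An alias, so that D does not inherit the pointwise product of functions. *)
Definition dbl (k : fieldType) (G : finGroupoid) : Type :=
  {ffun dbl_index G -> k^o}.
HB.instance Definition _ k G := Vector.on (dbl k G).

Section Double.
Variables (k : fieldType) (G : finGroupoid).
Local Notation D := (dbl k G).
Implicit Types (g h x y : gmor G) (u v w : D).

(* γ_g^x, and 0 when (g, x) is not an index of the basis. *)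
Definition dgamma g x : D := [ffun i => (val i == (g, x))%:R].

Definition dlift (V : lmodType k) (f : gmor G -> gmor G -> V) (u : D) : V :=
  \sum_i u i *: f (val i).1 (val i).2.

Lemma dlift_linear (V : lmodType k) (f : gmor G -> gmor G -> V) :
  linear (dlift f).
Proof.
move=> c u v; rewrite /dlift scaler_sumr -big_split /=; apply: eq_bigr => i _.
by rewrite !ffunE scalerDl scalerA.
Qed.

Lemma dgamma0 g x : ~~ dbl_adm (g, x) -> dgamma g x = 0.
Proof.
move=> gx; apply/ffunP=> i; rewrite !ffunE; case: eqP => // e.
by move: (valP i) gx; rewrite -e => ->.
Qed.

Lemma dlift_gamma (V : lmodType k) (f : gmor G -> gmor G -> V) g x :
  dlift f (dgamma g x) = if dbl_adm (g, x) then f g x else 0.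
Proof.
case: ifPn => [gx|/dgamma0->]; last first.
  by rewrite /dlift big1 // => i _; rewrite ffunE scale0r.
rewrite /dlift (bigD1 (Sub (g, x) gx : dbl_index G)) //= ffunE eqxx scale1r.
rewrite big1 ?addr0 // => i; rewrite ffunE -(inj_eq val_inj) /= => /negPf->.
exact: scale0r.
Qed.

Lemma dlift_id u : dlift dgamma u = u.
Proof.
apply/ffunP=> i; rewrite /dlift sum_ffunE (bigD1 i) //= !ffunE.
rewrite -surjective_pairing eqxx big1 ?addr0 => [|j ji]; first exact: mulr1.
rewrite !ffunE -surjective_pairing (inj_eq val_inj) eq_sym (negPf ji).
exact: mulr0.
Qed.

Lemma dbl_ext (V : lmodType k) (f f' : D -> V) : linear f -> linear f' ->
  (forall g x, dbl_adm (g, x) -> f (dgamma g x) = f' (dgamma g x)) -> f =1 f'.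
Proof.
move=> fL fL' ff' u.
pose F : {linear D -> V} := HB.pack f (GRing.isLinear.Build _ _ _ _ f fL).
pose F' : {linear D -> V} := HB.pack f' (GRing.isLinear.Build _ _ _ _ f' fL').
rewrite -[u]dlift_id -[f]/(F : D -> V) -[f']/(F' : D -> V) /dlift !linear_sum.
apply: eq_bigr => i _; rewrite !linearZ /= ff' // -surjective_pairing.
exact: valP.
Qed.

Definition dmul u v : D :=
  dlift (fun g x => dlift (fun h y =>
    if (x^-1 * (g * x) == h)%gpd then dgamma g (x * y)%gpd else 0) v) u.

Definition dunit1 (p : gob G) : D := \sum_(g in vgroup p) dgamma g (gid p).
Definition dunit : D := \sum_p dunit1 p.

Lemma dmul_linearl v : linear (dmul^~ v).
Proof. exact: dlift_linear. Qed.

Lemma dlift_linearr (U V : lmodType k) (f : gmor G -> gmor G -> U -> V) u :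
  (forall g x, linear (f g x)) -> linear (fun a => dlift (fun g x => f g x a) u).
Proof.
move=> fL c a b; rewrite /dlift scaler_sumr -big_split /=.
apply: eq_bigr => i _.
by rewrite fL scalerDr !scalerA mulrC.
Qed.

Lemma dmul_linearr u : linear (dmul u).
Proof. by apply: dlift_linearr => g x; apply: dlift_linear. Qed.

Lemma dmul_gamma g x h y : dbl_adm (g, x) -> dbl_adm (h, y) ->
  dmul (dgamma g x) (dgamma h y) =
  if (x^-1 * (g * x) == h)%gpd then dgamma g (x * y)%gpd else 0.
Proof. by move=> gx hy; rewrite /dmul !dlift_gamma gx hy. Qed.

Lemma dbl_admP g x : reflect (gsrc g = gtgt x /\ gtgt g = gtgt x) (dbl_adm (g, x)).
Proof.
by apply: (iffP andP) => /= [[/eqP-> /eqP->]|[-> ->]]; rewrite ?eqxx.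
Qed.

Lemma dmul_adm g x h y : dbl_adm (g, x) -> dbl_adm (h, y) ->
  (x^-1 * (g * x) == h)%gpd -> gsrc x = gtgt y /\ dbl_adm (g, (x * y)%gpd).
Proof.
move=> /dbl_admP[sg tg] /dbl_admP[sh th] /eqP e.
have xy : gsrc x = gtgt y by rewrite -th -e gconj_tgt.
by split=> //; apply/dbl_admP; rewrite gtgt_mul.
Qed.

Lemma gconjM g x y : dbl_adm (g, x) -> gsrc x = gtgt y ->
  ((x * y)^-1 * (g * (x * y)) = y^-1 * ((x^-1 * (g * x)) * y))%gpd.
Proof.
move=> /dbl_admP[sg tg] xy; rewrite ginvM //.
have yx : gsrc y^-1%gpd = gtgt x^-1%gpd by rewrite gsrc_inv gtgt_inv.
rewrite -[LHS]gmulA ?gsrc_inv ?gtgt_mul ?gtgt_inv //.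
rewrite -(gmulA (x := (x^-1)%gpd)) ?gsrc_inv ?gsrc_mul ?gtgt_mul //.
by rewrite -(gmulA (x := g)).
Qed.

Lemma dmulA : associative dmul.
Proof.
move=> u v w.
pose F u' v' w' := dmul u' (dmul v' w'); pose F' u' v' w' := dmul (dmul u' v') w'.
rewrite -[LHS]/(F u v w) -[RHS]/(F' u v w).
apply: (@dbl_ext _ (F^~ v ^~ w) (F'^~ v ^~ w)) => [c a b|c a b|g x gx].
- exact: dmul_linearl.
- by rewrite /F' !dmul_linearl.
apply: (@dbl_ext _ (F (dgamma g x) ^~ w) (F' (dgamma g x) ^~ w)) => [c a b|c a b|h y hy].
- by rewrite /F dmul_linearl dmul_linearr.
- by rewrite /F' dmul_linearr dmul_linearl.
apply: (@dbl_ext _ (F (dgamma g x) (dgamma h y)) (F' (dgamma g x) (dgamma h y)))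
   => [c a b|c a b|f z fz].
- by rewrite /F !dmul_linearr.
- exact: dmul_linearr.
rewrite /F /F' !dmul_gamma //.
have d0l a : dmul 0 a = 0.
  by rewrite /dmul /dlift big1 // => i _; rewrite ffunE scale0r.
have d0r a : dmul a 0 = 0.
  by have := dmul_linearr a (-1) 0 0; rewrite scaler0 addr0 scaleN1r addNr.
case: ifP => e1; case: ifP => e2; rewrite ?d0l ?d0r //.
- have [xy gxy] := dmul_adm gx hy e2; have [yz hyz] := dmul_adm hy fz e1.
  rewrite !dmul_gamma // e2 gconjM // (eqP e2) e1; congr dgamma.
  exact: gmulA.
- have [yz hyz] := dmul_adm hy fz e1.
  by rewrite dmul_gamma // e2.
have [xy gxy] := dmul_adm gx hy e2.
by rewrite dmul_gamma // gconjM // (eqP e2) e1.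
Qed.

Lemma dmul1_gamma p g x : dbl_adm (g, x) ->
  dmul (dunit1 p) (dgamma g x) = (gtgt x == p)%:R *: dgamma g x.
Proof.
move=> gx; have [sg tg] := dbl_admP _ _ gx.
pose m : {linear D -> D} := HB.pack (dmul^~ (dgamma g x))
  (GRing.isLinear.Build _ _ _ _ _ (dmul_linearl (dgamma g x))).
rewrite -[LHS]/(m (dunit1 p)) /dunit1 linear_sum.
have adm h : h \in vgroup p -> dbl_adm (h, gid p).
  by move=> /vgroupP[sh th]; apply/dbl_admP; rewrite gtgt_id.
have cj h : h \in vgroup p -> ((gid p)^-1 * (h * gid p) = h)%gpd.
  move=> /vgroupP[sh th]; rewrite -{2}sh gmulx1.
  have i1 : ((gid p)^-1 = gid p)%gpd.
    by rewrite -[LHS]gmulx1 gsrc_inv gtgt_id gmulVx gsrc_id.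
  by rewrite i1 -th gmul1x.
rewrite (eq_bigr (fun h => if h == g then dgamma h (gid p * x)%gpd else 0)); last first.
  by move=> h hp /=; rewrite dmul_gamma ?adm // cj.
case: eqP => [tx|/eqP tx].
  have gp : g \in vgroup p by apply/vgroupP; rewrite sg tg.
  rewrite (bigD1 g) //= eqxx -tx gmul1x scale1r big1 ?addr0 // => h /andP[_ /negPf->].
  by [].
rewrite scale0r big1 // => h /vgroupP[sh th]; case: eqP => // e.
by rewrite -e th in tg; rewrite tg eqxx in tx.
Qed.

Lemma dmul1_gammar p g x : dbl_adm (g, x) ->
  dmul (dgamma g x) (dunit1 p) = (gsrc x == p)%:R *: dgamma g x.
Proof.
move=> gx; have [sg tg] := dbl_admP _ _ gx.
pose m : {linear D -> D} := HB.pack (dmul (dgamma g x))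
  (GRing.isLinear.Build _ _ _ _ _ (dmul_linearr (dgamma g x))).
rewrite -[LHS]/(m (dunit1 p)) /dunit1 linear_sum.
have adm h : h \in vgroup p -> dbl_adm (h, gid p).
  by move=> /vgroupP[sh th]; apply/dbl_admP; rewrite gtgt_id.
rewrite (eq_bigr (fun h => if (x^-1 * (g * x) == h)%gpd
   then dgamma g (x * gid p)%gpd else 0)); last first.
  by move=> h hp /=; rewrite dmul_gamma ?adm.
case: eqP => [sx|/eqP sx].
  have gp : (x^-1 * (g * x))%gpd \in vgroup p.
    by apply/vgroupP; rewrite gconj_src // gconj_tgt.
  rewrite (bigD1 _ gp) /= eqxx -sx gmulx1 scale1r big1 ?addr0 // => h.
  by rewrite eq_sym => /andP[_ /negPf->].
rewrite scale0r big1 // => h /vgroupP[sh th]; case: eqP => // e.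
by rewrite -th -e gconj_tgt // eqxx in sx.
Qed.

Lemma dmul1x : left_id dunit dmul.
Proof.
apply: (@dbl_ext _ (dmul dunit) id) => [||g x gx]; rewrite ?/id //.
  exact: dmul_linearr.
pose m : {linear D -> D} := HB.pack (dmul^~ (dgamma g x))
  (GRing.isLinear.Build _ _ _ _ _ (dmul_linearl (dgamma g x))).
rewrite -[LHS]/(m dunit) /dunit linear_sum /= (bigD1 (gtgt x)) //=.
rewrite dmul1_gamma // eqxx scale1r big1 ?addr0 // => p.
by rewrite dmul1_gamma // eq_sym => /negPf->; rewrite scale0r.
Qed.

Lemma dmulx1 : right_id dunit dmul.
Proof.
apply: (@dbl_ext _ (dmul^~ dunit) id) => [||g x gx]; rewrite ?/id //.
  exact: dmul_linearl.
pose m : {linear D -> D} := HB.pack (dmul (dgamma g x))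
  (GRing.isLinear.Build _ _ _ _ _ (dmul_linearr (dgamma g x))).
rewrite -[LHS]/(m dunit) /dunit linear_sum /= (bigD1 (gsrc x)) //=.
rewrite dmul1_gammar // eqxx scale1r big1 ?addr0 // => p.
by rewrite dmul1_gammar // eq_sym => /negPf->; rewrite scale0r.
Qed.

Lemma dmulDl : left_distributive dmul +%R.
Proof. by move=> u v w; have := dmul_linearl w 1 u v; rewrite !scale1r. Qed.

Lemma dmulDr : right_distributive dmul +%R.
Proof. by move=> u v w; have := dmul_linearr u 1 v w; rewrite !scale1r. Qed.

HB.instance Definition _ :=
  GRing.Zmodule_isPzRing.Build D dmulA dmul1x dmulx1 dmulDl dmulDr.

Definition dcop : D -> tens D D := dlift (fun g x =>
  \sum_(g1 in vgroup (gtgt x)) \sum_(g2 in vgroup (gtgt x) | (g1 * g2 == g)%gpd)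
    dgamma g1 x \ot dgamma g2 x).

Definition dcounit : D -> k^o := dlift (fun g x => (g == x * x^-1)%gpd%:R).

Definition dantipode : D -> D := dlift (fun g x =>
  dgamma (x^-1 * (g^-1 * x))%gpd (x^-1)%gpd).

Definition dRmx : tens D D :=
  \sum_p \sum_(g in vgroup p) \sum_(h in vgroup p)
    dgamma g (gid p) \ot dgamma h g.

End Double.
Arguments dgamma {k G}.
Arguments dunit1 k {G}.
Arguments dRmx {k G}.

Section TensorMap.
Variable k : fieldType.
Implicit Types A B C : vectType k.

Definition tmap A A' B B' (f : 'Hom(A, A')) (g : 'Hom(B, B')) :
    'Hom(tens A B, tens A' B') :=
  tlift (fun a b => f a \ot g b).

Definition tswap A B : 'Hom(tens A B, tens B A) := tlift (fun a b => b \ot a).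

Definition tassoc A B C : 'Hom(tens (tens A B) C, tens A (tens B C)) :=
  tlift (fun ab c => tlift (fun a b => a \ot (b \ot c)) ab).

Definition tassocV A B C : 'Hom(tens A (tens B C), tens (tens A B) C) :=
  tlift (fun a bc => tlift (fun b c => (a \ot b) \ot c) bc).

Lemma tpure_bilinl A B C (f : 'Hom(A, B)) (b : C) : linear (fun a => f a \ot b).
Proof. by move=> c a a'; rewrite linearP tpure_linearl. Qed.

Lemma tpure_bilinr A B C (f : 'Hom(A, B)) (b : C) : linear (fun a => b \ot f a).
Proof. by move=> c a a'; rewrite linearP tpure_linearr. Qed.

Lemma tmapE A A' B B' (f : 'Hom(A, A')) (g : 'Hom(B, B')) a b :
  tmap f g (a \ot b) = f a \ot g b.
Proof.
by rewrite /tmap tliftE // => ?; [apply: tpure_bilinr | apply: tpure_bilinl].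
Qed.

Lemma tswapE A B (a : A) (b : B) : tswap A B (a \ot b) = b \ot a.
Proof.
by rewrite /tswap tliftE // => ?; [apply: tpure_linearl | apply: tpure_linearr].
Qed.

Lemma tlift_linear_param A B C (U : vectType k) (F : U -> A -> B -> C) t :
  (forall a b, linear (fun u => F u a b)) -> linear (fun u => tlift (F u) t).
Proof.
move=> FL c u v; rewrite !linfunE; try exact: tlift_linear.
rewrite scaler_sumr -big_split /=; apply: eq_bigr => i _.
rewrite scaler_sumr -big_split /=; apply: eq_bigr => j _.
by rewrite FL scalerDr !scalerA mulrC.
Qed.

Lemma tassocE A B C (a : A) (b : B) (c : C) :
  tassoc A B C ((a \ot b) \ot c) = a \ot (b \ot c).
Proof.
rewrite /tassoc tliftE => [|ab|c']; last by move=> s u v; rewrite linearP.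
  by rewrite tliftE // => ? s u v; rewrite ?tpure_linearl ?tpure_linearr.
apply: tlift_linear_param => a' b' s u v.
by rewrite !tpure_linearr.
Qed.

Lemma tassocVE A B C (a : A) (b : B) (c : C) :
  tassocV A B C (a \ot (b \ot c)) = (a \ot b) \ot c.
Proof.
rewrite /tassocV tliftE => [|ab|c']; first 1 last.
- by move=> s u v; rewrite linearP.
- apply: tlift_linear_param => a' b' s u v.
  by rewrite !tpure_linearl.
by rewrite tliftE // => ? s u v; rewrite ?tpure_linearr ?tpure_linearl.
Qed.

Lemma tmap_comp A A' A'' B B' B'' (f : 'Hom(A', A'')) (f' : 'Hom(A, A'))
    (g : 'Hom(B', B'')) (g' : 'Hom(B, B')) :
  tmap (f \o f')%VF (g \o g')%VF = (tmap f g \o tmap f' g')%VF.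
Proof. by apply: tens_ext => a b; rewrite comp_lfunE !tmapE !comp_lfunE. Qed.

End TensorMap.

Section Rep.
Variables (k : fieldType) (G : finGroupoid).
Local Notation D := (dbl k G).

Record dmodule (V : vectType k) := DModule {
  dact : 'Hom(D, 'End(V));
  dact1 : dact 1 = \1%VF;
  dactM : forall u v : D, dact (u * v) = (dact u \o dact v)%VF
}.

Record rep := Rep { rep_sort :> vectType k; rep_mod : dmodule rep_sort }.

Definition ract (A : rep) : 'Hom(D, 'End(A)) := dact (rep_mod A).

Definition dlinear (A B : rep) (f : 'Hom(A, B)) : Prop :=
  forall (h : D) (a : A), f (ract A h a) = ract B h (f a).

Definition tact (A B : rep) : 'Hom(tens D D, 'End(tens A B)) :=
  tlift (fun u v => tmap (ract A u) (ract B v)).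

Definition ttens_space (A B : rep) : {vspace tens A B} :=
  limg (tact A B (dcop 1)).

(* [trunc] is a ⊗ b |-> Δ(1)(a ⊗ b), and [tincl] is the inclusion of the
   truncated tensor product in the full one. *)
Definition trunc (A B : rep) : 'Hom(tens A B, subvs_of (ttens_space A B)) :=
  linfun (fun t => vsproj (ttens_space A B) (tact A B (dcop 1) t)).
Definition tincl (A B : rep) : 'Hom(subvs_of (ttens_space A B), tens A B) :=
  linfun (@vsval _ _ (ttens_space A B)).

Definition ttens_act (A B : rep) : 'Hom(D, 'End(subvs_of (ttens_space A B))) :=
  linfun (fun h : D => (trunc A B \o tact A B (dcop h) \o tincl A B)%VF).

Definition deps_t (h : D) : D :=
  tlift (fun u v : D => dcounit (u * h) *: v) (dcop 1).

Definition dt_space : {vspace D} := limg (linfun deps_t).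

Definition dt_act : 'Hom(D, 'End(subvs_of dt_space)) :=
  linfun (fun h : D => linfun (fun z : subvs_of dt_space =>
    vsproj dt_space (deps_t (h * vsval z)))).

Lemma dcop_linear : linear (@dcop k G). Proof. exact: dlift_linear. Qed.

Lemma dcop_gamma g x : dbl_adm (g, x) -> dcop (dgamma g x : D) =
  \sum_(g1 in vgroup (gtgt x)) \sum_(g2 in vgroup (gtgt x) | (g1 * g2 == g)%gpd)
    dgamma g1 x \ot dgamma g2 x.
Proof. by move=> gx; rewrite /dcop dlift_gamma gx. Qed.

Lemma vgroupM p (g h : gmor G) :
  g \in vgroup p -> h \in vgroup p -> (g * h)%gpd \in vgroup p.
Proof.
move=> /vgroupP[sg tg] /vgroupP[sh th]; apply/vgroupP.
by rewrite gsrc_mul ?gtgt_mul ?sg.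
Qed.

Lemma dbl_adm_vgroup g (x : gmor G) : (g \in vgroup (gtgt x)) = dbl_adm (g, x).
Proof. by apply/vgroupP/dbl_admP. Qed.

Lemma dcop_linear_sum I (r : seq I) (P : pred I) (F : I -> D) :
  dcop (\sum_(i <- r | P i) F i) = \sum_(i <- r | P i) dcop (F i).
Proof.
pose m : {linear D -> tens D D} :=
  HB.pack (@dcop k G) (GRing.isLinear.Build _ _ _ _ _ dcop_linear).
by rewrite -[LHS]/(m _) linear_sum.
Qed.

Lemma tpure_suml (A B : vectType k) I (r : seq I) (P : pred I) (F : I -> A) (b : B) :
  (\sum_(i <- r | P i) F i) \ot b = \sum_(i <- r | P i) (F i \ot b) :> tens A B.
Proof.
pose m : {linear A -> tens A B} :=
  HB.pack (fun a => a \ot b) (GRing.isLinear.Build _ _ _ _ _ (tpure_linearl b)).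
by rewrite -[LHS]/(m _) linear_sum.
Qed.

Lemma tpure_sumr (A B : vectType k) I (r : seq I) (P : pred I) (F : I -> B) (a : A) :
  a \ot (\sum_(i <- r | P i) F i) = \sum_(i <- r | P i) (a \ot F i) :> tens A B.
Proof.
pose m : {linear B -> tens A B} :=
  HB.pack (fun b => a \ot b) (GRing.isLinear.Build _ _ _ _ _ (tpure_linearr a)).
by rewrite -[LHS]/(m _) linear_sum.
Qed.

Lemma dcop1 : dcop (1 : D) = \sum_p dunit1 k p \ot dunit1 k p.
Proof.
rewrite -[1]/(dunit k G) /dunit dcop_linear_sum; apply: eq_bigr => p _.
rewrite /dunit1 dcop_linear_sum.
under eq_bigr => g gp.
  rewrite dcop_gamma ?gtgt_id; last by rewrite -dbl_adm_vgroup gtgt_id.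
  over.
rewrite exchange_big tpure_suml; apply: eq_bigr => g1 g1p.
rewrite tpure_sumr (exchange_big_dep (mem (vgroup p))) //=; last first.
  by move=> g i _ /andP[].
apply: eq_bigr => g2 g2p.
rewrite (big_pred1 (g1 * g2)%gpd) // => g /=.
rewrite -!topredE /= [_ == g]eq_sym; case: (g =P _) => [->|]; last by rewrite !andbF.
by rewrite andbT; apply/andP; split; [exact: vgroupM g1p g2p | exact: g2p].
Qed.

Lemma tact_pure A B u v : tact A B (u \ot v) = tmap (ract A u) (ract B v).
Proof.
rewrite /tact tliftE // => w c a b; apply: tens_ext => s t;
by rewrite add_lfunE scale_lfunE !tmapE linearP add_lfunE scale_lfunE
  ?tpure_linearr ?tpure_linearl.
Qed.

Lemma ract_M A u v : ract A (u * v) = (ract A u \o ract A v)%VF.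
Proof. exact: dactM. Qed.

Lemma ract_1 A : ract A 1 = \1%VF.
Proof. exact: dact1. Qed.

Lemma tact_cop_linear A B : linear (fun h => tact A B (dcop h)).
Proof. by move=> c u v; rewrite dcop_linear linearP. Qed.

Lemma tact_copM A B u v :
  tact A B (dcop (u * v)) = (tact A B (dcop u) \o tact A B (dcop v))%VF.
Proof.
pose F u v := tact A B (dcop (u * v)).
pose F' u v := (tact A B (dcop u) \o tact A B (dcop v))%VF.
rewrite -[LHS]/(F u v) -[RHS]/(F' u v).
apply: (@dbl_ext _ _ _ (F^~ v) (F'^~ v)) => [c a b|c a b|g x gx].
- by rewrite /F -tact_cop_linear; congr (tact _ _ (dcop _)); exact: dmul_linearl.
- rewrite /F'; have -> := tact_cop_linear A B c a b.
  by rewrite comp_lfunDl comp_lfunZl.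
apply: (@dbl_ext _ _ _ (F (dgamma g x)) (F' (dgamma g x))) => [c a b|c a b|h y hy].
- by rewrite /F -tact_cop_linear; congr (tact _ _ (dcop _)); exact: dmul_linearr.
- rewrite /F'; have -> := tact_cop_linear A B c a b.
  by rewrite comp_lfunDr comp_lfunZr.
have adm (c z : gmor G) : c \in vgroup (gtgt z) -> dbl_adm (c, z).
  by rewrite dbl_adm_vgroup.
have ty : h \in vgroup (gtgt y) by rewrite dbl_adm_vgroup.
have gV : g \in vgroup (gtgt x) by rewrite dbl_adm_vgroup.
have cjV c : c \in vgroup (gtgt x) -> (x^-1 * (c * x))%gpd \in vgroup (gsrc x).
  by move=> /vgroupP[sc tc]; apply/vgroupP; rewrite gconj_src ?gconj_tgt.
have cjM c d : c \in vgroup (gtgt x) -> d \in vgroup (gtgt x) ->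
    ((x^-1 * (c * x)) * (x^-1 * (d * x)) = x^-1 * ((c * d) * x))%gpd.
  move=> /vgroupP[sc tc] /vgroupP[sd td].
  have tdx : gtgt (d * x)%gpd = gtgt x by rewrite gtgt_mul.
  have tcx : gtgt (c * x)%gpd = gtgt x by rewrite gtgt_mul.
  have scx : gsrc (c * x)%gpd = gsrc x by rewrite gsrc_mul.
  have ti : gtgt (x^-1 * (d * x))%gpd = gsrc x.
    by rewrite gtgt_mul ?gtgt_inv // gsrc_inv tdx.
  rewrite -gmulA ?gsrc_inv ?tcx ?scx ?ti //; congr (_ * _)%gpd.
  rewrite -gmulA ?sc ?ti // (gmulA (x := x)) ?gtgt_inv ?gsrc_inv ?tdx //.
  by rewrite gmulxV -tdx gmul1x gmulA // sc td.
apply: tens_ext => a b; rewrite /F /F' -[dgamma g x * _]/(dmul _ _) comp_lfunE.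
pose X c := ract A (dgamma c (x * y)%gpd) a; pose Y c := ract B (dgamma c (x * y)%gpd) b.
transitivity (\sum_(g1 in vgroup (gtgt x)) \sum_(g2 in vgroup (gtgt x) |
    (g1 * g2 == g)%gpd) if (x^-1 * (g * x) == h)%gpd then X g1 \ot Y g2 else 0).
  rewrite dmul_gamma //; case: ifP => e; last first.
    have := dcop_linear (-1) 0 0; rewrite scaler0 addr0 scaleN1r addNr => ->.
    by rewrite linear0 lfunE big1 // => g1 _; rewrite big1.
  have [xy gxy] := dmul_adm gx hy e.
  rewrite dcop_gamma // gtgt_mul // linear_sum /= sum_lfunE; apply: eq_bigr => g1 _.
  rewrite linear_sum /= sum_lfunE; apply: eq_bigr => g2 _.
  by rewrite /= tact_pure tmapE.
rewrite !dcop_gamma //.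
have TE (z z' : gmor G) t :
 tact A B (\sum_(g1 in vgroup (gtgt z)) \sum_(g2 in vgroup (gtgt z) | (g1 * g2 == z')%gpd)
    dgamma g1 z \ot dgamma g2 z) t =
   \sum_(g1 in vgroup (gtgt z)) \sum_(g2 in vgroup (gtgt z) | (g1 * g2 == z')%gpd)
    tmap (ract A (dgamma g1 z)) (ract B (dgamma g2 z)) t.
  rewrite linear_sum /= sum_lfunE; apply: eq_bigr => g1 _.
  by rewrite linear_sum /= sum_lfunE; apply: eq_bigr => g2 _; rewrite tact_pure.
rewrite !TE //; apply: eq_bigr => g1 g1x; apply: eq_bigr => g2 /andP[g2x /eqP g12].
rewrite linear_sum /=.
under eq_bigr => h1 h1y.
  rewrite linear_sum /=.
  under eq_bigr => h2 /andP[h2y _].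
    rewrite !tmapE -!comp_lfunE -!ract_M -[_ * dgamma h1 _]/(dmul _ _)
        -[_ * dgamma h2 _]/(dmul _ _) !dmul_gamma ?adm //.
    over.
  over.
rewrite -g12 -cjM //.
set c1 := (x^-1 * (g1 * x))%gpd; set c2 := (x^-1 * (g2 * x))%gpd.
have r0 (C : rep) (c : C) : ract C 0 c = 0 by rewrite linear0 lfunE.
have t0l (w : B) : 0 \ot w = 0 :> tens A B.
  by rewrite /tpure linear0 trmx0 mul0mx.
have t0r (w : A) : w \ot 0 = 0 :> tens A B.
  by rewrite /tpure linear0 mulmx0.
have [c1y|c1y] := boolP (c1 \in vgroup (gtgt y)); last first.
  rewrite ifN; last first.
    apply: contra c1y => /eqP e; have /vgroupP[s1 t1] := cjV _ g1x.
    have /vgroupP[s2 t2] := cjV _ g2x.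
    have /vgroupP[s3 t3] := ty; apply/vgroupP.
    rewrite -e gtgt_mul ?s1 // in t3; rewrite -/c1 in s1 t1; split; congruence.
  rewrite big1 // => h1 h1y; rewrite big1 // => h2 _.
  rewrite ifN ?r0 ?t0l //; apply: contra c1y => /eqP->.
  by [].
have xy : gsrc x = gtgt y.
  by have /vgroupP[_ <-] := c1y; have /vgroupP[_ ->] := cjV _ g1x.
have c2y : c2 \in vgroup (gtgt y) by rewrite -xy cjV.
rewrite (bigD1 c1) //= [X in _ + X]big1 ?addr0; last first.
  move=> h1 /andP[_ h1c]; rewrite big1 // => h2 _.
  by rewrite eq_sym (negPf h1c) r0 t0l.
case: ifP => e.
  rewrite (bigD1 c2) ?e ?andbT //= !eqxx [X in _ + X]big1 ?addr0 //.
  by move=> h2 /andP[_ h2c]; rewrite [c2 == _]eq_sym (negPf h2c) r0 t0r.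
rewrite big1 // => h2 /andP[_ e2]; rewrite [c2 == h2](_ : _ = false) ?r0 ?t0r //.
by apply: contraFF e => /eqP->.
Qed.

Lemma trunc_val A B t : vsval (trunc A B t) = tact A B (dcop 1) t.
Proof.
rewrite linfunE => [|c u v]; last by rewrite !linearP.
by rewrite vsprojK // memv_img ?memvf.
Qed.

Lemma tincl_val A B t : tincl A B t = vsval t.
Proof. by rewrite linfunE. Qed.

Lemma tact_cop1K A B t : tact A B (dcop 1) (tact A B (dcop 1) t) = tact A B (dcop 1) t.
Proof. by rewrite -comp_lfunE -tact_copM mul1r. Qed.

Lemma ttens_cop1 A B (t : subvs_of (ttens_space A B)) :
  tact A B (dcop 1) (vsval t) = vsval t.
Proof. by have /memv_imgP[s _ ->] := subvsP t; rewrite tact_cop1K. Qed.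

Lemma ttens_actE A B h t :
  vsval (ttens_act A B h t) = tact A B (dcop h) (vsval t).
Proof.
rewrite linfunE => [|c u v]; last first.
  by rewrite tact_cop_linear comp_lfunDr comp_lfunDl -comp_lfunZr -comp_lfunZl.
by rewrite !comp_lfunE trunc_val tincl_val -comp_lfunE -tact_copM mul1r.
Qed.

Lemma ttens_act1 A B : ttens_act A B 1 = \1%VF.
Proof. by apply/lfunP=> t; apply: val_inj; rewrite /= ttens_actE ttens_cop1 lfunE. Qed.

Lemma ttens_actM A B u v :
  ttens_act A B (u * v) = (ttens_act A B u \o ttens_act A B v)%VF.
Proof.
apply/lfunP=> t; apply: val_inj; rewrite /= ttens_actE comp_lfunE !ttens_actE.
by rewrite tact_copM comp_lfunE.
Qed.

Definition ttens A B : rep := Rep (DModule (@ttens_act1 A B) (@ttens_actM A B)).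

Lemma dcounit_linear : linear (@dcounit k G). Proof. exact: dlift_linear. Qed.

Lemma deps_tE h : deps_t h = \sum_p dcounit (dunit1 k p * h) *: dunit1 k p.
Proof.
rewrite /deps_t dcop1 linear_sum /=; apply: eq_bigr => p _.
rewrite tliftE // => a c u v; first by rewrite scalerDr !scalerA mulrC.
rewrite -[X in dcounit X]/(dmul _ _) dmul_linearl dcounit_linear.
by rewrite scalerDl scalerA.
Qed.

Lemma deps_t_linear : linear deps_t.
Proof.
move=> c u v; rewrite !deps_tE scaler_sumr -big_split /=; apply: eq_bigr => p _.
rewrite -[X in dcounit X]/(dmul _ _) dmul_linearr dcounit_linear.
by rewrite scalerDl scalerA.
Qed.

Lemma deps_t_gamma g x : dbl_adm (g, x) ->
  deps_t (dgamma g x) = (g == gid (gtgt x))%:R *: dunit1 k (gtgt x).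
Proof.
move=> gx; rewrite deps_tE (bigD1 (gtgt x)) //= big1 ?addr0 => [|p px].
  rewrite -[_ * _]/(dmul _ _) dmul1_gamma // eqxx scale1r.
  by rewrite /dcounit dlift_gamma gx gmulxV.
rewrite -[_ * _]/(dmul _ _) dmul1_gamma // eq_sym (negPf px) scale0r.
by rewrite /dcounit /dlift big1 ?scale0r // => i _; rewrite ffunE scale0r.
Qed.

Lemma deps_t1 p : deps_t (dunit1 k p) = dunit1 k p.
Proof.
pose m : {linear D -> D} :=
  HB.pack deps_t (GRing.isLinear.Build _ _ _ _ _ deps_t_linear).
rewrite -[LHS]/(m _) /dunit1 linear_sum (bigD1 (gid p)) /=; last first.
  by apply/vgroupP; rewrite gsrc_id gtgt_id.
rewrite deps_t_gamma; last by apply/dbl_admP; rewrite gsrc_id !gtgt_id.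
rewrite gtgt_id eqxx scale1r big1 ?addr0 // => g /andP[/vgroupP[sg tg] ge].
rewrite deps_t_gamma; last by apply/dbl_admP; rewrite gtgt_id.
by rewrite gtgt_id (negPf ge) scale0r.
Qed.

Lemma deps_tM u v : deps_t (u * deps_t v) = deps_t (u * v).
Proof.
pose F u v := deps_t (u * deps_t v).
pose F' u v := deps_t (u * v).
rewrite -[LHS]/(F u v) -[RHS]/(F' u v).
have ml (c : k) (a b d : D) : (c *: a + b) * d = c *: (a * d) + b * d.
  exact: dmul_linearl.
have mr (c : k) (a b d : D) : d * (c *: a + b) = c *: (d * a) + d * b.
  exact: dmul_linearr.
have sc (c : k) (a : D) : deps_t (c *: a) = c *: deps_t a.
  pose m : {linear D -> D} :=
    HB.pack deps_t (GRing.isLinear.Build _ _ _ _ _ deps_t_linear).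
  by rewrite -[LHS]/(m _) linearZ.
apply: (@dbl_ext _ _ _ (F^~ v) (F'^~ v)) => [c a b|c a b|g x gx].
- by rewrite /F ml deps_t_linear.
- by rewrite /F' ml deps_t_linear.
apply: (@dbl_ext _ _ _ (F (dgamma g x)) (F' (dgamma g x))) => [c a b|c a b|h y hy].
- by rewrite /F deps_t_linear mr deps_t_linear.
- by rewrite /F' mr deps_t_linear.
rewrite /F /F'.
transitivity (deps_t (dgamma g x * ((h == gid (gtgt y))%:R *: dunit1 k (gtgt y)))).
  by congr (deps_t (_ * _)); apply: deps_t_gamma.
have -> : dgamma g x * ((h == gid (gtgt y))%:R *: dunit1 k (gtgt y)) =
    (h == gid (gtgt y))%:R *: (dmul (dgamma g x) (dunit1 k (gtgt y))).
  have := mr (h == gid (gtgt y))%:R (dunit1 k (gtgt y)) 0 (dgamma g x).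
  by rewrite mulr0 !addr0 => ->.
rewrite dmul1_gammar // scalerA sc (deps_t_gamma gx).
rewrite -[dgamma g x * _]/(dmul _ _) (dmul_gamma _ gx hy).
have [sg tg] := dbl_admP _ _ gx; have [sh th] := dbl_admP _ _ hy.
have cjid : (x^-1 * (gid (gtgt x) * x) = gid (gsrc x))%gpd.
  by rewrite gmul1x gmulVx.
have [xy|xy] := eqVneq (gsrc x) (gtgt y); last first.
  rewrite mulr0 scale0r; case: ifP => e.
    by have [e' _] := dmul_adm gx hy e; rewrite e' eqxx in xy.
  by have := deps_t_linear (-1) 0 0; rewrite scaler0 addr0 scaleN1r addNr.
rewrite mulr1 scalerA; case: ifP => e.
  have [_ gxy] := dmul_adm gx hy e.
  rewrite (deps_t_gamma gxy) gtgt_mul //; have [g1|] := eqVneq g (gid (gtgt x)).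
    by rewrite -(eqP e) g1 cjid -xy eqxx mulr1.
  by rewrite mulr0.
have -> : deps_t 0 = 0.
  by have := deps_t_linear (-1) 0 0; rewrite scaler0 addr0 scaleN1r addNr.
have [g1|] := eqVneq g (gid (gtgt x)); last by rewrite mulr0 scale0r.
have [h1|] := eqVneq h (gid (gtgt y)); last by rewrite mul0r scale0r.
by rewrite g1 h1 cjid xy eqxx in e.
Qed.

Lemma dt_actE h z : vsval (dt_act h z) = deps_t (h * vsval z).
Proof.
have mr (c : k) (a b d : D) : d * (c *: a + b) = c *: (d * a) + d * b.
  exact: dmul_linearr.
have L w : linear (fun z : subvs_of dt_space =>
    vsproj dt_space (deps_t (w * vsval z))).
  by move=> c a b; rewrite linearP mr deps_t_linear linearP.
have E w y : linfun (fun z : subvs_of dt_space =>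
    vsproj dt_space (deps_t (w * vsval z))) y =
    vsproj dt_space (deps_t (w * vsval y)) by exact: linfunE (L w) y.
rewrite /dt_act linfunE => [|c a b]; last first.
  apply/lfunP=> y; rewrite add_lfunE scale_lfunE.
  transitivity (vsproj dt_space (deps_t ((c *: a + b) * vsval y))); first exact: E.
  transitivity (c *: vsproj dt_space (deps_t (a * vsval y)) +
     vsproj dt_space (deps_t (b * vsval y))); last by congr (_ *: _ + _); rewrite E.
  have -> : (c *: a + b) * vsval y = c *: (a * vsval y) + b * vsval y.
    exact: dmul_linearl.
  by rewrite deps_t_linear linearP.
rewrite E vsprojK // /dt_space.
rewrite -[deps_t _](_ : linfun deps_t (h * vsval z) = _) ?memv_img ?memvf //.
exact: linfunE deps_t_linear _.
Qed.

Lemma deps_tK (z : subvs_of dt_space) : deps_t (vsval z) = vsval z.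
Proof.
have /memv_imgP[w _ ->] := subvsP z.
rewrite (linfunE deps_t_linear).
by have := deps_tM 1 w; rewrite !mul1r.
Qed.

Lemma dt_act1 : dt_act 1 = \1%VF.
Proof.
by apply/lfunP=> z; apply: val_inj; rewrite /= dt_actE mul1r deps_tK lfunE.
Qed.

Lemma dt_actM u v : dt_act (u * v) = (dt_act u \o dt_act v)%VF.
Proof.
apply/lfunP=> z; apply: val_inj; rewrite /= comp_lfunE !dt_actE.
by rewrite deps_tM mulrA.
Qed.

Definition unit_rep : rep := Rep (DModule dt_act1 dt_actM).

(* [dt1 p] is 1^p and [dt_one] is 1, as elements of D_t. *)
Definition dt1 (p : gob G) : unit_rep := vsproj dt_space (dunit1 k p).
Definition dt_one : unit_rep := vsproj dt_space (1 : D).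

Lemma dt1_val p : vsval (dt1 p) = dunit1 k p.
Proof.
rewrite vsprojK // -deps_t1 -(linfunE deps_t_linear).
by rewrite memv_img ?memvf.
Qed.

(* The coefficient of 1^p in z = Σ_p c_p 1^p, read off on γ_{e_p}^{e_p}. *)
Definition dcoef (p : gob G) (z : D) : k :=
  dlift (fun g x => ((g == gid p) && (x == gid p))%:R : k^o) z.

Lemma dt_expand (z : unit_rep) : z = \sum_p dcoef p (vsval z) *: dt1 p.
Proof.
apply: val_inj; rewrite /= linear_sum /=.
have dcl p : linear (@dcoef p : D -> k^o) by exact: dlift_linear.
have dc1 p q : dcoef p (dunit1 k q) = (q == p)%:R.
  pose m : {linear D -> k^o} :=
    HB.pack (dcoef p : D -> k^o) (GRing.isLinear.Build _ _ _ _ _ (dcl p)).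
  rewrite -[LHS]/(m _) /dunit1 linear_sum /=.
  have E g : g \in vgroup q ->
     dcoef p (dgamma g (gid q)) = ((g == gid p) && (gid q == gid p))%:R.
    move=> gq; rewrite /dcoef dlift_gamma -dbl_adm_vgroup gtgt_id.
    by rewrite [g \in _]gq.
  rewrite (eq_bigr _ E); have [->|qp] := eqVneq q p.
    rewrite (bigD1 (gid p)) ?eqxx /= ?big1 ?addr0 //.
      by move=> g /andP[_ /negPf->].
    by apply/vgroupP; rewrite gsrc_id gtgt_id.
  rewrite big1 // => g _; case: (gid q =P gid p) => [e|_]; last by rewrite andbF.
  by rewrite -(gsrc_id p) -e gsrc_id eqxx in qp.
rewrite -{1}[vsval z]deps_tK deps_tE.
have E : vsval z = \sum_p dcounit (dunit1 k p * vsval z) *: dunit1 k p.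
  by rewrite -deps_tE deps_tK.
apply: eq_bigr => p _; rewrite dt1_val; congr (_ *: _).
pose m : {linear D -> k^o} :=
  HB.pack (dcoef p : D -> k^o) (GRing.isLinear.Build _ _ _ _ _ (dcl p)).
rewrite [X in dcoef p X]E -[RHS]/(m _) linear_sum (bigD1 p) //=.
rewrite -[dcoef p _]/(m _) linearZ /= dc1 eqxx big1 ?addr0.
  by rewrite [_ *: _]mulr1.
by move=> q /negPf qp; rewrite -[dcoef p _]/(m _) linearZ /= dc1 qp scaler0.
Qed.

End Rep.
Arguments dt1 k {G} p.
Arguments dt_one {k G}.
Arguments ract {k G} A.

Section Monoidal.
Variables (k : fieldType) (G : finGroupoid).
Local Notation D := (dbl k G).
Local Notation rep := (rep k G).
Implicit Types A B C : rep.

Definition ttens_map A A' B B' (f : 'Hom(A, A')) (g : 'Hom(B, B')) :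
    'Hom(ttens A B, ttens A' B') :=
  (trunc A' B' \o tmap f g \o tincl A B)%VF.

Definition rassoc A B C :
    'Hom(ttens (ttens A B) C, ttens A (ttens B C)) :=
  (trunc A (ttens B C) \o tmap \1 (trunc B C) \o tassoc A B C
    \o tmap (tincl A B) \1 \o tincl (ttens A B) C)%VF.

Definition rassocV A B C :
    'Hom(ttens A (ttens B C), ttens (ttens A B) C) :=
  (trunc (ttens A B) C \o tmap (trunc A B) \1 \o tassocV A B C
    \o tmap \1 (tincl B C) \o tincl A (ttens B C))%VF.

Definition lunitor A : 'Hom(ttens (unit_rep k G) A, A) :=
  (tlift (fun (z : unit_rep k G) a => ract A (vsval z) a)
    \o tincl (unit_rep k G) A)%VF.

Definition runitor A : 'Hom(ttens A (unit_rep k G), A) :=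
  (tlift (fun a (z : unit_rep k G) => ract A (dantipode (vsval z)) a)
    \o tincl A (unit_rep k G))%VF.

Definition braiding A B : 'Hom(ttens A B, ttens B A) :=
  (trunc B A \o tswap A B \o tact A B dRmx \o tincl A B)%VF.

Lemma dunit1M p q : dunit1 k p * dunit1 k q = (p == q)%:R *: (dunit1 k p : D).
Proof.
pose m : {linear D -> D} := HB.pack (dmul (dunit1 k p))
  (GRing.isLinear.Build _ _ _ _ _ (dmul_linearr (dunit1 k p))).
rewrite -[LHS]/(m (dunit1 k q)) {1}/dunit1 linear_sum /=.
rewrite (eq_bigr (fun g => (q == p)%:R *: dgamma g (gid q))) => [|g gq].
  rewrite -scaler_sumr eq_sym; case: eqP => [->//|_]; by rewrite !scale0r.
by rewrite dmul1_gamma ?gtgt_id // -dbl_adm_vgroup gtgt_id.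
Qed.

Lemma ract1K A p q (a : A) : ract A (dunit1 k p) a = a ->
  ract A (dunit1 k q) a = (q == p)%:R *: a.
Proof.
by move=> ap; rewrite -{1}ap -comp_lfunE -ract_M dunit1M linearZ /= scale_lfunE;
  case: eqP => [->|]; rewrite ?scale0r // ap.
Qed.

Lemma trunc_pure A B p (a : A) (b : B) :
  ract A (dunit1 k p) a = a -> ract B (dunit1 k p) b = b ->
  tincl A B (trunc A B (a \ot b)) = a \ot b.
Proof.
move=> ap bp; rewrite tincl_val trunc_val dcop1 linear_sum /= sum_lfunE.
rewrite (bigD1 p) //= tact_pure tmapE ap bp big1 ?addr0 // => q qp.
rewrite tact_pure tmapE (ract1K q ap) (negPf qp) scale0r.
by rewrite /tpure linear0 trmx0 mul0mx.
Qed.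

Lemma ract_dt1 p : ract (unit_rep k G) (dunit1 k p) (dt1 k p) = dt1 k p.
Proof.
apply: val_inj; rewrite /= [LHS]dt_actE !dt1_val dunit1M eqxx scale1r.
exact: deps_t1.
Qed.

Lemma lunitorE A p (a : A) : ract A (dunit1 k p) a = a ->
  lunitor A (trunc (unit_rep k G) A (dt1 k p \ot a)) = a.
Proof.
move=> ap; rewrite comp_lfunE (trunc_pure (ract_dt1 p) ap) tliftE.
- by rewrite /= dt1_val.
- by move=> z c u v; rewrite linearP.
move=> b c u v; rewrite (_ : vsval (c *: u + v) = c *: vsval u + vsval v) //.
by rewrite linearP add_lfunE scale_lfunE.
Qed.

Lemma dantipode1 p : dantipode (dunit1 k p) = dunit1 k p :> D.
Proof.
pose m : {linear D -> D} := HB.pack (@dantipode k G)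
  (GRing.isLinear.Build _ _ _ _ _ (@dlift_linear k G _ _)).
rewrite -[LHS]/(m _) /dunit1 linear_sum /=.
have i1 : ((gid p)^-1 = gid p)%gpd.
  by rewrite -[LHS]gmulx1 gsrc_inv gtgt_id gmulVx gsrc_id.
have iV g : g \in vgroup p -> (g^-1)%gpd \in vgroup p.
  by move=> /vgroupP[sg tg]; apply/vgroupP; rewrite gsrc_inv gtgt_inv.
have iK (g : gmor G) : (g^-1^-1)%gpd = g.
  rewrite -[LHS]gmulx1 gsrc_inv gtgt_inv -gmulVx gmulA ?gsrc_inv ?gtgt_inv //.
  by rewrite gmulVx gsrc_inv gmul1x.
rewrite [RHS](reindex_inj (can_inj iK)) /=.
apply: eq_big => [g|g gp].
  by apply/idP/idP => [/iV//|/iV]; rewrite iK.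
rewrite /dantipode dlift_gamma -dbl_adm_vgroup gtgt_id gp i1.
have /vgroupP[s t] := iV _ gp.
by rewrite -{2}s gmulx1 -t gmul1x.
Qed.

Lemma runitorE A p (a : A) : ract A (dunit1 k p) a = a ->
  runitor A (trunc A (unit_rep k G) (a \ot dt1 k p)) = a.
Proof.
move=> ap; rewrite comp_lfunE (trunc_pure ap (ract_dt1 p)) tliftE.
- by rewrite /= dt1_val dantipode1.
- move=> b c u v; rewrite linearP /=.
  have -> : dantipode (c *: vsval u + vsval v) =
      c *: dantipode (vsval u) + dantipode (vsval v) by exact: dlift_linear.
  by rewrite linearP add_lfunE scale_lfunE.
by move=> z c u v; rewrite linearP.
Qed.

Record frobenius A := Frobenius {
  fmul : 'Hom(ttens A A, A);
  fcomul : 'Hom(A, ttens A A);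
  funit : 'Hom(unit_rep k G, A);
  fcounit : 'Hom(A, unit_rep k G);
  fmul_dlinear : dlinear fmul;
  fcomul_dlinear : dlinear fcomul;
  funit_dlinear : dlinear funit;
  fcounit_dlinear : dlinear fcounit;
  fmulA : (fmul \o ttens_map \1 fmul \o rassoc A A A
           = fmul \o ttens_map fmul \1)%VF;
  fmul1 : (fmul \o ttens_map funit \1 = lunitor A)%VF;
  fmulr1 : (fmul \o ttens_map \1 funit = runitor A)%VF;
  fmulC : (fmul \o braiding A A = fmul)%VF;
  fcomulA : (ttens_map \1 fcomul \o fcomul
             = rassoc A A A \o ttens_map fcomul \1 \o fcomul)%VF;
  fcomul1 : (lunitor A \o ttens_map fcounit \1 \o fcomul = \1)%VF;
  fcomulr1 : (runitor A \o ttens_map \1 fcounit \o fcomul = \1)%VF;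
  fcomulC : (braiding A A \o fcomul = fcomul)%VF;
  frobl : (fcomul \o fmul
           = ttens_map fmul \1 \o rassocV A A A \o ttens_map \1 fcomul)%VF;
  frobr : (fcomul \o fmul
           = ttens_map \1 fmul \o rassoc A A A \o ttens_map fcomul \1)%VF
}.

(* l_c, for c ∈ A^p: it agrees with v |-> m(c ⊗ v) on A^p, and vanishes on A^q
   for q <> p. *)
Definition fleft A (F : frobenius A) (c : A) : 'End(A) :=
  linfun (fun v => fmul F (trunc A A (c \ot v))).

Definition self_invariant A : Prop :=
  \sum_(p : gob G) \sum_(g in vgroup p) ract A (dgamma g g) = \1%VF.

Definition trace_condition A (F : frobenius A) : Prop :=
  forall (p : gob G) (g h : gmor G), g \in vgroup p -> h \in vgroup p ->
  forall c : A,
    c \in limg (ract A (dgamma (g * (h * (g^-1 * h^-1)))%gpd (gid p))) ->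
  lftr (fleft F c \o ract A (dgamma (h * (g * h^-1))%gpd h))%VF
  = lftr (ract A (dgamma h (g^-1)%gpd) \o fleft F c
          \o ract A (dgamma h (gid p)))%VF.

(* The data of a G-Frobenius algebra on A. [gfa_sector g] is A^p_g for
   g ∈ Γ^p, and is meaningless when g is not a loop; [gfa_act x] represents the
   map φ(x) : A^{s(x)} -> A^{t(x)}, and is meaningless outside A^{s(x)}. *)
Record gfa_data (A : vectType k) := GfaData {
  gfa_mul : A -> A -> A;
  gfa_one : A;
  gfa_eta : A -> A -> k;
  gfa_act : gmor G -> 'End(A);
  gfa_part : gob G -> {vspace A};
  gfa_sector : gmor G -> {vspace A}
}.

Definition is_unit_of (A : vectType k) (mul : A -> A -> A) (U : {vspace A})
    (u : A) : Prop :=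
  u \in U /\ {in U, forall a, mul u a = a /\ mul a u = a}.

Record is_gfa (A : vectType k) (X : gfa_data A) : Prop := IsGfa {
  gfa_mul_linearl : forall b, linear (gfa_mul X ^~ b);
  gfa_mul_linearr : forall a, linear (gfa_mul X a);
  gfa_mulA : associative (gfa_mul X);
  gfa_mul1x : left_id (gfa_one X) (gfa_mul X);
  gfa_mulx1 : right_id (gfa_one X) (gfa_mul X);
  gfa_part_full : (\sum_p gfa_part X p)%VS = fullv;
  gfa_part_direct : directv (\sum_p gfa_part X p);
  gfa_eta_linearl : forall b, scalar (gfa_eta X ^~ b);
  gfa_eta_linearr : forall a, scalar (gfa_eta X a);
  gfa_act_onto : forall x,
    (gfa_act X x @: gfa_part X (gsrc x))%VS = gfa_part X (gtgt x);
  gfa_act_inj : forall x, {in gfa_part X (gsrc x) &, injective (gfa_act X x)};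
  gfa_act_mul : forall x, {in gfa_part X (gsrc x) &, forall a b,
    gfa_act X x (gfa_mul X a b) = gfa_mul X (gfa_act X x a) (gfa_act X x b)};
  gfa_act_unit : forall x u,
    is_unit_of (gfa_mul X) (gfa_part X (gsrc x)) u ->
    is_unit_of (gfa_mul X) (gfa_part X (gtgt x)) (gfa_act X x u);
  gfa_act_comp : forall h g, gsrc h = gtgt g ->
    {in gfa_part X (gsrc g), forall a,
      gfa_act X h (gfa_act X g a) = gfa_act X (h * g)%gpd a};
  gfa_act_id : forall p, {in gfa_part X p, forall a, gfa_act X (gid p) a = a};
  gfa_sector_full : forall p,
    (\sum_(g in vgroup p) gfa_sector X g)%VS = gfa_part X p;
  gfa_sector_direct : forall p,
    directv (\sum_(g in vgroup p) gfa_sector X g);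
  gfa_sector_mul : forall p g h, g \in vgroup p -> h \in vgroup p ->
    {in gfa_sector X g & gfa_sector X h, forall a b,
      gfa_mul X a b \in gfa_sector X (g * h)%gpd};
  gfa_part_mul : forall p,
    {in gfa_part X p &, forall a b, gfa_mul X a b \in gfa_part X p};
  gfa_part_mul0 : forall p q, p != q ->
    {in gfa_part X p & gfa_part X q, forall a b, gfa_mul X a b = 0};
  gfa_eta_mul : forall a b c,
    gfa_eta X (gfa_mul X a b) c = gfa_eta X a (gfa_mul X b c);
  gfa_eta_act : forall h, {in gfa_part X (gsrc h) &, forall a b,
    gfa_eta X (gfa_act X h a) (gfa_act X h b) = gfa_eta X a b};
  gfa_act_sector : forall x g, g \in vgroup (gsrc x) ->
    (gfa_act X x @: gfa_sector X g
      <= gfa_sector X (x * (g * x^-1))%gpd)%VS;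
  gfa_eta_nondegl : forall p g h, g \in vgroup p -> h \in vgroup p ->
    (g * h)%gpd = gid p ->
    {in gfa_sector X g, forall a,
      {in gfa_sector X h, forall b, gfa_eta X a b = 0} -> a = 0};
  gfa_eta_nondegr : forall p g h, g \in vgroup p -> h \in vgroup p ->
    (g * h)%gpd = gid p ->
    {in gfa_sector X h, forall b,
      {in gfa_sector X g, forall a, gfa_eta X a b = 0} -> b = 0};
  gfa_eta0 : forall p g h, g \in vgroup p -> h \in vgroup p ->
    (g * h)%gpd <> gid p ->
    {in gfa_sector X g & gfa_sector X h, forall a b, gfa_eta X a b = 0};
  gfa_mulC : forall p g h, g \in vgroup p -> h \in vgroup p ->
    {in gfa_sector X g & gfa_sector X h, forall a b,
      gfa_mul X a b = gfa_mul X (gfa_act X g b) a};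
  gfa_act_self : forall p g, g \in vgroup p ->
    {in gfa_sector X g, forall a, gfa_act X g a = a};
  gfa_trace : forall p g h, g \in vgroup p -> h \in vgroup p ->
    {in gfa_sector X (g * (h * (g^-1 * h^-1)))%gpd, forall c,
      lftr_on (gfa_sector X g) (linfun (gfa_mul X c) \o gfa_act X h)%VF
      = lftr_on (gfa_sector X h)
          (gfa_act X (g^-1)%gpd \o linfun (gfa_mul X c))%VF}
}.

(* Equality of G-Frobenius algebra structures on A, ignoring the meaningless
   values of [gfa_sector] and [gfa_act]. *)
Record gfa_eq (A : vectType k) (X Y : gfa_data A) : Prop := GfaEq {
  gfa_eq_mul : gfa_mul X =2 gfa_mul Y;
  gfa_eq_one : gfa_one X = gfa_one Y;
  gfa_eq_eta : gfa_eta X =2 gfa_eta Y;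
  gfa_eq_part : gfa_part X =1 gfa_part Y;
  gfa_eq_sector : forall p, {in vgroup p, gfa_sector X =1 gfa_sector Y};
  gfa_eq_act : forall x, {in gfa_part X (gsrc x), gfa_act X x =1 gfa_act Y x}
}.

Section Associated.
Variables (A : rep) (F : frobenius A).

Definition rcomp (p : gob G) (a : A) : A := ract A (dunit1 k p) a.

Definition assoc_mul (a b : A) : A :=
  \sum_p fmul F (trunc A A (rcomp p a \ot rcomp p b)).

Definition assoc_one : A := funit F dt_one.

(* ε', characterised by [assoc_epsE] *)
Definition assoc_eps (a : A) : k :=
  \sum_p dcoef p (vsval (fcounit F (rcomp p a))).

Definition assoc_eta (a b : A) : k := assoc_eps (assoc_mul a b).

Definition assoc_act (x : gmor G) : 'End(A) :=
  \sum_(g in vgroup (gtgt x)) ract A (dgamma g x).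

Definition assoc_data : gfa_data A := {|
  gfa_mul := assoc_mul;
  gfa_one := assoc_one;
  gfa_eta := assoc_eta;
  gfa_act := assoc_act;
  gfa_part := fun p => limg (ract A (dunit1 k p));
  gfa_sector := fun g => limg (ract A (dgamma g (gid (gsrc g))))
|}.

Lemma assoc_oneE : assoc_one = \sum_p funit F (dt1 k p).
Proof.
rewrite /assoc_one -linear_sum; congr (funit F _); apply: val_inj.
rewrite /= linear_sum /= vsprojK; first by under eq_bigr do rewrite dt1_val.
rewrite -[1]/(dunit k G) /dunit; apply: rpred_sum => p _.
by rewrite -dt1_val subvsP.
Qed.

Lemma dcoef_linear p : linear (@dcoef k G p : D -> k^o).
Proof. exact: dlift_linear. Qed.

Lemma rcompK p q (a : A) : rcomp q (rcomp p a) = (q == p)%:R *: rcomp p a.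
Proof. by apply: ract1K; rewrite -comp_lfunE -ract_M dunit1M eqxx scale1r. Qed.

Lemma assoc_eps_linear : scalar assoc_eps.
Proof.
move=> c a b; rewrite mulr_sumr -big_split /=; apply: eq_bigr => p _.
by rewrite /rcomp !linearP /=; apply: dcoef_linear.
Qed.

Lemma assoc_epsE a : fcounit F a = \sum_p assoc_eps (rcomp p a) *: dt1 k p.
Proof.
rewrite [LHS]dt_expand; apply: eq_bigr => p _; congr (_ *: _).
have z0 : dcoef p (0 : D) = 0 :> k^o.
  have := @dcoef_linear p (-1) 0 0.
  by rewrite scaler0 addr0 scaleN1r addNr.
have z0' q : dcoef q (0 : D) = 0 :> k^o.
  have := @dcoef_linear q (-1) 0 0.
  by rewrite scaler0 addr0 scaleN1r addNr.
rewrite /assoc_eps (bigD1 p) //= rcompK eqxx scale1r big1 ?addr0; last first.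
  by move=> q qp; rewrite rcompK (negPf qp) scale0r linear0; apply: z0'.
rewrite /rcomp fcounit_dlinear.
have -> : ract (unit_rep k G) (dunit1 k p) (fcounit F a) =
   dcoef p (vsval (fcounit F a)) *: dt1 k p.
  rewrite {1}[fcounit F a]dt_expand linear_sum /= (bigD1 p) //= linearZ /=.
  rewrite ract_dt1 big1 ?addr0 // => q qp.
  by rewrite linearZ /= (ract1K p (ract_dt1 q)) eq_sym (negPf qp) scale0r scaler0.
rewrite linearZ /= dt1_val.
have -> c : dcoef p (c *: dunit1 k p : D) = c * dcoef p (dunit1 k p : D).
  have := @dcoef_linear p c (dunit1 k p) 0.
  by rewrite addr0 z0 addr0.
suff -> : dcoef p (dunit1 k p : D) = 1 by rewrite mulr1.
pose m : {linear D -> k^o} := HB.pack (dcoef p : D -> k^o)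
  (GRing.isLinear.Build _ _ _ _ _ (@dcoef_linear p)).
rewrite -[LHS]/(m _) /dunit1 linear_sum /= (bigD1 (gid p)) /=; last first.
  by apply/vgroupP; rewrite gsrc_id gtgt_id.
rewrite big1 ?addr0.
  rewrite /dcoef dlift_gamma -dbl_adm_vgroup gtgt_id !eqxx.
  by case: vgroupP => // -[]; rewrite gsrc_id gtgt_id.
move=> g /andP[gp ge]; rewrite /dcoef dlift_gamma -dbl_adm_vgroup gtgt_id.
by rewrite [g \in _]gp (negPf ge).
Qed.

End Associated.
End Monoidal.

(* Main.v *)
From HB Require Import structures.
Require Import Defs.
From mathcomp Require Import all_boot all_order all_algebra.

(** A module over the double is the same thing as a vector space graded by the
    loops of the groupoid, A = sum of the A_g, together with transport
    isomorphisms phi(x) that permute the degrees by conjugation: the basis element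
    gamma_g^x acts as the projection to degree x^-1 g x followed by phi(x).  A map
    is therefore linear over the double exactly when it preserves degrees and
    commutes with transports ([dlinear_homog], [dlinear_ttens_homog]).  The
    truncated tensor product is spanned by the classes of a (x) b with a and b in
    the part A^p of the same object, and on such classes every structural map is
    what one expects ([ttens_map_tpr], [rassoc_tpr], [braiding_tpr], ...); the
    braiding sends a (x) b to phi(g) b (x) a when a has degree g.

    From a Frobenius object to an algebra, the axioms are read off on these
    classes: commutativity for the braiding is the twisted commutativity
    a.b = phi(g)(b).a for a of degree g, [self_invariant] says that phi(g) is the
    identity in degree g, and the counit, being linear over the double, is
    invariant under transports and vanishes off the identity degrees.  Nondegeneracy comes from the Frobenius relation: since
    a = a.1, the coproduct of a is a.1_(1) (x) 1_(2), so the counit axiom gives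
    a = eps(a.1_(1)) 1_(2), which is 0 when a is orthogonal to everything
    ([assoc_eta_nondeg]).  The equality of traces in
    [trace_condition] is the one in [gfa_trace], because each of the two operators
    in the former factors through the projection to a single degree, and its trace
    is that of its restriction to that degree ([lftr_onE]).

    Conversely, let a G-Frobenius algebra be given, and let E_j, F_j ([casl] and
    [casr]) be homogeneous
    families of opposite degrees with a = sum_j eta(a, E_j) F_j, hence also
    b = sum_j eta(F_j, b) E_j; they exist because eta is nondegenerate and pairs
    degree g with degree g^-1.  The coproduct is
        Delta(a) = sum_j a E_j (x) F_j = sum_j E_j (x) F_j a.
    The two expressions agree by the adjunction principle [cas_adjoint], which
    moves an operator from the first leg of sum_j E_j (x) F_j to its eta-adjoint on
    the second leg.  Having both expressions makes coassociativity and the two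
    Frobenius relations immediate; the same principle applied to phi(x), whose
    adjoint is its inverse, gives invariance under transports.  Cocommutativity
    combines twisted commutativity with the symmetry of eta ([cas_swap]). *)

Set Implicit Arguments.
Unset Strict Implicit.
Unset Printing Implicit Defensive.

Import GRing.Theory VectorInternalTheory.
Local Open Scope ring_scope.

(** * Conjugation and inverses in vertex groups *)

Section GroupoidFacts.
Variable G : finGroupoid.
Implicit Types (p : gob G) (g h x y : gmor G).

Lemma ginvK x : (x^-1^-1)%gpd = x.
Proof.
rewrite -[LHS]gmulx1 gsrc_inv gtgt_inv -gmulVx gmulA ?gsrc_inv ?gtgt_inv //.
by rewrite gmulVx gsrc_inv gmul1x.
Qed.

Lemma ginv_id p : ((gid p)^-1 = gid p)%gpd.
Proof. by rewrite -[LHS]gmulx1 gsrc_inv gtgt_id gmulVx gsrc_id. Qed.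

Lemma vgroup1 p : gid p \in vgroup p.
Proof. by apply/vgroupP; rewrite gsrc_id gtgt_id. Qed.

Lemma vgroupV p g : g \in vgroup p -> (g^-1)%gpd \in vgroup p.
Proof. by move=> /vgroupP[sg tg]; apply/vgroupP; rewrite gsrc_inv gtgt_inv. Qed.

Lemma vgroup1g p g : g \in vgroup p -> (gid p * g = g)%gpd.
Proof. by move=> /vgroupP[_ <-]; rewrite gmul1x. Qed.

Lemma vgroupg1 p g : g \in vgroup p -> (g * gid p = g)%gpd.
Proof. by move=> /vgroupP[<- _]; rewrite gmulx1. Qed.

Lemma vgroupgV p g : g \in vgroup p -> (g * g^-1 = gid p)%gpd.
Proof. by move=> /vgroupP[_ <-]; rewrite gmulxV. Qed.

Lemma vgroupVg p g : g \in vgroup p -> (g^-1 * g = gid p)%gpd.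
Proof. by move=> /vgroupP[<- _]; rewrite gmulVx. Qed.

Lemma vgroupA p g h x : g \in vgroup p -> h \in vgroup p -> x \in vgroup p ->
  (g * (h * x) = (g * h) * x)%gpd.
Proof. by move=> /vgroupP[sg tg] /vgroupP[sh th] /vgroupP[sx tx]; rewrite gmulA ?sg ?th ?sh ?tx. Qed.

Lemma vgroup_invP p g h : g \in vgroup p -> h \in vgroup p ->
  (g * h)%gpd = gid p -> h = (g^-1)%gpd.
Proof.
move=> gp hp e; have gVp := vgroupV gp.
by rewrite -(vgroup1g hp) -(vgroupVg gp) -(vgroupA gVp gp hp) e vgroupg1.
Qed.

Lemma vgroup_conj x g : g \in vgroup (gsrc x) ->
  (x * (g * x^-1))%gpd \in vgroup (gtgt x).
Proof.
move=> /vgroupP[sg tg]; have s1 : gsrc g = gtgt (x^-1)%gpd by rewrite gtgt_inv.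
by apply/vgroupP; rewrite gsrc_mul ?gtgt_mul ?gsrc_mul ?gsrc_inv.
Qed.

Lemma vgroup_conjV x g : g \in vgroup (gtgt x) ->
  (x^-1 * (g * x))%gpd \in vgroup (gsrc x).
Proof. by move=> /vgroupP[sg tg]; apply/vgroupP; rewrite gconj_src ?gconj_tgt. Qed.

Lemma gconjK x g : g \in vgroup (gsrc x) ->
  (x^-1 * ((x * (g * x^-1)) * x) = g)%gpd.
Proof.
move=> /vgroupP[sg tg]; have s1 : gsrc g = gtgt (x^-1)%gpd by rewrite gtgt_inv.
rewrite -gmulA ?gtgt_mul ?gsrc_mul ?gsrc_inv // gmulKx; last first.
  by rewrite !gtgt_mul ?gsrc_mul ?gsrc_inv.
by rewrite -gmulA ?gsrc_inv // gmulVx -sg gmulx1.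
Qed.

Lemma gconjKV x g : g \in vgroup (gtgt x) ->
  (x * ((x^-1 * (g * x)) * x^-1) = g)%gpd.
Proof.
by move=> gx; have := @gconjK (x^-1)%gpd g; rewrite ginvK gsrc_inv => ->.
Qed.

Lemma gconj_eq x g h : g \in vgroup (gtgt x) -> h \in vgroup (gsrc x) ->
  ((x^-1 * (g * x))%gpd == h) = (g == (x * (h * x^-1))%gpd).
Proof.
move=> gx hx; apply/eqP/eqP => [<-|->]; first by rewrite gconjKV.
exact: gconjK.
Qed.

Lemma gconj1 p g : g \in vgroup p -> ((gid p)^-1 * (g * gid p) = g)%gpd.
Proof. by move=> gp; rewrite ginv_id (vgroupg1 gp) (vgroup1g gp). Qed.

Lemma gconj_self p g : g \in vgroup p -> (g^-1 * (g * g) = g)%gpd.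
Proof. by move=> /vgroupP[sg tg]; rewrite gmulKx ?sg. Qed.

Lemma vgroup_adm p g : g \in vgroup p -> dbl_adm (g, gid p).
Proof. by rewrite -dbl_adm_vgroup gtgt_id. Qed.

Lemma vgroup_inj p q g : g \in vgroup p -> g \in vgroup q -> p = q.
Proof. by move=> /vgroupP[<- _] /vgroupP[]. Qed.

End GroupoidFacts.

(** * Linear maps and traces on invariant subspaces *)

Section Traces.
Variable k : fieldType.
Implicit Types A B : vectType k.

Lemma lfun_sum A B (f : 'Hom(A, B)) I (r : seq I) (P : pred I) (F : I -> A) :
  f (\sum_(i <- r | P i) F i) = \sum_(i <- r | P i) f (F i).
Proof. exact: linear_sum. Qed.

Lemma lfunZ A B (f : 'Hom(A, B)) c a : f (c *: a) = c *: f a.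
Proof. exact: linearZ. Qed.

Lemma lftrC A B (f : 'Hom(A, B)) (g : 'Hom(B, A)) : lftr (f \o g)%VF = lftr (g \o f)%VF.
Proof.
have f2mxE (U V : vectType k) (u : 'Hom(U, V)) a : v2r (u a) = v2r a *m f2mx u.
  by rewrite unlock /= r2vK.
have f2mxM (U V W : vectType k) (u : 'Hom(V, W)) (v : 'Hom(U, V)) :
    f2mx (u \o v)%VF = f2mx v *m f2mx u.
  apply/row_matrixP => i; rewrite row_mul !rowE.
  by rewrite -[delta_mx _ _]r2vK -!f2mxE comp_lfunE.
by rewrite /lftr !f2mxM mxtrace_mulC.
Qed.

Lemma lftr_on_ext A (U : {vspace A}) (f f' : 'End(A)) :
  {in U, f =1 f'} -> lftr_on U f = lftr_on U f'.
Proof.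
move=> ff'; congr lftr; apply/lfunP => u.
by rewrite !linfunE => [|c a b|c a b]; rewrite ?linearP ?linearP // ff' ?subvsP.
Qed.

(** The projection pr lets f factor as the inclusion of U after a map defined on U,
    and the trace is invariant under exchanging the two factors. *)
Lemma lftr_onE A (U : {vspace A}) (pr f f' : 'End(A)) :
  (forall a, pr a \in U) -> {in U, forall a, pr a = a} ->
  (forall a, f (pr a) = f a) -> (forall a, f a \in U) -> {in U, f =1 f'} ->
  lftr f = lftr_on U f'.
Proof.
move=> prU prK fpr fU ff'.
pose j : 'Hom(subvs_of U, A) := linfun (@vsval _ _ U).
have jE u : j u = vsval u by rewrite linfunE.
pose q : 'Hom(A, subvs_of U) := linfun (vsproj U).
have qE a : q a = vsproj U a by rewrite lfunE.
rewrite /lftr_on; set fU' := linfun _.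
have fU'E u : fU' u = vsproj U (f' (vsval u)).
  by rewrite [LHS]linfunE // => c a b; rewrite !linearP.
have -> : f = (j \o (fU' \o (q \o pr)))%VF.
  apply/lfunP=> a; rewrite !comp_lfunE jE fU'E qE [vsval (vsproj U (pr a))]vsprojK //.
  by rewrite -ff' // fpr vsprojK.
rewrite lftrC -comp_lfunA; congr lftr; apply/lfunP=> u.
by rewrite !comp_lfunE jE prK ?subvsP // qE vsvalK.
Qed.

End Traces.

(** * Graded parts and transports of a module over the double *)

Section Modules.
Variables (k : fieldType) (G : finGroupoid).
Implicit Types (A B C : rep k G) (p q : gob G) (g h x y : gmor G).

Definition rpart A p : {vspace A} := limg (ract A (dunit1 k p)).

(** For a loop g this is the summand A_g; at other arrows the basis element is 0
    and so is the subspace. *)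
Definition rsector A g : {vspace A} := limg (ract A (dgamma g (gid (gsrc g)))).

Lemma ract0 A a : ract A 0 a = 0.
Proof. by rewrite linear0 lfunE. Qed.

Lemma ract_gammaM A g x h y a : dbl_adm (g, x) -> dbl_adm (h, y) ->
  ract A (dgamma g x) (ract A (dgamma h y) a) =
  if (x^-1 * (g * x) == h)%gpd then ract A (dgamma g (x * y)%gpd) a else 0.
Proof.
move=> gx hy; rewrite -comp_lfunE -ract_M.
rewrite -[dgamma g x * _]/(dmul _ _) dmul_gamma //.
by case: ifP => // _; rewrite ract0.
Qed.

Lemma ract_unit1M A p g x a : dbl_adm (g, x) ->
  ract A (dunit1 k p) (ract A (dgamma g x) a) =
  (gtgt x == p)%:R *: ract A (dgamma g x) a.
Proof.
move=> gx; rewrite -comp_lfunE -ract_M.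
by rewrite -[dunit1 k p * _]/(dmul _ _) dmul1_gamma // linearZ scale_lfunE.
Qed.

Lemma ract_Munit1 A p g x a : dbl_adm (g, x) ->
  ract A (dgamma g x) (ract A (dunit1 k p) a) =
  (gsrc x == p)%:R *: ract A (dgamma g x) a.
Proof.
move=> gx; rewrite -comp_lfunE -ract_M.
by rewrite -[dgamma g x * _]/(dmul _ _) dmul1_gammar // linearZ scale_lfunE.
Qed.

Lemma ract_unit1E A p a :
  ract A (dunit1 k p) a = \sum_(g in vgroup p) ract A (dgamma g (gid p)) a.
Proof. by rewrite /dunit1 linear_sum sum_lfunE. Qed.

Lemma sum_ract_unit1 A a : \sum_p ract A (dunit1 k p) a = a.
Proof.
by rewrite -sum_lfunE -linear_sum /= -/(dunit k G) [ract A _]ract_1 lfunE.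
Qed.

Lemma rpartP A p a : reflect (ract A (dunit1 k p) a = a) (a \in rpart A p).
Proof.
apply: (iffP idP) => [/memv_imgP[b _ ->]|<-]; last exact: memv_img (memvf _).
by rewrite -comp_lfunE -ract_M dunit1M eqxx scale1r.
Qed.

Lemma ract_unit1_in A p a : ract A (dunit1 k p) a \in rpart A p.
Proof. exact: memv_img (memvf _). Qed.

Lemma ract_unit1_part A p q a : a \in rpart A p ->
  ract A (dunit1 k q) a = (q == p)%:R *: a.
Proof. by move=> /rpartP; apply: ract1K. Qed.

Lemma rsectorE A p g : g \in vgroup p ->
  rsector A g = limg (ract A (dgamma g (gid p))).
Proof. by rewrite /rsector => /vgroupP[->]. Qed.

Lemma rsectorP A p g a : g \in vgroup p ->
  reflect (ract A (dgamma g (gid p)) a = a) (a \in rsector A g).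
Proof.
move=> gp; rewrite (rsectorE _ gp).
apply: (iffP idP) => [/memv_imgP[b _ ->]|<-]; last exact: memv_img (memvf _).
rewrite ract_gammaM ?vgroup_adm // (gconj1 gp) eqxx.
by rewrite (vgroup1g (vgroup1 p)).
Qed.

Lemma rsector_part A p g : g \in vgroup p -> {subset rsector A g <= rpart A p}.
Proof.
move=> gp a; rewrite (rsectorE _ gp) => /memv_imgP[b _ ->].
by apply/rpartP; rewrite ract_unit1M ?vgroup_adm // gtgt_id eqxx scale1r.
Qed.

Lemma ract_sector_in A g x a : dbl_adm (g, x) -> ract A (dgamma g x) a \in rsector A g.
Proof.
move=> gx; have gp : g \in vgroup (gtgt x) by rewrite dbl_adm_vgroup.
apply/(rsectorP _ gp).
by rewrite ract_gammaM ?vgroup_adm // (gconj1 gp) eqxx gmul1x.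
Qed.

(** On a homogeneous vector at most one of the summands of [assoc_act A x] is
    nonzero, the one whose degree is the conjugate of h. *)
Lemma ract_sector A g x h a : dbl_adm (g, x) -> h \in vgroup (gsrc x) ->
  a \in rsector A h ->
  ract A (dgamma g x) a = if g == (x * (h * x^-1))%gpd then assoc_act A x a else 0.
Proof.
move=> gx hx /(rsectorP _ hx) ah.
have gp : g \in vgroup (gtgt x) by rewrite dbl_adm_vgroup.
have E g' : g' \in vgroup (gtgt x) -> ract A (dgamma g' x) a =
    if g' == (x * (h * x^-1))%gpd then ract A (dgamma g' x) a else 0.
  move=> g'p; rewrite -{1}ah ract_gammaM ?vgroup_adm //; last by rewrite -dbl_adm_vgroup.
  by rewrite gmulx1 gconj_eq.
rewrite E //; case: eqP => // ->; rewrite sum_lfunE (bigD1 (x * (h * x^-1))%gpd) /=.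
  by rewrite big1 ?addr0 // => g' /andP[/E -> /negPf ->].
exact: vgroup_conj.
Qed.

Lemma ract_gamma_id A p g h a : g \in vgroup p -> h \in vgroup p -> a \in rsector A g ->
  ract A (dgamma h (gid p)) a = if h == g then a else 0.
Proof.
move=> gp hp /(rsectorP _ gp) ag; rewrite -{1}ag ract_gammaM ?vgroup_adm // (gconj1 hp).
by rewrite (vgroup1g (vgroup1 p)); case: eqP => // ->.
Qed.

Lemma assoc_actE A x h a : h \in vgroup (gsrc x) -> a \in rsector A h ->
  assoc_act A x a = ract A (dgamma (x * (h * x^-1))%gpd x) a.
Proof.
move=> hx ah; rewrite (ract_sector _ hx ah) ?eqxx //.
by rewrite -dbl_adm_vgroup vgroup_conj.
Qed.

Lemma assoc_act_part A x a : assoc_act A x a \in rpart A (gtgt x).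
Proof.
rewrite sum_lfunE; apply: rpred_sum => g gx.
by apply/rpartP; rewrite ract_unit1M ?eqxx ?scale1r // -dbl_adm_vgroup.
Qed.

Lemma assoc_act_id A p : assoc_act A (gid p) = ract A (dunit1 k p).
Proof. by rewrite /assoc_act gtgt_id /dunit1 linear_sum. Qed.

(** Holds on all of A, not just on the source part: each summand of the product
    selects one degree, and conjugation by h matches the two sums. *)
Lemma assoc_act_comp A h g a : gsrc h = gtgt g ->
  assoc_act A h (assoc_act A g a) = assoc_act A (h * g)%gpd a.
Proof.
move=> hg; rewrite [assoc_act A g a]sum_lfunE linear_sum [RHS]sum_lfunE gtgt_mul //=.
under eq_bigr => g1 g1g do rewrite sum_lfunE.
rewrite exchange_big /=; apply: eq_bigr => h1 h1h.
rewrite (bigD1 (h^-1 * (h1 * h))%gpd) /=; last by rewrite -hg vgroup_conjV.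
rewrite ract_gammaM -?dbl_adm_vgroup -?hg ?vgroup_conjV // eqxx big1 ?addr0 // => g1.
by case/andP=> g1g /negPf g1h; rewrite ract_gammaM -?dbl_adm_vgroup -?hg // eq_sym g1h.
Qed.

Lemma assoc_actK A x : {in rpart A (gsrc x), cancel (assoc_act A x) (assoc_act A (x^-1)%gpd)}.
Proof.
move=> a /rpartP ax; rewrite assoc_act_comp ?gsrc_inv // gmulVx.
by rewrite assoc_act_id.
Qed.

Lemma assoc_actKV A x : {in rpart A (gtgt x), cancel (assoc_act A (x^-1)%gpd) (assoc_act A x)}.
Proof. by move=> a ax; have /(_ a) := @assoc_actK A (x^-1)%gpd; rewrite ginvK gsrc_inv; apply. Qed.

Lemma dlinear_act A B (f : 'Hom(A, B)) x a : dlinear f ->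
  f (assoc_act A x a) = assoc_act B x (f a).
Proof. by move=> fD; rewrite !sum_lfunE linear_sum; apply: eq_bigr => g _; apply: fD. Qed.

Lemma dlinear_part A B (f : 'Hom(A, B)) p a : dlinear f ->
  a \in rpart A p -> f a \in rpart B p.
Proof. by move=> fD /rpartP ap; apply/rpartP; rewrite -fD ap. Qed.

Lemma dlinear_sector A B (f : 'Hom(A, B)) p g a : dlinear f -> g \in vgroup p ->
  a \in rsector A g -> f a \in rsector B g.
Proof. by move=> fD gp /(rsectorP _ gp) ag; apply/(rsectorP _ gp); rewrite -fD ag. Qed.

Lemma rpart_sum A p a : a \in rpart A p ->
  a = \sum_(g in vgroup p) ract A (dgamma g (gid p)) a.
Proof. by move=> /rpartP {1}<-; rewrite ract_unit1E. Qed.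

Lemma rpart_ext A (V : vectType k) (f f' : 'Hom(A, V)) :
  (forall p, {in rpart A p, f =1 f'}) -> f = f'.
Proof.
move=> ff'; apply/lfunP => a; rewrite -(sum_ract_unit1 a) !linear_sum.
by apply: eq_bigr => p _; apply: ff'; apply: ract_unit1_in.
Qed.

Lemma rsector_ext A (V : vectType k) (f f' : 'Hom(A, V)) p :
  (forall g, g \in vgroup p -> {in rsector A g, f =1 f'}) -> {in rpart A p, f =1 f'}.
Proof.
move=> ff' a /rpart_sum ->; rewrite !linear_sum.
apply: eq_bigr => g gp; apply: (ff' g) => //.
exact: ract_sector_in (vgroup_adm gp).
Qed.

Lemma rsector_all_ext A (V : vectType k) (f f' : 'Hom(A, V)) :
  (forall p g, g \in vgroup p -> {in rsector A g, f =1 f'}) -> f = f'.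
Proof. by move=> ff'; apply: rpart_ext => p; apply: rsector_ext => g; apply: ff'. Qed.

(** The operator whose triviality is [self_invariant] acts in degree g as the
    transport along g itself, since g is fixed by its own conjugation. *)
Lemma sum_ract_self A p g a : g \in vgroup p -> a \in rsector A g ->
  (\sum_(q : gob G) \sum_(h in vgroup q) ract A (dgamma h h)) a = assoc_act A g a.
Proof.
move=> gp ag; have [sg tg] := vgroupP _ _ gp.
have E h q : h \in vgroup q -> ract A (dgamma h h) a = if h == g then assoc_act A g a else 0.
  move=> hq; have [sh th] := vgroupP _ _ hq.
  have hh : dbl_adm (h, h) by rewrite -dbl_adm_vgroup th.
  case: eqP => [hg|/eqP/negPf hg]; last first.
    by rewrite -(rsectorP _ gp ag) ract_gammaM ?vgroup_adm // (gconj_self hq) hg.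
  rewrite hg in hh *; have gg : g \in vgroup (gsrc g) by rewrite sg.
  by rewrite (ract_sector hh gg ag) (vgroupgV gp) (vgroupg1 gp) eqxx.
rewrite sum_lfunE (bigD1 p) //= sum_lfunE (bigD1 g) //= (E _ p) // eqxx big1 ?addr0; last first.
  by move=> h /andP[hp /negPf hg]; rewrite (E _ p) // hg.
rewrite big1 ?addr0 // => q qp; rewrite sum_lfunE big1 // => h hq; rewrite (E _ q) //.
by case: eqP => // hg; rewrite hg in hq; rewrite (vgroup_inj gp hq) eqxx in qp.
Qed.

Lemma dlinear_gamma A B (f : 'Hom(A, B)) :
  (forall g x, dbl_adm (g, x) -> (f \o ract A (dgamma g x) = ract B (dgamma g x) \o f)%VF) ->
  dlinear f.
Proof.
move=> fg u a; rewrite -!comp_lfunE.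
suff -> : (f \o ract A u = ract B u \o f)%VF by [].
apply: (@dbl_ext _ _ _ (fun u => f \o ract A u)%VF (fun u => ract B u \o f)%VF) => //.
- by move=> c v w; rewrite linearP comp_lfunDr comp_lfunZr.
by move=> c v w; rewrite linearP comp_lfunDl comp_lfunZl.
Qed.

Lemma ract_sector0 A g x p h a : dbl_adm (g, x) -> h \in vgroup p -> p != gsrc x ->
  a \in rsector A h -> ract A (dgamma g x) a = 0.
Proof.
move=> gx hp /negPf px ah; rewrite -(rpartP _ _ (rsector_part hp ah)) ract_Munit1 //.
by rewrite eq_sym px scale0r.
Qed.

(** Every gamma_g^x is, in each degree, either 0 or a transport, so linearity over
    the double amounts to respecting the degrees and the transports. *)
Lemma dlinear_homog A B (f : 'Hom(A, B)) :
  (forall p g a, g \in vgroup p -> a \in rsector A g -> f a \in rsector B g) ->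
  (forall x g a, g \in vgroup (gsrc x) -> a \in rsector A g ->
    f (assoc_act A x a) = assoc_act B x (f a)) ->
  dlinear f.
Proof.
move=> fS fact; apply: dlinear_gamma => g x gx; apply: rsector_all_ext => p h hp a ah.
rewrite !comp_lfunE; have [px|px] := eqVneq p (gsrc x); last first.
  by rewrite !(@ract_sector0 _ g x p h) ?linear0 // (fS p).
rewrite px in hp; rewrite !(@ract_sector _ g x h) ?(fS _ _ _ hp) //.
by case: ifP => _; rewrite ?linear0 // (fact _ _ _ hp).
Qed.

End Modules.

(** * Computing in the truncated tensor product *)

Section TruncatedTensors.
Variables (k : fieldType) (G : finGroupoid).
Implicit Types (A B C : rep k G) (p q : gob G) (g h x y : gmor G).

(** Defined for all a and b, so that it is bilinear, although only the components
    in common parts survive. *)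
Definition tpr A B (a : A) (b : B) : ttens A B := trunc A B (a \ot b).

Lemma tpr_linearl A B b : linear (fun a : A => tpr a b : ttens A B).
Proof. by move=> c u v; rewrite /tpr tpure_linearl linearP. Qed.

Lemma tpr_linearr A B a : linear (fun b : B => tpr a b : ttens A B).
Proof. by move=> c u v; rewrite /tpr tpure_linearr linearP. Qed.

Lemma tpr_suml A B I (r : seq I) (P : pred I) (F : I -> A) (b : B) :
  tpr (\sum_(i <- r | P i) F i) b = \sum_(i <- r | P i) tpr (F i) b.
Proof. by rewrite /tpr tpure_suml linear_sum. Qed.

Lemma tpr_sumr A B I (r : seq I) (P : pred I) (F : I -> B) (a : A) :
  tpr a (\sum_(i <- r | P i) F i) = \sum_(i <- r | P i) tpr a (F i).
Proof. by rewrite /tpr tpure_sumr linear_sum. Qed.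

Lemma tprZl A B c (a : A) (b : B) : tpr (c *: a) b = c *: tpr a b.
Proof.
have := tpr_linearl b c a 0; rewrite addr0 => ->.
have := tpr_linearl b (-1) (0 : A) 0; rewrite scaler0 addr0 scaleN1r addNr => ->.
by rewrite addr0.
Qed.

Lemma tprZr A B c (a : A) (b : B) : tpr a (c *: b) = c *: tpr a b.
Proof.
have := tpr_linearr a c b 0; rewrite addr0 => ->.
have := tpr_linearr a (-1) (0 : B) 0; rewrite scaler0 addr0 scaleN1r addNr => ->.
by rewrite addr0.
Qed.

Lemma tpr0l A B (b : B) : tpr (0 : A) b = 0.
Proof. by rewrite -(scale0r (0 : A)) tprZl scale0r. Qed.

Lemma tpr0r A B (a : A) : tpr a (0 : B) = 0.
Proof. by rewrite -(scale0r (0 : B)) tprZr scale0r. Qed.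

Lemma tpure0r A B (a : A) : a \ot (0 : B) = 0 :> tens A B.
Proof. by have := tpure_sumr [::] xpredT (fun _ : nat => 0 : B) a; rewrite !big_nil. Qed.

Lemma tpr_incl A B p (a : A) (b : B) : a \in rpart A p -> b \in rpart B p ->
  tincl A B (tpr a b) = a \ot b.
Proof. by move=> /rpartP ap /rpartP bp; apply: trunc_pure ap bp. Qed.

Lemma tpr_val A B (a : A) (b : B) : vsval (tpr a b) =
  \sum_p ract A (dunit1 k p) a \ot ract B (dunit1 k p) b.
Proof.
rewrite trunc_val dcop1 linear_sum sum_lfunE; apply: eq_bigr => p _.
by rewrite /= tact_pure tmapE.
Qed.

Lemma trunc_incl A B t : trunc A B (tincl A B t) = t.
Proof.
by apply: val_inj; rewrite /= trunc_val tincl_val ttens_cop1.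
Qed.

(** Truncation is the sum over p of the projections to A^p (x) B^p. *)
Lemma tpr_sum A B (a : A) (b : B) :
  tpr a b = \sum_p tpr (ract A (dunit1 k p) a) (ract B (dunit1 k p) b).
Proof.
rewrite -{1}[tpr a b]trunc_incl tincl_val tpr_val linear_sum.
exact: eq_bigr.
Qed.

Lemma tpr_partl A B p (a : A) (b : B) : a \in rpart A p ->
  tpr a b = tpr a (ract B (dunit1 k p) b).
Proof.
move=> ap; rewrite tpr_sum (bigD1 p) //= (ract_unit1_part _ ap) eqxx scale1r.
by rewrite big1 ?addr0 // => q /negPf qp; rewrite (ract_unit1_part _ ap) qp scale0r tpr0l.
Qed.

Lemma ttens_ext A B (V : vectType k) (f f' : 'Hom(ttens A B, V)) :
  (forall p, {in rpart A p & rpart B p, forall a b, f (tpr a b) = f' (tpr a b)}) ->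
  f = f'.
Proof.
move=> ff'; apply/lfunP=> t; rewrite -[t]trunc_incl.
move: (tincl A B t) => {}t; rewrite -[RHS]comp_lfunE -[LHS]comp_lfunE.
congr (_ t); congr fun_of_lfun; apply: tens_ext => a b; rewrite !comp_lfunE.
rewrite -/(tpr a b) tpr_sum !linear_sum; apply: eq_bigr => p _.
by apply: (ff' p); apply: ract_unit1_in.
Qed.

Lemma ract_tpr A B g x p (a : A) (b : B) : dbl_adm (g, x) ->
  a \in rpart A p -> b \in rpart B p ->
  ract (ttens A B) (dgamma g x) (tpr a b) =
  \sum_(g1 in vgroup (gtgt x)) \sum_(g2 in vgroup (gtgt x) | (g1 * g2 == g)%gpd)
    tpr (ract A (dgamma g1 x) a) (ract B (dgamma g2 x) b).
Proof.
move=> gx ap bp; apply: val_inj; rewrite /= [LHS]ttens_actE -tincl_val (tpr_incl ap bp).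
rewrite dcop_gamma // linear_sum sum_lfunE linear_sum; apply: eq_bigr => g1 g1x.
rewrite linear_sum sum_lfunE linear_sum; apply: eq_bigr => g2 /andP[g2x _].
rewrite /= tact_pure tmapE -tincl_val (@tpr_incl _ _ (gtgt x)) //.
  by apply/rpartP; rewrite ract_unit1M ?eqxx ?scale1r // -dbl_adm_vgroup.
by apply/rpartP; rewrite ract_unit1M ?eqxx ?scale1r // -dbl_adm_vgroup.
Qed.

(** Summing the coproduct of gamma_g^x over all g makes the two tensor factors run
    independently over the vertex group. *)
Lemma assoc_act_tpr A B x p (a : A) (b : B) : a \in rpart A p -> b \in rpart B p ->
  assoc_act (ttens A B) x (tpr a b) = tpr (assoc_act A x a) (assoc_act B x b).
Proof.
move=> ap bp; rewrite !sum_lfunE.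
under eq_bigr => g gx do rewrite (ract_tpr _ ap bp) -?dbl_adm_vgroup //.
rewrite exchange_big tpr_suml /=; apply: eq_bigr => g1 g1p.
rewrite tpr_sumr (exchange_big_dep (mem (vgroup (gtgt x)))) //=; last first.
  by move=> g i _ /andP[].
apply: eq_bigr => g2 g2p.
rewrite (big_pred1 (g1 * g2)%gpd) // => g /=.
rewrite -!topredE /= [_ == g]eq_sym; case: (g =P _) => [->|]; last by rewrite !andbF.
by rewrite andbT; apply/andP; split; [exact: vgroupM g1p g2p | exact: g2p].
Qed.

(** The case x = e_p of [assoc_act_tpr]. *)
Lemma tpr_in_part A B p (a : A) (b : B) : a \in rpart A p -> b \in rpart B p ->
  tpr a b \in rpart (ttens A B) p.
Proof.
move=> ap bp; apply/rpartP; rewrite -assoc_act_id (assoc_act_tpr _ ap bp) !assoc_act_id.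
by rewrite (rpartP _ _ ap) (rpartP _ _ bp).
Qed.

Lemma tpr_sector A B p g h (a : A) (b : B) : g \in vgroup p -> h \in vgroup p ->
  a \in rsector A g -> b \in rsector B h -> tpr a b \in rsector (ttens A B) (g * h)%gpd.
Proof.
move=> gp hp ag bh; have ghp := vgroupM gp hp.
apply/(rsectorP _ ghp); have ap := rsector_part gp ag; have bp := rsector_part hp bh.
rewrite (ract_tpr (vgroup_adm ghp) ap bp) gtgt_id (bigD1 g) //= (bigD1 h) ?eqxx ?andbT //=.
have {}ag := ract_gamma_id gp _ ag; have {}bh := ract_gamma_id hp _ bh.
rewrite ag // bh // !eqxx big1 ?addr0 => [|h' /andP[/andP[h'p _] /negPf h'h]].
  rewrite big1 ?addr0 // => g' /andP[g'p /negPf g'g]; rewrite big1 // => h' _.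
  by rewrite ag // g'g tpr0l.
by rewrite bh // h'h tpr0r.
Qed.

Lemma ttens_map_tpr A A' B B' (f : 'Hom(A, A')) (f' : 'Hom(B, B')) p a b :
  a \in rpart A p -> b \in rpart B p ->
  ttens_map f f' (tpr a b) = tpr (f a) (f' b).
Proof. by move=> ap bp; rewrite !comp_lfunE (tpr_incl ap bp) tmapE. Qed.

(** Between the inclusions and truncations that make up the associator, vectors in
    a common part are left unchanged. *)
Lemma rassoc_tpr A B C p a b c :
  a \in rpart A p -> b \in rpart B p -> c \in rpart C p ->
  rassoc A B C (tpr (tpr a b) c) = tpr a (tpr b c).
Proof.
move=> ap bp cp; rewrite !comp_lfunE (tpr_incl (tpr_in_part ap bp) cp).
by rewrite tmapE (tpr_incl ap bp) lfunE tassocE tmapE lfunE.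
Qed.

Lemma rassocV_tpr A B C p a b c :
  a \in rpart A p -> b \in rpart B p -> c \in rpart C p ->
  rassocV A B C (tpr a (tpr b c)) = tpr (tpr a b) c.
Proof.
move=> ap bp cp; rewrite !comp_lfunE (tpr_incl ap (tpr_in_part bp cp)).
by rewrite tmapE (tpr_incl bp cp) lfunE tassocVE tmapE lfunE.
Qed.

(** The R-matrix projects a to each degree g in turn and transports b along g. *)
Lemma braiding_tpr A B p a b : a \in rpart A p -> b \in rpart B p ->
  braiding A B (tpr a b) =
  \sum_(g in vgroup p) tpr (assoc_act B g b) (ract A (dgamma g (gid p)) a).
Proof.
move=> ap bp; rewrite !comp_lfunE (tpr_incl ap bp) /dRmx linear_sum sum_lfunE.
rewrite linear_sum (bigD1 p) //= [X in _ + X]big1 ?addr0 => [|q qp].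
  rewrite linear_sum sum_lfunE !linear_sum; apply: eq_bigr => g gp.
  have [_ tg] := vgroupP _ _ gp.
  rewrite sum_lfunE tg tpr_suml /= linear_sum sum_lfunE !linear_sum; apply: eq_bigr => h hp.
  by rewrite /= tact_pure tmapE tswapE.
rewrite linear_sum sum_lfunE !linear_sum big1 // => g gq.
rewrite /= linear_sum sum_lfunE !linear_sum big1 // => h hq.
rewrite /= tact_pure tmapE tswapE -(rpartP _ _ ap) ract_Munit1 ?vgroup_adm //.
by rewrite gsrc_id (negPf qp) scale0r tpure0r.
Qed.

(** The unit object is one-dimensional over each object of the groupoid, which is
    why tensoring with it can be checked on the vectors [dt1 k p]. *)
Lemma unit_part p z : z \in rpart (unit_rep k G) p -> z = dcoef p (vsval z) *: dt1 k p.
Proof.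
move=> /rpartP zp; rewrite -{1}zp {1}[z]dt_expand linear_sum /= (bigD1 p) //=.
rewrite big1 ?addr0 => [|q /negPf qp]; first by rewrite linearZ /= ract_dt1.
by rewrite linearZ /= (ract1K p (ract_dt1 k q)) eq_sym qp scale0r scaler0.
Qed.

Lemma dt1_part p : dt1 k p \in rpart (unit_rep k G) p.
Proof. by apply/rpartP; apply: ract_dt1. Qed.

Lemma dt_one_sum : dt_one = \sum_p dt1 k p :> unit_rep k G.
Proof.
apply: val_inj; rewrite /= linear_sum /= vsprojK; first by under eq_bigr do rewrite dt1_val.
rewrite -[1]/(dunit k G) /dunit; apply: rpred_sum => p _.
by rewrite -dt1_val subvsP.
Qed.

Lemma unit_ttens_ext A (V : vectType k) (f f' : 'Hom(ttens (unit_rep k G) A, V)) :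
  (forall p, {in rpart A p, forall a, f (tpr (dt1 k p) a) = f' (tpr (dt1 k p) a)}) ->
  f = f'.
Proof.
move=> ff'; apply: ttens_ext => p z a zp ap.
by rewrite (unit_part zp) !tprZl !linearZ /= ff'.
Qed.

Lemma ttens_unit_ext A (V : vectType k) (f f' : 'Hom(ttens A (unit_rep k G), V)) :
  (forall p, {in rpart A p, forall a, f (tpr a (dt1 k p)) = f' (tpr a (dt1 k p))}) ->
  f = f'.
Proof.
move=> ff'; apply: ttens_ext => p a z ap zp.
by rewrite (unit_part zp) !tprZr !linearZ /= ff'.
Qed.

(** A vector of the p-part of A (x) B is its own projection, so the first factor
    may be replaced by pure tensors over the same object p. *)
Lemma ttens3_ext A B C (V : vectType k) (f f' : 'Hom(ttens (ttens A B) C, V)) :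
  (forall p a b c, a \in rpart A p -> b \in rpart B p -> c \in rpart C p ->
    f (tpr (tpr a b) c) = f' (tpr (tpr a b) c)) ->
  f = f'.
Proof.
move=> ff'; apply: ttens_ext => p t c /rpartP <- cp.
pose L (f : 'Hom(ttens (ttens A B) C, V)) : 'Hom(ttens A B, V) := linfun (fun t => f (tpr t c)).
have LE f0 t' : L f0 t' = f0 (tpr t' c).
  by rewrite [LHS]linfunE // => d u v; rewrite tpr_linearl linearP.
rewrite -!LE -!comp_lfunE; congr (fun_of_lfun _ t).
apply: ttens_ext => q a b aq bq; rewrite !comp_lfunE !LE.
rewrite (ract_unit1_part p (tpr_in_part aq bq)); case: eqP => [e|_]; last first.
  by rewrite scale0r tpr0l !linear0.
by rewrite scale1r; apply: (ff' q); rewrite // -e.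
Qed.

Lemma ttens_sector_ext A B (V : vectType k) (f f' : 'Hom(ttens A B, V)) :
  (forall p g h, g \in vgroup p -> h \in vgroup p ->
    {in rsector A g & rsector B h, forall a b, f (tpr a b) = f' (tpr a b)}) ->
  f = f'.
Proof.
move=> ff'; apply: ttens_ext => p a b /rpart_sum -> /rpart_sum ->.
rewrite tpr_suml !linear_sum; apply: eq_bigr => g gp.
rewrite tpr_sumr !linear_sum; apply: eq_bigr => h hp.
by apply: (ff' p g h) => //; apply: ract_sector_in; apply: vgroup_adm.
Qed.

(** The form of [dlinear_homog] needed for maps out of a tensor product, whose
    degree-g summand is not itself a set of pure tensors. *)
Lemma dlinear_ttens_homog A B C (f : 'Hom(ttens A B, C)) :
  (forall p g h a b, g \in vgroup p -> h \in vgroup p ->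
    a \in rsector A g -> b \in rsector B h -> f (tpr a b) \in rsector C (g * h)%gpd) ->
  (forall x a b, a \in rpart A (gsrc x) -> b \in rpart B (gsrc x) ->
    f (tpr (assoc_act A x a) (assoc_act B x b)) = assoc_act C x (f (tpr a b))) ->
  dlinear f.
Proof.
move=> fS fact; apply: dlinear_gamma => g x gx; apply: ttens_sector_ext => p g1 h1 g1p h1p a b ag bh.
have abS := tpr_sector g1p h1p ag bh; have ghp := vgroupM g1p h1p.
rewrite !comp_lfunE; have [px|px] := eqVneq p (gsrc x); last first.
  by rewrite !(@ract_sector0 _ _ _ g x p (g1 * h1)%gpd) ?linear0 // (fS p).
have ap := rsector_part g1p ag; have bp := rsector_part h1p bh.
rewrite px in ghp ap bp; rewrite !(@ract_sector _ _ _ g x (g1 * h1)%gpd) ?(fS p) //.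
by case: ifP => _; rewrite ?linear0 // (assoc_act_tpr _ ap bp) fact.
Qed.

Lemma ract_gamma_dt1 g x p : dbl_adm (g, x) ->
  ract (unit_rep k G) (dgamma g x) (dt1 k p) =
  if (gsrc x == p) && (g == gid (gtgt x)) then dt1 k (gtgt x) else 0.
Proof.
move=> gx; apply: val_inj; rewrite /= [LHS]dt_actE dt1_val.
rewrite -[dgamma g x * _]/(dmul _ _) dmul1_gammar //.
pose m : {linear dbl k G -> dbl k G} :=
  HB.pack (@deps_t k G) (GRing.isLinear.Build _ _ _ _ _ (@deps_t_linear k G)).
rewrite -[deps_t _]/(m _) linearZ /= deps_t_gamma // scalerA -natrM mulnb.
by case: ifP => _; rewrite ?scale1r ?scale0r ?dt1_val.
Qed.

Lemma dcoefP p : scalar (dcoef p : dbl k G -> k).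
Proof. by move=> c a b; apply: (@dcoef_linear k G p). Qed.

Lemma dcoef_dt1 p q : dcoef p (vsval (dt1 k q : unit_rep k G)) = (q == p)%:R.
Proof.
pose m : {scalar dbl k G} :=
  HB.pack (dcoef p : dbl k G -> k) (GRing.isLinear.Build _ _ _ _ _ (dcoefP p)).
rewrite dt1_val -[LHS]/(m _) linear_sum /=.
have E g : g \in vgroup q -> dcoef p (dgamma g (gid q) : dbl k G) =
    ((g == gid p) && (gid q == gid p))%:R.
  by move=> gq; rewrite /dcoef dlift_gamma vgroup_adm.
rewrite (eq_bigr _ E) (bigD1 (gid q)) ?vgroup1 //= andbb big1 ?addr0.
  by congr (_%:R); congr nat_of_bool; apply/eqP/eqP => [e|-> //]; rewrite -(gsrc_id q) e gsrc_id.
move=> g /andP[gq /negPf gq1].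
by case: (gid q =P gid p) => [<-|_]; rewrite ?gq1 ?andbF.
Qed.

Lemma dcoefZ p c (z : unit_rep k G) : dcoef p (vsval (c *: z)) = c * dcoef p (vsval z).
Proof.
pose m : {scalar dbl k G} :=
  HB.pack (dcoef p : dbl k G -> k) (GRing.isLinear.Build _ _ _ _ _ (dcoefP p)).
by rewrite linearZ -[LHS]/(m _) linearZ.
Qed.

Lemma dt1Z_inj p c d : c *: dt1 k p = d *: dt1 k p :> unit_rep k G -> c = d.
Proof.
move/(congr1 (fun z : unit_rep k G => dcoef p (vsval z))).
by rewrite !dcoefZ dcoef_dt1 eqxx !mulr1.
Qed.

End TruncatedTensors.

(** * The algebra attached to a Frobenius object *)

Section FrobeniusToAlgebra.
Variables (k : fieldType) (G : finGroupoid) (A : rep k G) (F : frobenius A).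
Implicit Types (p q : gob G) (g h x y : gmor G) (a b c : A).
Local Notation "a ∙ b" := (assoc_mul F a b) (at level 40, left associativity).
Local Notation ε := (assoc_eps F).
Local Notation φ := (assoc_act A).
Local Notation P := (fun p => ract A (dunit1 k p)).

Lemma assoc_mulE a b : a ∙ b = fmul F (tpr a b).
Proof. by rewrite tpr_sum linear_sum. Qed.

Lemma assoc_mul_linearl b : linear (assoc_mul F ^~ b).
Proof. by move=> c u v; rewrite !assoc_mulE tpr_linearl linearP. Qed.

Lemma assoc_mul_linearr a : linear (assoc_mul F a).
Proof. by move=> c u v; rewrite !assoc_mulE tpr_linearr linearP. Qed.

Lemma assoc_mul_part p a b : a \in rpart A p -> b \in rpart A p -> a ∙ b \in rpart A p.
Proof.
move=> ap bp; rewrite assoc_mulE; apply: dlinear_part (fmul_dlinear F) _.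
exact: tpr_in_part.
Qed.

Lemma assoc_mul_sector p g h a b : g \in vgroup p -> h \in vgroup p ->
  a \in rsector A g -> b \in rsector A h -> a ∙ b \in rsector A (g * h)%gpd.
Proof.
move=> gp hp ag bh; rewrite assoc_mulE.
apply: dlinear_sector (fmul_dlinear F) (vgroupM gp hp) _.
exact: tpr_sector gp hp ag bh.
Qed.

Lemma assoc_mul_part0 p q a b : p != q -> a \in rpart A p -> b \in rpart A q -> a ∙ b = 0.
Proof.
move=> /negPf pq ap bq; rewrite assoc_mulE (tpr_partl _ ap) (ract_unit1_part _ bq) pq.
by rewrite scale0r tpr0r linear0.
Qed.

(** Lets identities between arbitrary elements be checked one part at a time. *)
Lemma ract_assoc_mul p a b : P p (a ∙ b) = P p a ∙ P p b.
Proof.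
rewrite {1}/assoc_mul linear_sum (bigD1 p) //= big1 ?addr0 => [|q /negPf qp].
  rewrite -[fmul F _]/(fmul F (tpr (P p a) (P p b))) -assoc_mulE; apply/rpartP.
  by apply: assoc_mul_part; apply: ract_unit1_in.
rewrite -[fmul F _]/(fmul F (tpr (P q a) (P q b))) -assoc_mulE.
rewrite (@ract_unit1_part _ _ _ q) 1?eq_sym ?qp ?scale0r //.
by apply: assoc_mul_part; apply: ract_unit1_in.
Qed.

Lemma assoc_mulA_part p a b c : a \in rpart A p -> b \in rpart A p -> c \in rpart A p ->
  a ∙ (b ∙ c) = a ∙ b ∙ c.
Proof.
move=> ap bp cp; have abp := tpr_in_part ap bp; have bcp := tpr_in_part bp cp.
have : fmul F (ttens_map \1 (fmul F) (rassoc A A A (tpr (tpr a b) c))) =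
    fmul F (ttens_map (fmul F) \1 (tpr (tpr a b) c)) by rewrite -!comp_lfunE fmulA.
rewrite (rassoc_tpr ap bp cp) (ttens_map_tpr _ _ ap bcp).
by rewrite (ttens_map_tpr _ _ abp cp) !lfunE !assoc_mulE.
Qed.

Lemma assoc_mulA : associative (assoc_mul F).
Proof.
move=> a b c; rewrite -[LHS]sum_ract_unit1 -[RHS]sum_ract_unit1.
apply: eq_bigr => p _; rewrite !ract_assoc_mul.
by apply: (@assoc_mulA_part p); apply: ract_unit1_in.
Qed.

Lemma assoc_one_part p : P p (assoc_one F) = funit F (dt1 k p).
Proof.
rewrite /assoc_one -funit_dlinear dt_one_sum linear_sum (bigD1 p) //=.
rewrite ract_dt1 big1 ?addr0 // => q /negPf qp.
by rewrite (ract1K p (ract_dt1 k q)) eq_sym qp scale0r.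
Qed.

Lemma assoc_mul1 : left_id (assoc_one F) (assoc_mul F).
Proof.
move=> a; rewrite -[LHS]sum_ract_unit1 -[RHS]sum_ract_unit1; apply: eq_bigr => p _.
have ap := ract_unit1_in p a.
rewrite ract_assoc_mul assoc_one_part assoc_mulE; move: (ract A _ a) ap => {}a ap.
have := congr1 (fun f : 'Hom(_, _) => f (tpr (dt1 k p) a)) (fmul1 F).
rewrite comp_lfunE (ttens_map_tpr _ _ (dt1_part k p) ap) lfunE => ->.
by apply: lunitorE; apply/rpartP.
Qed.

Lemma assoc_mulr1 : right_id (assoc_one F) (assoc_mul F).
Proof.
move=> a; rewrite -[LHS]sum_ract_unit1 -[RHS]sum_ract_unit1; apply: eq_bigr => p _.
have ap := ract_unit1_in p a.
rewrite ract_assoc_mul assoc_one_part assoc_mulE; move: (ract A _ a) ap => {}a ap.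
have := congr1 (fun f : 'Hom(_, _) => f (tpr a (dt1 k p))) (fmulr1 F).
rewrite comp_lfunE (ttens_map_tpr _ _ ap (dt1_part k p)) lfunE => ->.
by apply: runitorE; apply/rpartP.
Qed.

Lemma assoc_act_mul x a b : a \in rpart A (gsrc x) -> b \in rpart A (gsrc x) ->
  φ x (a ∙ b) = φ x a ∙ φ x b.
Proof.
move=> ax bx; rewrite !assoc_mulE -(dlinear_act _ _ (fmul_dlinear F)).
by rewrite (assoc_act_tpr _ ax bx).
Qed.

Lemma assoc_eps_part p c : c \in rpart A p -> fcounit F c = ε c *: dt1 k p.
Proof.
move=> cp; rewrite assoc_epsE (bigD1 p) //= /rcomp (rpartP _ _ cp).
rewrite big1 ?addr0 // => q /negPf qp.
rewrite (ract_unit1_part _ cp) qp scale0r.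
have := @assoc_eps_linear k G A F (-1) 0 0.
by rewrite scaler0 addr0 mulN1r addNr => ->; rewrite scale0r.
Qed.

Lemma dt1_act x : assoc_act (unit_rep k G) x (dt1 k (gsrc x)) = dt1 k (gtgt x).
Proof.
rewrite sum_lfunE (bigD1 (gid (gtgt x))) ?vgroup1 //= ract_gamma_dt1 -?dbl_adm_vgroup ?vgroup1 //.
rewrite !eqxx big1 ?addr0 // => g /andP[gx /negPf g1].
by rewrite ract_gamma_dt1 -?dbl_adm_vgroup // g1 andbF.
Qed.

(** The counit is linear over the double and the transports of the unit object
    permute the vectors [dt1 k p]. *)
Lemma assoc_eps_act x c : c \in rpart A (gsrc x) -> ε (φ x c) = ε c.
Proof.
move=> cx; have := dlinear_act x c (fcounit_dlinear F).
rewrite (assoc_eps_part cx) (assoc_eps_part (assoc_act_part x c)) linearZ /= dt1_act.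
exact: dt1Z_inj.
Qed.

(** The unit object lives in the identity degrees only. *)
Lemma assoc_eps_sector p g c : g \in vgroup p -> g != gid p -> c \in rsector A g -> ε c = 0.
Proof.
move=> gp /negPf g1 cg; have cp := rsector_part gp cg.
have := fcounit_dlinear F (dgamma g (gid p)) c.
rewrite (rsectorP _ gp cg) (assoc_eps_part cp) linearZ /=.
rewrite ract_gamma_dt1 ?vgroup_adm // gtgt_id g1 andbF scaler0.
by rewrite -(scale0r (dt1 k p)) => /dt1Z_inj.
Qed.

(** In the braiding of a homogeneous a with b a single degree contributes. *)
Lemma assoc_mulC p g a b : g \in vgroup p -> a \in rsector A g -> b \in rpart A p ->
  a ∙ b = φ g b ∙ a.
Proof.
move=> gp ag bp; have ap := rsector_part gp ag.
rewrite assoc_mulE -[in LHS](fmulC F) comp_lfunE (braiding_tpr ap bp) linear_sum.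
rewrite (bigD1 g) //= (ract_gamma_id gp gp ag) eqxx -assoc_mulE big1 ?addr0 //.
by move=> h /andP[hp /negPf hg]; rewrite (ract_gamma_id gp hp ag) hg tpr0r linear0.
Qed.

Lemma assoc_act_self p g a : self_invariant A -> g \in vgroup p -> a \in rsector A g ->
  φ g a = a.
Proof. by move=> inv gp ag; rewrite -(sum_ract_self gp ag) inv id_lfunE. Qed.

(** By the Frobenius relation the coproduct of a = a.1 is a.1_(1) (x) 1_(2); the
    counit axiom then writes a as the sum of the eps(a.1_(1)) 1_(2), and each of
    these pairings vanishes. *)
Lemma assoc_eta_nondeg p a : a \in rpart A p ->
  (forall b, b \in rpart A p -> ε (a ∙ b) = 0) -> a = 0.
Proof.
move=> ap a0; have onep : P p (assoc_one F) \in rpart A p by apply: ract_unit1_in.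
have Ea : a = fmul F (tpr a (P p (assoc_one F))).
  rewrite -assoc_mulE -{1}(rpartP _ _ ap) -{1}(assoc_mulr1 a) ract_assoc_mul.
  by rewrite (rpartP _ _ ap).
have fD := fcomul_dlinear F.
have : lunitor A (ttens_map (fcounit F) \1 (fcomul F a)) = a.
  by rewrite -!comp_lfunE fcomul1 lfunE.
have : fcomul F (fmul F (tpr a (P p (assoc_one F)))) =
    ttens_map (fmul F) \1 (rassocV A A A (ttens_map \1 (fcomul F) (tpr a (P p (assoc_one F))))).
  by rewrite -!comp_lfunE frobl.
rewrite -Ea => ->; rewrite (ttens_map_tpr _ _ ap onep) id_lfunE => <-.
move/(dlinear_part fD): onep; move: (fcomul F _) => t /rpartP <-.
(* As a function of the second argument, the composite is linear, so it suffices
   that it kills pure tensors b (x) c in the p-part: their image is eps(a.b) c. *)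
pose L : 'Hom(ttens A A, A) := linfun (fun t => lunitor A
  (ttens_map (fcounit F) \1 (ttens_map (fmul F) \1 (rassocV A A A (tpr a t))))).
have LE t' : L t' = lunitor A
  (ttens_map (fcounit F) \1 (ttens_map (fmul F) \1 (rassocV A A A (tpr a t')))).
  by rewrite [LHS]linfunE // => c u v; rewrite tpr_linearr !linearP.
rewrite -LE -comp_lfunE.
suff -> : (L \o ract (ttens A A) (dunit1 k p))%VF = 0 by rewrite lfunE.
apply: ttens_ext => q b c bq cq; rewrite comp_lfunE [RHS]lfunE LE.
rewrite (ract_unit1_part p (tpr_in_part bq cq)); case: eqP => [e|_]; last first.
  by rewrite scale0r tpr0r !linear0.
rewrite -e in bq cq; rewrite scale1r (rassocV_tpr ap bq cq).
rewrite (ttens_map_tpr _ _ (tpr_in_part ap bq) cq) -assoc_mulE id_lfunE.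
rewrite (ttens_map_tpr _ _ (assoc_mul_part ap bq) cq) (assoc_eps_part (assoc_mul_part ap bq)).
by rewrite a0 // scale0r tpr0l linear0.
Qed.

Lemma assoc_eta0 p g h a b : g \in vgroup p -> h \in vgroup p -> (g * h)%gpd <> gid p ->
  a \in rsector A g -> b \in rsector A h -> ε (a ∙ b) = 0.
Proof.
move=> gp hp /eqP gh ag bh; apply: (assoc_eps_sector (vgroupM gp hp) gh).
exact: assoc_mul_sector gp hp ag bh.
Qed.

Lemma assoc_mul_sumr I (r : seq I) (Q : pred I) (f : I -> A) a :
  a ∙ (\sum_(i <- r | Q i) f i) = \sum_(i <- r | Q i) a ∙ f i.
Proof. by rewrite assoc_mulE tpr_sumr linear_sum; apply: eq_bigr => i _; rewrite assoc_mulE. Qed.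

Lemma assoc_eps_sum I (r : seq I) (Q : pred I) (f : I -> A) :
  ε (\sum_(i <- r | Q i) f i) = \sum_(i <- r | Q i) ε (f i).
Proof.
pose m : {scalar A} := HB.pack (assoc_eps F : A -> k)
  (GRing.isLinear.Build _ _ _ _ _ (@assoc_eps_linear k G A F)).
by rewrite -[LHS]/(m _) linear_sum.
Qed.

Lemma assoc_eta_nondegl p g h a : g \in vgroup p -> h \in vgroup p ->
  (g * h)%gpd = gid p -> a \in rsector A g ->
  {in rsector A h, forall b, ε (a ∙ b) = 0} -> a = 0.
Proof.
move=> gp hp gh ag a0; apply: (assoc_eta_nondeg (rsector_part gp ag)) => b bp.
rewrite (rpart_sum bp) assoc_mul_sumr assoc_eps_sum big1 // => h' h'p.
have bh' : ract A (dgamma h' (gid p)) b \in rsector A h'.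
  exact: ract_sector_in (vgroup_adm h'p).
have [e|/eqP ne] := eqVneq (g * h')%gpd (gid p); last exact: assoc_eta0 gp h'p ne ag bh'.
by rewrite (vgroup_invP gp h'p e) -(vgroup_invP gp hp gh) in bh' *; apply: a0.
Qed.

(** Twisted commutativity turns a.b into phi(g)(b).a, and phi(g) fixes b because
    b has degree g^-1 and is fixed by phi(g^-1). *)
Lemma assoc_eta_sym p g h a b : self_invariant A -> g \in vgroup p -> h \in vgroup p ->
  (g * h)%gpd = gid p -> a \in rsector A g -> b \in rsector A h -> ε (a ∙ b) = ε (b ∙ a).
Proof.
move=> inv gp hp gh ag bh; have bp := rsector_part hp bh.
have hV := vgroup_invP gp hp gh; have [sg tg] := vgroupP _ _ gp.
rewrite (assoc_mulC gp ag bp); congr (ε (_ ∙ a)).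
rewrite -[in LHS](assoc_act_self inv hp bh) hV.
by apply: assoc_actKV; rewrite tg.
Qed.

Lemma assoc_act_sector x g a : g \in vgroup (gsrc x) -> a \in rsector A g ->
  φ x a \in rsector A (x * (g * x^-1))%gpd.
Proof.
move=> gx ag; rewrite (assoc_actE gx ag).
by apply: ract_sector_in; rewrite -dbl_adm_vgroup vgroup_conj.
Qed.

Lemma rpart_full : (\sum_p rpart A p)%VS = fullv.
Proof.
apply/eqP; rewrite eqEsubv subvf /=; apply/subvP => a _.
rewrite -(sum_ract_unit1 a); apply: rpred_sum => p _.
by apply: (subvP (sumv_sup p _ (subvv _))) => //; apply: ract_unit1_in.
Qed.

Lemma rpart_direct : directv (\sum_p rpart A p).
Proof.
apply/directv_sum_independent => us usp us0 p _.
have := congr1 (P p) us0; rewrite linear0 linear_sum (bigD1 p) //= big1 ?addr0.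
  by rewrite (rpartP _ _ (usp p isT)).
by move=> q /negPf qp; rewrite (ract_unit1_part p (usp q isT)) eq_sym qp scale0r.
Qed.

Lemma rsector_full p : (\sum_(g in vgroup p) rsector A g)%VS = rpart A p.
Proof.
apply/eqP; rewrite eqEsubv; apply/andP; split.
  by apply/subv_sumP => g gp; apply/subvP => a; apply: rsector_part gp _.
apply/subvP => a /rpart_sum ->; apply: rpred_sum => g gp.
apply: (subvP (sumv_sup g gp (subvv _))).
exact: ract_sector_in (vgroup_adm gp).
Qed.

Lemma rsector_direct p : directv (\sum_(g in vgroup p) rsector A g).
Proof.
apply/directv_sum_independent => us usp us0 g gp.
have := congr1 (ract A (dgamma g (gid p))) us0; rewrite linear0 linear_sum (bigD1 g) //=.
rewrite (ract_gamma_id gp gp (usp g gp)) eqxx big1 ?addr0 // => h /andP[hp /negPf hg].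
by rewrite (ract_gamma_id hp gp (usp h hp)) eq_sym hg.
Qed.

Lemma fleftE c : fleft F c =1 assoc_mul F c.
Proof.
move=> v; rewrite assoc_mulE [LHS]linfunE // => d a b.
by rewrite -!/(tpr _ _) tpr_linearr linearP.
Qed.

(** The degree bookkeeping behind both traces: multiplication by an element of
    degree g h g^-1 h^-1 takes h g h^-1 back to g, and h to g h g^-1. *)
Lemma vgroup_comm p g h : g \in vgroup p -> h \in vgroup p ->
  ((g * (h * (g^-1 * h^-1))) * (h * (g * h^-1)) = g)%gpd /\
  ((g * (h * (g^-1 * h^-1))) * h = g * (h * g^-1))%gpd.
Proof.
move=> gp hp; have [gVp hVp] := (vgroupV gp, vgroupV hp).
have K x y : x \in vgroup p -> y \in vgroup p -> (x^-1 * (x * y) = y)%gpd.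
  by move=> xp yp; rewrite (vgroupA (vgroupV xp) xp yp) (vgroupVg xp) (vgroup1g yp).
split; rewrite -!(vgroupA (p := p)) ?(vgroupM (p := p)) //.
  by rewrite K ?vgroupM // K // (vgroupgV hp) (vgroupg1 gp).
by rewrite (vgroupVg hp) (vgroupg1 gVp).
Qed.

Lemma lfun_assoc_mulE c b : linfun (assoc_mul F c) b = c ∙ b.
Proof. by rewrite linfunE //; apply: assoc_mul_linearr. Qed.

Lemma lftr_sector_mul_act p g h c : g \in vgroup p -> h \in vgroup p ->
  c \in rsector A (g * (h * (g^-1 * h^-1)))%gpd ->
  lftr (fleft F c \o ract A (dgamma (h * (g * h^-1))%gpd h))%VF
  = lftr_on (rsector A g) (linfun (assoc_mul F c) \o φ h)%VF.
Proof.
move=> gp hp cgh; have [gVp hVp] := (vgroupV gp, vgroupV hp).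
have ghp : (g * (h * (g^-1 * h^-1)))%gpd \in vgroup p by rewrite !vgroupM.
have [sh th] := vgroupP _ _ hp; have [e1 _] := vgroup_comm gp hp.
have hg : (h * (g * h^-1))%gpd \in vgroup p by rewrite !vgroupM.
have hgA : dbl_adm ((h * (g * h^-1))%gpd, h) by rewrite -dbl_adm_vgroup th.
have gh' : g \in vgroup (gsrc h) by rewrite sh.
apply: (@lftr_onE _ _ _ (ract A (dgamma g (gid p)))) => a.
- exact: ract_sector_in (vgroup_adm gp).
- by move=> ag; apply/rsectorP.
- rewrite 2!comp_lfunE; congr (fleft _ _ _).
  by rewrite ract_gammaM ?vgroup_adm // gconjK // eqxx -sh gmulx1.
- rewrite [X in X \in _]comp_lfunE fleftE -{2}e1; apply: assoc_mul_sector ghp hg cgh _.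
  exact: ract_sector_in hgA.
move=> ag; rewrite [LHS]comp_lfunE [RHS]comp_lfunE fleftE lfun_assoc_mulE.
by congr (c ∙ _); rewrite (ract_sector hgA gh' ag) eqxx.
Qed.

Lemma lftr_sector_act_mul p g h c : g \in vgroup p -> h \in vgroup p ->
  c \in rsector A (g * (h * (g^-1 * h^-1)))%gpd ->
  lftr (ract A (dgamma h (g^-1)%gpd) \o fleft F c \o ract A (dgamma h (gid p)))%VF
  = lftr_on (rsector A h) (φ (g^-1)%gpd \o linfun (assoc_mul F c))%VF.
Proof.
move=> gp hp cgh; have [gVp hVp] := (vgroupV gp, vgroupV hp).
have ghp : (g * (h * (g^-1 * h^-1)))%gpd \in vgroup p by rewrite !vgroupM.
have [sg tg] := vgroupP _ _ gp; have [_ e2] := vgroup_comm gp hp.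
have gh : (g * (h * g^-1))%gpd \in vgroup p by rewrite !vgroupM.
have hA : dbl_adm (h, (g^-1)%gpd) by rewrite -dbl_adm_vgroup gtgt_inv sg.
apply: (@lftr_onE _ _ _ (ract A (dgamma h (gid p)))) => a.
- exact: ract_sector_in (vgroup_adm hp).
- by move=> ah; apply/rsectorP.
- rewrite 4!comp_lfunE; congr (ract _ _ (fleft _ _ _)).
  by rewrite (rsectorP _ hp (ract_sector_in _ (vgroup_adm hp))).
- by rewrite 2!comp_lfunE; apply: ract_sector_in hA.
move=> ah; rewrite 2![LHS]comp_lfunE fleftE (rsectorP _ hp ah) [RHS]comp_lfunE lfun_assoc_mulE.
have cah : c ∙ a \in rsector A (g * (h * g^-1))%gpd.
  by rewrite -e2; apply: assoc_mul_sector ghp hp cgh ah.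
rewrite (ract_sector hA _ cah) ?gsrc_inv ?tg // -gconj_eq ?gsrc_inv ?gtgt_inv ?sg ?tg //.
by rewrite ginvK eqxx.
Qed.

Lemma frobenius_gfa : self_invariant A -> trace_condition F -> is_gfa (assoc_data F).
Proof.
move=> inv tc; split=> /=.
- exact: assoc_mul_linearl.
- exact: assoc_mul_linearr.
- exact: assoc_mulA.
- exact: assoc_mul1.
- exact: assoc_mulr1.
- exact: rpart_full.
- exact: rpart_direct.
- by move=> b c u v; rewrite /assoc_eta assoc_mul_linearl assoc_eps_linear.
- by move=> a c u v; rewrite /assoc_eta assoc_mul_linearr assoc_eps_linear.
- move=> x; apply/eqP; rewrite eqEsubv; apply/andP; split; apply/subvP => a.
    by move=> /memv_imgP[b _ ->]; apply: assoc_act_part.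
  move=> ax; rewrite -(assoc_actKV ax); apply: memv_img.
  by have := assoc_act_part (x^-1)%gpd a; rewrite gtgt_inv.
- by move=> x; apply: can_in_inj (assoc_actK (x := x)).
- by move=> x a b ax bx; apply: assoc_act_mul.
- move=> x u [ux uP]; split=> [|a ax]; first exact: assoc_act_part.
  have bx : φ (x^-1)%gpd a \in rpart A (gsrc x) by have := assoc_act_part (x^-1)%gpd a; rewrite gtgt_inv.
  by rewrite -{1 3}(assoc_actKV ax) -!assoc_act_mul //; have [-> ->] := uP _ bx; rewrite assoc_actKV.
- by move=> h g hg a _; apply: assoc_act_comp.
- by move=> p a /rpartP ap; rewrite assoc_act_id.
- exact: rsector_full.
- exact: rsector_direct.
- by move=> p g h gp hp a b; apply: assoc_mul_sector gp hp.
- by move=> p a b; apply: assoc_mul_part.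
- by move=> p q pq a b; apply: assoc_mul_part0.
- by move=> a b c; rewrite /assoc_eta assoc_mulA.
- move=> h a b ah bh; rewrite /assoc_eta -assoc_act_mul //.
  by rewrite assoc_eps_act // assoc_mul_part.
- move=> x g gx; apply/subvP => _ /memv_imgP[a ag ->]; exact: assoc_act_sector.
- by move=> p g h gp hp gh a ag; apply: assoc_eta_nondegl gp hp gh ag.
- move=> p g h gp hp gh b bh b0; have hV := vgroup_invP gp hp gh.
  have hg : (h * g)%gpd = gid p by rewrite hV (vgroupVg gp).
  apply: (assoc_eta_nondegl hp gp hg bh) => a ag.
  by rewrite (assoc_eta_sym inv hp gp hg bh ag); apply: b0.
- by move=> p g h gp hp gh a b ag bh; apply: assoc_eta0 gp hp gh ag bh.
- by move=> p g h gp hp a b ag bh; apply: assoc_mulC gp ag (rsector_part hp bh).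
- by move=> p g gp a ag; apply: assoc_act_self gp ag.
move=> p g h gp hp c cgh; rewrite -(lftr_sector_mul_act gp hp cgh) -(lftr_sector_act_mul gp hp cgh).
by apply: (tc p) => //; rewrite -rsectorE // !(vgroupM, vgroupV).
Qed.

End FrobeniusToAlgebra.

(** * The module underlying a G-Frobenius algebra *)

Section DirectSums.
Variables (k : fieldType) (V : vectType k) (I : finType).

Lemma sumv_pi_direct (Q : pred I) (Us : I -> {vspace V}) (W : {vspace V})
    (defW : W = (\sum_(i | Q i) Us i)%VS) i j v :
  directv (\sum_(i | Q i) Us i) -> Q i -> Q j -> v \in Us i ->
  sumv_pi_for defW j v = if j == i then v else 0.
Proof.
move=> /directv_sum_independent dU Qi Qj vi.
have vW : v \in W by rewrite defW; apply: (subvP (sumv_sup i Qi (subvv _))).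
apply/eqP; rewrite -subr_eq0; apply/eqP; move: j Qj; apply: dU => [j Qj|].
  by rewrite rpredB ?memv_sum_pi //; case: eqP => [->|_]; rewrite ?mem0v.
rewrite sumrB sumv_pi_sum // (bigD1 i) //= eqxx big1 ?addr0 ?subrr // => j.
by case/andP=> _ /negPf ->.
Qed.

End DirectSums.

Section AlgebraToFrobenius.
Variables (k : fieldType) (G : finGroupoid) (A : vectType k) (X : gfa_data G A).
Hypothesis HX : is_gfa X.
Implicit Types (p q : gob G) (g h x y : gmor G) (a b c : A).
Local Notation "a ∙ b" := (gfa_mul X a b) (at level 40, left associativity).
Local Notation η := (gfa_eta X).
Local Notation φ := (gfa_act X).
Local Notation part := (gfa_part X).
Local Notation sector := (gfa_sector X).
Local Notation one := (gfa_one X).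

Definition gfa_proj p : 'End(A) := sumv_pi_for (erefl (\sum_p part p)%VS) p.

(** The projection to degree g is taken in two stages since the algebra is a direct
    sum of parts, each of which is a direct sum of sectors. *)
Definition gfa_sproj g : 'End(A) :=
  (sumv_pi_for (erefl (\sum_(h in vgroup (gsrc g)) sector h)%VS) g \o gfa_proj (gsrc g))%VF.
Local Notation P := gfa_proj.
Local Notation π := gfa_sproj.

Lemma gfa_proj_in p a : P p a \in part p.
Proof. exact: memv_sum_pi. Qed.

Lemma gfa_proj_part p q a : a \in part p -> P q a = if q == p then a else 0.
Proof. by move=> ap; apply: sumv_pi_direct (gfa_part_direct HX) _ _ ap. Qed.

Lemma sum_gfa_proj a : \sum_p P p a = a.
Proof. by apply: sumv_pi_sum; rewrite (gfa_part_full HX) memvf. Qed.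

Lemma gfa_sector_part p g : g \in vgroup p -> {subset sector g <= part p}.
Proof.
move=> gp; apply/subvP; rewrite -(gfa_sector_full HX); exact: (sumv_sup g gp (subvv _)).
Qed.

Lemma gfa_sproj_in g a : π g a \in sector g.
Proof. by rewrite comp_lfunE; apply: memv_sum_pi. Qed.

Lemma gfa_sproj_sector p q g h a : g \in vgroup p -> h \in vgroup q -> a \in sector g ->
  π h a = if h == g then a else 0.
Proof.
move=> gp hq ag; have [sh th] := vgroupP _ _ hq.
rewrite /gfa_sproj comp_lfunE sh (gfa_proj_part _ (gfa_sector_part gp ag)).
case: eqP => [e|/eqP qp]; last first.
  rewrite linear0; case: eqP => // e; rewrite e in hq.
  by rewrite (vgroup_inj gp hq) eqxx in qp.
by move: (gp) (hq); rewrite -e -sh => gp' hq'; apply: sumv_pi_direct (gfa_sector_direct HX _) _ _ ag.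
Qed.

Lemma sum_gfa_sproj p a : \sum_(g in vgroup p) π g a = P p a.
Proof.
rewrite -[RHS](@sumv_pi_sum _ _ _ (mem (vgroup p)) sector _ _ erefl); last first.
  by rewrite (gfa_sector_full HX) gfa_proj_in.
by apply: eq_bigr => g /vgroupP[sg tg]; rewrite /gfa_sproj sg comp_lfunE.
Qed.

Lemma gfa_part_sum p a : a \in part p -> a = \sum_(g in vgroup p) π g a.
Proof. by move=> ap; rewrite sum_gfa_sproj (gfa_proj_part p ap) eqxx. Qed.

Lemma gfa_act_part x a : a \in part (gsrc x) -> φ x a \in part (gtgt x).
Proof. by move=> ax; rewrite -(gfa_act_onto HX) memv_img. Qed.

Lemma gfa_act_conj x g a : g \in vgroup (gsrc x) -> a \in sector g ->
  φ x a \in sector (x * (g * x^-1))%gpd.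
Proof. by move=> gx ag; apply: (subvP (gfa_act_sector HX gx)); apply: memv_img. Qed.

(** Projecting to degree x^-1 g x first puts the vector in the source part of x,
    where the transport along x is meaningful, and its image in degree g. *)
Definition gfa_dact : 'Hom(dbl k G, 'End(A)) :=
  linfun (dlift (fun g x => φ x \o π (x^-1 * (g * x))%gpd)%VF).

Lemma gfa_dact_gamma g x a : dbl_adm (g, x) ->
  gfa_dact (dgamma g x) a = φ x (π (x^-1 * (g * x))%gpd a).
Proof.
move=> gx; rewrite /gfa_dact linfunE; last exact: dlift_linear.
by rewrite dlift_gamma gx [LHS]comp_lfunE.
Qed.

Lemma gfa_dact_unit1 p : gfa_dact (dunit1 k p) = P p.
Proof.
apply/lfunP => a; rewrite linear_sum sum_lfunE -sum_gfa_sproj /=; apply: eq_bigr => g gp.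
rewrite gfa_dact_gamma ?vgroup_adm // (gconj1 gp) (gfa_act_id HX) //.
exact: gfa_sector_part gp _ (gfa_sproj_in _ _).
Qed.

Lemma gfa_dact1 : gfa_dact 1 = \1%VF.
Proof.
apply/lfunP => a; rewrite -[1]/(dunit k G) linear_sum sum_lfunE id_lfunE -[RHS]sum_gfa_proj.
by apply: eq_bigr => p _; rewrite /= gfa_dact_unit1.
Qed.

Lemma gfa_dactM (u v : dbl k G) : gfa_dact (u * v) = (gfa_dact u \o gfa_dact v)%VF.
Proof.
rewrite -[u * v]/(dmul u v).
apply: (@dbl_ext _ _ _ (fun u => gfa_dact (dmul u v)) (fun u => gfa_dact u \o gfa_dact v)%VF)
  => [c a b|c a b|g x gx].
- by rewrite dmul_linearl linearP.
- by rewrite linearP comp_lfunDl comp_lfunZl.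
apply: (@dbl_ext _ _ _ (fun v => gfa_dact (dmul (dgamma g x) v))
  (fun v => gfa_dact (dgamma g x) \o gfa_dact v)%VF) => [c a b|c a b|h y hy].
- by rewrite dmul_linearr linearP.
- by rewrite linearP comp_lfunDr comp_lfunZr.
have hyV : (y^-1 * (h * y))%gpd \in vgroup (gsrc y) by rewrite vgroup_conjV // dbl_adm_vgroup.
have gxV : (x^-1 * (g * x))%gpd \in vgroup (gsrc x) by rewrite vgroup_conjV // dbl_adm_vgroup.
have hV : h \in vgroup (gtgt y) by rewrite dbl_adm_vgroup.
apply/lfunP => a; rewrite dmul_gamma // [RHS]comp_lfunE !gfa_dact_gamma //.
have := gfa_act_conj hyV (gfa_sproj_in (y^-1 * (h * y))%gpd a).
rewrite gconjKV // => /(gfa_sproj_sector hV gxV) ->.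
case: ifP => [e|_]; last by rewrite linear0 lfunE linear0.
have [xy gxy] := dmul_adm gx hy e.
rewrite gfa_dact_gamma // (gconjM gx xy) (eqP e) (gfa_act_comp HX) //.
exact: gfa_sector_part hyV _ (gfa_sproj_in _ _).
Qed.

Definition gfa_mod : dmodule G A := DModule gfa_dact1 gfa_dactM.
Local Notation R := (Rep gfa_mod).

Lemma gfa_ract_unit1 p a : ract R (dunit1 k p) a = P p a.
Proof. by rewrite /ract /= gfa_dact_unit1. Qed.

Lemma gfa_ract_gamma1 p g a : g \in vgroup p -> ract R (dgamma g (gid p)) a = π g a.
Proof.
move=> gp; rewrite /ract /= gfa_dact_gamma ?vgroup_adm // (gconj1 gp).
by rewrite (gfa_act_id HX) // (gfa_sector_part gp (gfa_sproj_in _ _)).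
Qed.

Lemma rpart_gfa p : rpart R p = part p.
Proof.
apply/eqP; rewrite eqEsubv; apply/andP; split; apply/subvP => a.
  by move=> /rpartP <-; rewrite gfa_ract_unit1 gfa_proj_in.
by move=> ap; apply/rpartP; rewrite gfa_ract_unit1 (gfa_proj_part p ap) eqxx.
Qed.

Lemma rsector_gfa p g : g \in vgroup p -> rsector R g = sector g.
Proof.
move=> gp; apply/eqP; rewrite eqEsubv; apply/andP; split; apply/subvP => a.
  by move=> /(rsectorP _ gp) <-; rewrite gfa_ract_gamma1 // gfa_sproj_in.
by move=> ag; apply/(rsectorP _ gp); rewrite gfa_ract_gamma1 // (gfa_sproj_sector gp gp ag) eqxx.
Qed.

Lemma mem_rpart_gfa p (a : R) : (a \in rpart R p) = (a \in part p).
Proof. by rewrite rpart_gfa. Qed.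

Lemma mem_rsector_gfa p g (a : R) : g \in vgroup p -> (a \in rsector R g) = (a \in sector g).
Proof. by move=> gp; rewrite (rsector_gfa gp). Qed.

Lemma assoc_act_gfa x (a : R) : a \in part (gsrc x) -> assoc_act R x a = φ x a.
Proof.
rewrite -mem_rpart_gfa; move: a; apply: (@rsector_ext _ _ R A (assoc_act R x) (φ x)) => g gx a ag.
rewrite (assoc_actE gx ag) /ract /= gfa_dact_gamma -?dbl_adm_vgroup ?vgroup_conj //.
rewrite gconjK // (rsector_gfa gx) in ag *.
by rewrite (gfa_sproj_sector gx gx ag) eqxx.
Qed.

(** * Bilinearity *)

Lemma gfa_mul_suml I (r : seq I) (Q : pred I) (f : I -> A) b :
  (\sum_(i <- r | Q i) f i) ∙ b = \sum_(i <- r | Q i) f i ∙ b.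
Proof.
pose m : {linear A -> A} := HB.pack (gfa_mul X ^~ b)
  (GRing.isLinear.Build _ _ _ _ _ (gfa_mul_linearl HX b)).
by rewrite -[LHS]/(m _) linear_sum.
Qed.

Lemma gfa_mul_sumr I (r : seq I) (Q : pred I) (f : I -> A) a :
  a ∙ (\sum_(i <- r | Q i) f i) = \sum_(i <- r | Q i) a ∙ f i.
Proof.
pose m : {linear A -> A} := HB.pack (gfa_mul X a)
  (GRing.isLinear.Build _ _ _ _ _ (gfa_mul_linearr HX a)).
by rewrite -[LHS]/(m _) linear_sum.
Qed.

Lemma gfa_etaZl (d : k) a b : η (d *: a) b = d * η a b.
Proof.
pose m : {scalar A} := HB.pack (η ^~ b)
  (GRing.isLinear.Build _ _ _ _ _ (gfa_eta_linearl HX b)).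
by rewrite -[LHS]/(m _) linearZ.
Qed.

Lemma gfa_eta_suml I (r : seq I) (Q : pred I) (f : I -> A) b :
  η (\sum_(i <- r | Q i) f i) b = \sum_(i <- r | Q i) η (f i) b.
Proof.
pose m : {scalar A} := HB.pack (η ^~ b)
  (GRing.isLinear.Build _ _ _ _ _ (gfa_eta_linearl HX b)).
by rewrite -[LHS]/(m _) linear_sum.
Qed.

Lemma gfa_etaZr (d : k) a b : η a (d *: b) = d * η a b.
Proof.
pose m : {scalar A} := HB.pack (η a)
  (GRing.isLinear.Build _ _ _ _ _ (gfa_eta_linearr HX a)).
by rewrite -[LHS]/(m _) linearZ.
Qed.

Lemma gfa_eta_sumr I (r : seq I) (Q : pred I) (f : I -> A) a :
  η a (\sum_(i <- r | Q i) f i) = \sum_(i <- r | Q i) η a (f i).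
Proof.
pose m : {scalar A} := HB.pack (η a)
  (GRing.isLinear.Build _ _ _ _ _ (gfa_eta_linearr HX a)).
by rewrite -[LHS]/(m _) linear_sum.
Qed.

Lemma gfa_etaBr a b c : η a (b - c) = η a b - η a c.
Proof.
pose m : {scalar A} := HB.pack (η a)
  (GRing.isLinear.Build _ _ _ _ _ (gfa_eta_linearr HX a)).
by rewrite -[LHS]/(m _) linearB.
Qed.

Lemma gfa_eta0l b : η 0 b = 0.
Proof. by rewrite -(scale0r (0 : A)) gfa_etaZl mul0r. Qed.

(** * Units of the parts *)

(** Products across different parts vanish, so each projection to a part is
    multiplicative. *)
Lemma gfa_mul_proj p a b : P p (a ∙ b) = P p a ∙ P p b.
Proof.
have Eab : a ∙ b = \sum_q P q a ∙ P q b.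
  rewrite -{1}(sum_gfa_proj a) gfa_mul_suml; apply: eq_bigr => q _.
  rewrite -{1}(sum_gfa_proj b) gfa_mul_sumr (bigD1 q) //= big1 ?addr0 // => r rq.
  by rewrite (gfa_part_mul0 HX _ (gfa_proj_in q a) (gfa_proj_in r b)) // eq_sym.
rewrite Eab linear_sum (bigD1 p) //= big1 ?addr0 => [|q /negPf qp].
  by rewrite (gfa_proj_part p (gfa_part_mul HX (gfa_proj_in p a) (gfa_proj_in p b))) eqxx.
rewrite (gfa_proj_part p (gfa_part_mul HX (gfa_proj_in q a) (gfa_proj_in q b))).
by rewrite eq_sym qp.
Qed.

Lemma gfa_one_unit p : is_unit_of (gfa_mul X) (part p) (P p one).
Proof.
split=> [|a ap]; first exact: gfa_proj_in.
have Ea : P p a = a by rewrite (gfa_proj_part p ap) eqxx.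
by rewrite -{1 2 3 4}Ea -!gfa_mul_proj (gfa_mul1x HX) (gfa_mulx1 HX).
Qed.

(** Both sides are units of the same part, and units are unique. *)
Lemma gfa_act_one x : φ x (P (gsrc x) one) = P (gtgt x) one.
Proof.
have [ux uP] := gfa_act_unit HX (gfa_one_unit (gsrc x)).
have [vx vP] := gfa_one_unit (gtgt x).
by have [<- _] := vP _ ux; have [_ ->] := uP _ vx.
Qed.

(** Comparing degree-h components in 1.a = a shows that the identity component of
    the unit is already a left unit, hence equal to the unit. *)
Lemma gfa_one_sector p : P p one \in sector (gid p).
Proof.
have ep := vgroup1 p; have := gfa_one_unit p; move: (P p one) => e [eP eU].
suff -> : e = π (gid p) e by apply: gfa_sproj_in.
have U h a : h \in vgroup p -> a \in sector h -> a = π (gid p) e ∙ a.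
  move=> hp ah; have [Ea _] := eU _ (gfa_sector_part hp ah).
  have := congr1 (π h) Ea; rewrite (gfa_sproj_sector hp hp ah) eqxx.
  rewrite {1}(gfa_part_sum eP) gfa_mul_suml linear_sum (bigD1 (gid p)) //=.
  have gah g : g \in vgroup p -> π h (π g e ∙ a) = if h == (g * h)%gpd then π g e ∙ a else 0.
    move=> gp; apply: (gfa_sproj_sector (vgroupM gp hp) hp).
    by apply: (gfa_sector_mul HX gp hp) => //; apply: gfa_sproj_in.
  rewrite gah // (vgroup1g hp) eqxx big1 ?addr0 // => g /andP[gp gne].
  rewrite gah //; case: eqP => // hgh; case/eqP: gne.
  rewrite -(vgroupg1 gp) -(vgroupgV hp) (vgroupA gp hp (vgroupV hp)) -hgh.
  by rewrite (vgroupgV hp).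
transitivity (π (gid p) e ∙ e).
  rewrite [X in _ ∙ X](gfa_part_sum eP) gfa_mul_sumr [LHS](gfa_part_sum eP).
  by apply: eq_bigr => h hp; rewrite -(U h) // gfa_sproj_in.
by have [_ ->] := eU _ (gfa_sector_part ep (gfa_sproj_in (gid p) e)).
Qed.

(** * The invariant form *)

Lemma gfa_eta_part0 p q a b : p != q -> a \in part p -> b \in part q -> η a b = 0.
Proof.
move=> pq ap bq; rewrite -[b](gfa_mulx1 HX) -(gfa_eta_mul HX).
by rewrite (gfa_part_mul0 HX pq ap bq) gfa_eta0l.
Qed.

Lemma gfa_eta_one p a : a \in part p -> η a (P p one) = η a one.
Proof.
move=> ap; rewrite -{2}(sum_gfa_proj one) gfa_eta_sumr (bigD1 p) //= big1 ?addr0 // => q qp.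
by rewrite (gfa_eta_part0 _ ap (gfa_proj_in q one)) // eq_sym.
Qed.

Lemma gfa_eta_mul1 a b : η (a ∙ b) one = η a b.
Proof. by rewrite (gfa_eta_mul HX) (gfa_mulx1 HX). Qed.

Lemma gfa_eta_sectors0 p q g h a b : g \in vgroup p -> h \in vgroup q -> h != (g^-1)%gpd ->
  a \in sector g -> b \in sector h -> η a b = 0.
Proof.
move=> gp hq hg ag bh; have [e|pq] := eqVneq p q; last first.
  exact: gfa_eta_part0 pq (gfa_sector_part gp ag) (gfa_sector_part hq bh).
rewrite -e in hq; apply: (gfa_eta0 HX gp hq) => // /(vgroup_invP gp hq) hE.
by rewrite hE eqxx in hg.
Qed.

Lemma gfa_eta_sprojr p q g h a b : g \in vgroup p -> h \in vgroup q -> a \in sector g ->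
  η a (π h b) = if h == (g^-1)%gpd then η a b else 0.
Proof.
move=> gp hq ag; case: eqP => [hg|/eqP hg]; last first.
  exact: gfa_eta_sectors0 gp hq hg ag (gfa_sproj_in h b).
rewrite -{2}(sum_gfa_proj b) gfa_eta_sumr (bigD1 p) //= [X in _ + X]big1 ?addr0; last first.
  move=> r rp; rewrite (gfa_eta_part0 _ (gfa_sector_part gp ag) (gfa_proj_in r b)) //.
  by rewrite eq_sym.
have gVp := vgroupV gp.
rewrite -sum_gfa_sproj gfa_eta_sumr (bigD1 (g^-1)%gpd) //= hg big1 ?addr0 // => h' /andP[h'p h'g].
exact: gfa_eta_sectors0 gp h'p h'g ag (gfa_sproj_in h' b).
Qed.

(** Only opposite degrees pair nontrivially; there twisted commutativity applies,
    and phi(g) fixes degree g^-1. *)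
Lemma gfa_eta_sym_sector p q g h a b : g \in vgroup p -> h \in vgroup q ->
  a \in sector g -> b \in sector h -> η a b = η b a.
Proof.
move=> gp hq ag bh; have [hg|hg] := eqVneq h (g^-1)%gpd; last first.
  rewrite (gfa_eta_sectors0 gp hq hg ag bh) (gfa_eta_sectors0 hq gp _ bh ag) //.
  by apply: contra hg => /eqP ->; rewrite ginvK.
have [sg tg] := vgroupP _ _ gp; rewrite hg in bh; have gVp := vgroupV gp.
have bp := gfa_sector_part gVp bh.
rewrite -gfa_eta_mul1 (gfa_mulC HX gp gVp ag bh) gfa_eta_mul1; congr (η _ a).
rewrite -[in LHS](gfa_act_self HX gVp bh) (gfa_act_comp HX) ?gsrc_inv ?gtgt_inv ?tg ?sg //.
by rewrite (vgroupgV gp) (gfa_act_id HX bp).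
Qed.

Lemma gfa_eta_sym a b : η a b = η b a.
Proof.
have E a' : a' = \sum_p \sum_(g in vgroup p) π g a'.
  by rewrite -{1}(sum_gfa_proj a'); apply: eq_bigr => p _; rewrite sum_gfa_sproj.
rewrite {1}(E a) [in RHS](E a) gfa_eta_suml gfa_eta_sumr; apply: eq_bigr => p _.
rewrite gfa_eta_suml gfa_eta_sumr; apply: eq_bigr => g gp.
rewrite {1}(E b) [in RHS](E b) gfa_eta_suml gfa_eta_sumr; apply: eq_bigr => q _.
rewrite gfa_eta_suml gfa_eta_sumr; apply: eq_bigr => h hq.
exact: gfa_eta_sym_sector gp hq (gfa_sproj_in g a) (gfa_sproj_in h b).
Qed.

Lemma gfa_eta_nondeg a : (forall b, η a b = 0) -> a = 0.
Proof.
move=> a0; rewrite -(sum_gfa_proj a) big1 // => p _.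
rewrite -sum_gfa_sproj big1 // => g gp; have gVp := vgroupV gp.
apply: (gfa_eta_nondegl HX gp gVp (vgroupgV gp) (gfa_sproj_in g a)) => b bg.
by rewrite gfa_eta_sym (gfa_eta_sprojr _ gVp gp bg) ginvK eqxx gfa_eta_sym.
Qed.

Lemma gfa_eta_projl p a b : b \in part p -> η (P p a) b = η a b.
Proof.
move=> bp; rewrite -{2}(sum_gfa_proj a) gfa_eta_suml (bigD1 p) //= big1 ?addr0 // => q qp.
exact: gfa_eta_part0 qp (gfa_proj_in q a) bp.
Qed.

(** Invariance of eta under transports says that phi(x^-1) is the adjoint of
    phi(x). *)
Lemma gfa_eta_actV x a b : a \in part (gsrc x) -> b \in part (gtgt x) ->
  η b (φ x a) = η (φ (x^-1)%gpd b) a.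
Proof.
move=> ax bx; have bV : φ (x^-1)%gpd b \in part (gsrc x).
  by have := @gfa_act_part (x^-1)%gpd b; rewrite gsrc_inv gtgt_inv; apply.
rewrite -(gfa_eta_act HX bV ax) (gfa_act_comp HX) ?gsrc_inv ?gtgt_inv //.
by rewrite gmulxV (gfa_act_id HX bx).
Qed.

Lemma gfa_mulC_part p g a b : g \in vgroup p -> a \in sector g -> b \in part p ->
  a ∙ b = φ g b ∙ a.
Proof.
move=> gp ag bp; rewrite (gfa_part_sum bp) gfa_mul_sumr linear_sum gfa_mul_suml.
by apply: eq_bigr => h hp; apply: (gfa_mulC HX gp hp ag (gfa_sproj_in h b)).
Qed.

(** * The Casimir element *)

Local Notation J := (gmor G * 'I_(dim A))%type.

Definition gfa_coords : 'Hom(A, 'rV[k]_(dim A)) :=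
  linfun (fun a => \row_i η a (r2v (delta_mx 0 i))).

(** The basis dual to the standard one; nondegeneracy of eta makes the
    coordinate map injective, so that its partial inverse is a left inverse. *)
Definition gfa_dual i : A := (gfa_coords^-1)%VF (delta_mx 0 i).

Lemma gfa_coordsE a : gfa_coords a = \row_i η a (r2v (delta_mx 0 i)).
Proof.
rewrite linfunE // => c u v; apply/rowP => i.
by rewrite !mxE (gfa_eta_linearl HX).
Qed.

Lemma gfa_dual_sum a : \sum_i η a (r2v (delta_mx 0 i)) *: gfa_dual i = a.
Proof.
have inj : lker gfa_coords == 0%VS.
  apply/lker0P => u v /eqP; rewrite -subr_eq0 -linearB /= gfa_coordsE => /eqP uv0.
  apply/eqP; rewrite -subr_eq0; apply/eqP; apply: gfa_eta_nondeg => b.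
  rewrite (vect_delta b) gfa_eta_sumr big1 // => i _; rewrite gfa_etaZr.
  by have /rowP/(_ i) := uv0; rewrite !mxE => ->; rewrite mulr0.
rewrite -[RHS](lker0_lfunK inj) gfa_coordsE.
rewrite [in RHS](row_sum_delta (\row_i _)) linear_sum.
by apply: eq_bigr => i _; rewrite linearZ /= mxE.
Qed.

(** The families [casl] and [casr] are the homogeneous components of dual bases, in
    degrees h and h^-1, indexed by h and the position i in the basis; for h in the
    vertex group of p they form the two legs of the Casimir element of A^p. *)
Definition casl (j : J) : A := π j.1 (r2v (delta_mx 0 j.2)).
Definition casr (j : J) : A := π (j.1^-1)%gpd (gfa_dual j.2).

Lemma casl_sector j : casl j \in sector j.1.
Proof. exact: gfa_sproj_in. Qed.

Lemma casr_sector j : casr j \in sector (j.1^-1)%gpd.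
Proof. exact: gfa_sproj_in. Qed.

Lemma casl_part p j : j.1 \in vgroup p -> casl j \in part p.
Proof. by move=> jp; apply: (gfa_sector_part jp); apply: casl_sector. Qed.

Lemma casr_part p j : j.1 \in vgroup p -> casr j \in part p.
Proof. by move=> jp; apply: (gfa_sector_part (vgroupV jp)); apply: casr_sector. Qed.

(** For a of degree g only the index h = g^-1 contributes, and there the identity
    is the expansion of a in the dual bases. *)
Lemma cas_suml p a : a \in part p ->
  \sum_(j : J | j.1 \in vgroup p) η a (casl j) *: casr j = a.
Proof.
move=> ap; rewrite [RHS](gfa_part_sum ap).
transitivity (\sum_(j : J | j.1 \in vgroup p) \sum_(g in vgroup p) η (π g a) (casl j) *: casr j).
  by apply: eq_bigr => j _; rewrite -scaler_suml -gfa_eta_suml -gfa_part_sum.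
rewrite exchange_big /=; apply: eq_bigr => g gp; have ag := gfa_sproj_in g a.
move: (π g a) ag => {ap}a ag; have gVp := vgroupV gp.
have -> : \sum_(j : J | j.1 \in vgroup p) η a (casl j) *: casr j =
    \sum_(h in vgroup p) \sum_i η a (π h (r2v (delta_mx 0 i))) *: π (h^-1)%gpd (gfa_dual i).
  by rewrite pair_big_dep; apply: eq_bigl => j; rewrite andbT.
rewrite (bigD1 (g^-1)%gpd) //= [X in _ + X]big1 ?addr0.
  transitivity (π g a); last by rewrite (gfa_sproj_sector gp gp ag) eqxx.
  rewrite -[in RHS](gfa_dual_sum a) linear_sum; apply: eq_bigr => i _.
  by rewrite (gfa_eta_sprojr _ gp gVp ag) eqxx ginvK linearZ.
move=> h /andP[hp /negPf hg]; rewrite big1 // => i _.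
by rewrite (gfa_eta_sprojr _ gp hp ag) hg scale0r.
Qed.

(** Follows from [cas_suml] by pairing both sides with an arbitrary a. *)
Lemma cas_sumr p b : b \in part p ->
  \sum_(j : J | j.1 \in vgroup p) η (casr j) b *: casl j = b.
Proof.
move=> bp; apply/eqP; rewrite -subr_eq0; apply/eqP; apply: gfa_eta_nondeg => a.
rewrite gfa_eta_sym gfa_etaBr gfa_eta_sumr.
rewrite -[η a b](gfa_eta_projl a bp) -{1}(cas_suml (gfa_proj_in p a)).
rewrite gfa_eta_suml -sumrB big1 // => j jp.
by rewrite gfa_etaZl gfa_etaZr (gfa_eta_projl _ (casl_part jp)) mulrC subrr.
Qed.

Section Casimir.
Variables (W : vectType k) (B : A -> A -> W).
Hypotheses (Bl : forall b, linear (B ^~ b)) (Br : forall a, linear (B a)).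

Lemma bil_suml I (r : seq I) (Q : pred I) (c : I -> k) (f : I -> A) b :
  B (\sum_(i <- r | Q i) c i *: f i) b = \sum_(i <- r | Q i) c i *: B (f i) b.
Proof.
pose m : {linear A -> W} := HB.pack (B ^~ b) (GRing.isLinear.Build _ _ _ _ _ (Bl b)).
by rewrite -[LHS]/(m _) linear_sum; apply: eq_bigr => i _; rewrite linearZ.
Qed.

Lemma bil_sumr I (r : seq I) (Q : pred I) (c : I -> k) (f : I -> A) a :
  B a (\sum_(i <- r | Q i) c i *: f i) = \sum_(i <- r | Q i) c i *: B a (f i).
Proof.
pose m : {linear A -> W} := HB.pack (B a) (GRing.isLinear.Build _ _ _ _ _ (Br a)).
by rewrite -[LHS]/(m _) linear_sum; apply: eq_bigr => i _; rewrite linearZ.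
Qed.

(** Expand u(E_j) in the E_l and then contract the F_j: operators pass from the
    first leg to the second by taking eta-adjoints. *)
Lemma cas_adjoint p q (u v : A -> A) :
  (forall a, a \in part p -> u a \in part q) ->
  (forall b, b \in part q -> v b \in part p) ->
  (forall a b, a \in part p -> b \in part q -> η b (u a) = η (v b) a) ->
  \sum_(j : J | j.1 \in vgroup p) B (u (casl j)) (casr j) =
  \sum_(j : J | j.1 \in vgroup q) B (casl j) (v (casr j)).
Proof.
move=> uP vP uv.
under eq_bigr => j jp do rewrite -(cas_sumr (uP _ (casl_part jp))) bil_suml.
under [RHS]eq_bigr => l lq do rewrite -(cas_suml (vP _ (casr_part lq))) bil_sumr.
rewrite exchange_big; apply: eq_bigr => l lq; apply: eq_bigr => j jp.
by rewrite uv ?casl_part ?casr_part.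
Qed.

(** The Casimir element is symmetric because eta is. *)
Lemma cas_swap p :
  \sum_(j : J | j.1 \in vgroup p) B (casr j) (casl j) =
  \sum_(j : J | j.1 \in vgroup p) B (casl j) (casr j).
Proof.
under eq_bigr => j jp do rewrite -(cas_sumr (casr_part jp)) bil_suml.
under [RHS]eq_bigr => l lq do rewrite -(cas_sumr (casr_part lq)) bil_sumr.
rewrite exchange_big; apply: eq_bigr => l lq; apply: eq_bigr => j jp.
by rewrite gfa_eta_sym.
Qed.

End Casimir.

(** * Structure maps of the Frobenius object *)

Local Notation T := (ttens R R).
Local Notation U := (unit_rep k G).
Local Notation tprR := (@tpr k G R R).

Definition gfa_fmul : 'Hom(T, R) := (tlift (gfa_mul X : R -> R -> R) \o tincl R R)%VF.

Definition gfa_funit : 'Hom(U, R) := linfun (fun z : U => ract R (vsval z) one).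

Definition gfa_fcounit : 'Hom(R, U) := linfun (fun a : R => \sum_p η (P p a) one *: dt1 k p).

Definition gfa_fcomul : 'Hom(R, T) := linfun (fun a : R =>
  \sum_p \sum_(j : J | j.1 \in vgroup p) tprR (a ∙ casl j) (casr j)).

Lemma gfa_fmulE p (a b : R) : a \in part p -> b \in part p -> gfa_fmul (tprR a b) = a ∙ b.
Proof.
rewrite -!mem_rpart_gfa => ap bp; rewrite [LHS]comp_lfunE (tpr_incl ap bp) tliftE //.
  exact: gfa_mul_linearr.
exact: gfa_mul_linearl.
Qed.

Lemma gfa_funitE p : gfa_funit (dt1 k p) = P p one.
Proof.
rewrite /gfa_funit linfunE => [|c u v]; last by rewrite linearP add_lfunE scale_lfunE.
by rewrite dt1_val gfa_ract_unit1.
Qed.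

Lemma gfa_fcounitE p a : a \in part p -> gfa_fcounit a = η a one *: dt1 k p.
Proof.
move=> ap; rewrite /gfa_fcounit linfunE => [|c u v]; last first.
  rewrite scaler_sumr -big_split; apply: eq_bigr => q _ /=.
  by rewrite linearP (gfa_eta_linearl HX) scalerDl scalerA.
rewrite (bigD1 p) //= (gfa_proj_part p ap) eqxx big1 ?addr0 // => q /negPf qp.
by rewrite (gfa_proj_part q ap) qp gfa_eta0l scale0r.
Qed.

Lemma gfa_fcomulE p a : a \in part p ->
  gfa_fcomul a = \sum_(j : J | j.1 \in vgroup p) tprR (a ∙ casl j) (casr j).
Proof.
move=> ap; rewrite /gfa_fcomul linfunE => [|c u v]; last first.
  rewrite scaler_sumr -big_split; apply: eq_bigr => q _ /=.
  rewrite scaler_sumr -big_split; apply: eq_bigr => j _ /=.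
  by rewrite (gfa_mul_linearl HX) tpr_linearl.
rewrite (bigD1 p) //= [X in _ + X]big1 ?addr0 // => q qp.
rewrite big1 // => j jq; rewrite (gfa_part_mul0 HX _ ap (casl_part jq)) ?tpr0l //.
by rewrite eq_sym.
Qed.

(** Left multiplication by a is adjoint to right multiplication by a. *)
Lemma gfa_fcomulEr p a : a \in part p ->
  gfa_fcomul a = \sum_(j : J | j.1 \in vgroup p) tprR (casl j) (casr j ∙ a).
Proof.
move=> ap; rewrite (gfa_fcomulE ap).
apply: (cas_adjoint _ _ (u := gfa_mul X a) (v := gfa_mul X ^~ a)).
- exact: (@tpr_linearl k G R R).
- exact: (@tpr_linearr k G R R).
- by move=> b bp; apply: (gfa_part_mul HX).
- by move=> b bp; apply: (gfa_part_mul HX).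
by move=> b c bp cp; rewrite (gfa_eta_mul HX).
Qed.

Lemma gfa_act_tpr x (a b : R) : a \in part (gsrc x) -> b \in part (gsrc x) ->
  assoc_act T x (tprR a b) = tprR (φ x a) (φ x b).
Proof.
move=> ax bx; rewrite (@assoc_act_tpr _ _ _ _ _ (gsrc x)) ?mem_rpart_gfa //.
by rewrite (assoc_act_gfa ax) (assoc_act_gfa bx).
Qed.

Lemma gfa_fmul_dlinear : dlinear gfa_fmul.
Proof.
apply: dlinear_ttens_homog => [p g h a b gp hp|x a b].
  rewrite (mem_rsector_gfa _ gp) (mem_rsector_gfa _ hp) (mem_rsector_gfa _ (vgroupM gp hp)) => ag bh.
  rewrite (gfa_fmulE (gfa_sector_part gp ag) (gfa_sector_part hp bh)).
  exact: gfa_sector_mul HX _ _ _ gp hp _ _ ag bh.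
rewrite !mem_rpart_gfa => ax bx; have [ax' bx'] := (gfa_act_part ax, gfa_act_part bx).
rewrite (gfa_fmulE ax bx) (assoc_act_gfa ax) (assoc_act_gfa bx) (gfa_fmulE ax' bx').
by rewrite assoc_act_gfa ?(gfa_act_mul HX) //; apply: (gfa_part_mul HX).
Qed.

Lemma gfa_funit_dlinear : dlinear gfa_funit.
Proof.
have act1 x : gfa_funit (assoc_act U x (dt1 k (gsrc x))) = assoc_act R x (gfa_funit (dt1 k (gsrc x))).
  by rewrite dt1_act !gfa_funitE assoc_act_gfa ?gfa_proj_in // gfa_act_one.
apply: dlinear_homog => [p g z gp zg|x g z gx zg]; last first.
  by rewrite (unit_part (rsector_part gx zg)) !linearZ /= act1.
rewrite (mem_rsector_gfa _ gp) -(rsectorP _ gp zg) {zg}(unit_part (rsector_part gp zg)) !linearZ /=.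
rewrite ract_gamma_dt1 ?vgroup_adm // gsrc_id gtgt_id eqxx /=; case: eqP => [->|_].
  by rewrite gfa_funitE rpredZ // gfa_one_sector.
by rewrite linear0 scaler0 mem0v.
Qed.

Lemma gfa_fcounit_dlinear : dlinear gfa_fcounit.
Proof.
apply: dlinear_homog => [p g a gp|x g a gx]; [rewrite (mem_rsector_gfa a gp)|rewrite (mem_rsector_gfa a gx)] => ag; last first.
  have ax := gfa_sector_part gx ag.
  rewrite assoc_act_gfa // (gfa_fcounitE ax) (gfa_fcounitE (gfa_act_part ax)) linearZ /= dt1_act.
  congr (_ *: _); rewrite -(gfa_eta_one ax) -(gfa_eta_one (gfa_act_part ax)) -gfa_act_one.
  by rewrite (gfa_eta_act HX) // gfa_proj_in.
have ap := gfa_sector_part gp ag; rewrite (gfa_fcounitE ap) -(gfa_eta_one ap).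
have [->|/eqP g1] := eqVneq g (gid p).
  rewrite rpredZ //; apply/(rsectorP _ (vgroup1 p)).
  by rewrite ract_gamma_dt1 ?vgroup_adm ?vgroup1 // gsrc_id gtgt_id !eqxx.
rewrite (gfa_eta0 HX gp (vgroup1 p) _ ag (gfa_one_sector p)) ?scale0r ?mem0v //.
by rewrite (vgroupg1 gp).
Qed.

(** The vectors a E_j and F_j have degrees whose product is the degree of a,
    and invariance of the Casimir element under phi(x) is [cas_adjoint]. *)
Lemma gfa_fcomul_dlinear : dlinear gfa_fcomul.
Proof.
apply: dlinear_homog => [p g a gp|x g a gx]; [rewrite (mem_rsector_gfa a gp)|rewrite (mem_rsector_gfa a gx)] => ag.
  rewrite (gfa_fcomulE (gfa_sector_part gp ag)); apply: rpred_sum => j jp.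
  have jVp := vgroupV jp; have gjp := vgroupM gp jp.
  have -> : g = ((g * j.1) * j.1^-1)%gpd.
    by rewrite -(vgroupA gp jp jVp) (vgroupgV jp) (vgroupg1 gp).
  apply: (tpr_sector gjp jVp); last by rewrite (mem_rsector_gfa _ jVp) casr_sector.
  rewrite (mem_rsector_gfa _ gjp).
  by apply: (gfa_sector_mul HX gp jp) => //; apply: casl_sector.
have ax := gfa_sector_part gx ag.
rewrite assoc_act_gfa // (gfa_fcomulE (gfa_act_part ax)) (gfa_fcomulE ax) linear_sum /=.
have actP b : b \in part (gtgt x) -> φ (x^-1)%gpd b \in part (gsrc x).
  by have := @gfa_act_part (x^-1)%gpd b; rewrite gsrc_inv gtgt_inv.
(* tprR (φ x a
Insert phi(x) phi(x^-1) on the second leg, to move phi(x) over to the first. *)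
transitivity (\sum_(j : J | j.1 \in vgroup (gtgt x))
    tprR (φ x a ∙ casl j) (φ x (φ (x^-1)%gpd (casr j)))).
  apply: eq_bigr => j jx; rewrite (gfa_act_comp HX) ?gsrc_inv ?gtgt_inv ?casr_part //.
  by rewrite gmulxV (gfa_act_id HX) // casr_part.
rewrite -(cas_adjoint (B := fun b c => tprR (φ x a ∙ b) (φ x c)) _ _ (u := φ x) (p := gsrc x)).
- apply: eq_bigr => j jx; have [lx rx] := (casl_part jx, casr_part jx).
  have lax := gfa_part_mul HX ax lx.
  by rewrite -(gfa_act_mul HX ax lx); symmetry; apply: gfa_act_tpr.
- by move=> b c u v; rewrite (gfa_mul_linearr HX) tpr_linearl.
- by move=> b c u v; rewrite linearP tpr_linearr.
- by move=> b; apply: gfa_act_part.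
- exact: actP.
by move=> b c bx cx; apply: gfa_eta_actV.
Qed.

(** * The axioms of a Frobenius object *)

Lemma gfa_fmulA : (gfa_fmul \o ttens_map \1 gfa_fmul \o rassoc R R R
  = gfa_fmul \o ttens_map gfa_fmul \1)%VF.
Proof.
apply: ttens3_ext => p a b c ap bp cp.
rewrite 2![LHS]comp_lfunE [RHS]comp_lfunE (rassoc_tpr ap bp cp).
rewrite (ttens_map_tpr _ _ ap (tpr_in_part bp cp)) (ttens_map_tpr _ _ (tpr_in_part ap bp) cp).
rewrite !id_lfunE; rewrite !mem_rpart_gfa in ap bp cp.
have [abp bcp] := (gfa_part_mul HX ap bp, gfa_part_mul HX bp cp).
rewrite (gfa_fmulE ap bp) (gfa_fmulE bp cp) (gfa_fmulE ap bcp) (gfa_fmulE abp cp).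
exact: (gfa_mulA HX).
Qed.

Lemma gfa_fmul1 : (gfa_fmul \o ttens_map gfa_funit \1 = lunitor R)%VF.
Proof.
apply: unit_ttens_ext => p a ap; rewrite [LHS]comp_lfunE.
rewrite (ttens_map_tpr _ _ (dt1_part k p) ap) id_lfunE gfa_funitE.
rewrite [RHS](lunitorE (rpartP _ _ ap)); rewrite mem_rpart_gfa in ap.
by rewrite (gfa_fmulE (gfa_proj_in p one) ap); have [_ /(_ _ ap) []] := gfa_one_unit p.
Qed.

Lemma gfa_fmulr1 : (gfa_fmul \o ttens_map \1 gfa_funit = runitor R)%VF.
Proof.
apply: ttens_unit_ext => p a ap; rewrite [LHS]comp_lfunE.
rewrite (ttens_map_tpr _ _ ap (dt1_part k p)) id_lfunE gfa_funitE.
rewrite [RHS](runitorE (rpartP _ _ ap)); rewrite mem_rpart_gfa in ap.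
by rewrite (gfa_fmulE ap (gfa_proj_in p one)); have [_ /(_ _ ap) []] := gfa_one_unit p.
Qed.

Lemma gfa_braiding p g a b : g \in vgroup p -> a \in sector g -> b \in part p ->
  braiding R R (tprR a b) = tprR (φ g b) a.
Proof.
move=> gp ag bp; have [sg tg] := vgroupP _ _ gp.
have aR : (a : R) \in rsector R g by rewrite (mem_rsector_gfa _ gp).
have bR : (b : R) \in rpart R p by rewrite mem_rpart_gfa.
rewrite (braiding_tpr (rsector_part gp aR) bR) (bigD1 g) //=.
rewrite (ract_gamma_id gp gp aR) eqxx assoc_act_gfa ?sg // big1 ?addr0 //.
by move=> h /andP[hp /negPf hg]; rewrite (ract_gamma_id gp hp aR) hg tpr0r.
Qed.

Lemma gfa_fmulC : (gfa_fmul \o braiding R R = gfa_fmul)%VF.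
Proof.
apply: ttens_sector_ext => p g h gp hp a b.
rewrite (mem_rsector_gfa _ gp) (mem_rsector_gfa _ hp) => ag bh; rewrite [LHS]comp_lfunE.
have [ap bp] := (gfa_sector_part gp ag, gfa_sector_part hp bh).
have [sg tg] := vgroupP _ _ gp.
have bp' : φ g b \in part p by rewrite -tg gfa_act_part ?sg.
by rewrite (gfa_braiding gp ag bp) (gfa_fmulE bp' ap) (gfa_fmulE ap bp) -(gfa_mulC HX gp hp ag bh).
Qed.

(** Expanding the two coproducts from opposite sides, both composites become the
    sum of the E_i (x) (F_i a E_j) (x) F_j. *)
Lemma gfa_fcomulA : (ttens_map \1 gfa_fcomul \o gfa_fcomul
  = rassoc R R R \o ttens_map gfa_fcomul \1 \o gfa_fcomul)%VF.
Proof.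
have mR p (a : R) : a \in part p -> a \in rpart R p by rewrite mem_rpart_gfa.
apply: rpart_ext => p a; rewrite mem_rpart_gfa => ap.
rewrite [LHS]comp_lfunE 2![RHS]comp_lfunE {1}(gfa_fcomulEr ap) (gfa_fcomulE ap) !lfun_sum.
transitivity (\sum_(i : J | i.1 \in vgroup p) \sum_(j : J | j.1 \in vgroup p)
  (tpr (casl i : R) (tprR ((casr i ∙ a) ∙ casl j) (casr j)) : ttens R T)).
  apply: eq_bigr => i ip; have [lp rp] := (casl_part ip, casr_part ip).
  have rap := gfa_part_mul HX rp ap.
  rewrite (ttens_map_tpr _ _ (mR _ _ lp) (mR _ _ rap)) id_lfunE.
  by rewrite (gfa_fcomulE rap) tpr_sumr.
rewrite exchange_big; apply: eq_bigr => j jp; have [lp rp] := (casl_part jp, casr_part jp).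
have alp := gfa_part_mul HX ap lp.
rewrite (ttens_map_tpr _ _ (mR _ _ alp) (mR _ _ rp)) id_lfunE (gfa_fcomulEr alp).
rewrite tpr_suml lfun_sum; apply: eq_bigr => i ip.
have [lip rip] := (casl_part ip, casr_part ip).
rewrite (rassoc_tpr (mR _ _ lip) (mR _ _ (gfa_part_mul HX rip alp)) (mR _ _ rp)).
by rewrite (gfa_mulA HX).
Qed.

Lemma gfa_fcomul1 : (lunitor R \o ttens_map gfa_fcounit \1 \o gfa_fcomul = \1)%VF.
Proof.
have mR p (a : R) : a \in part p -> a \in rpart R p by rewrite mem_rpart_gfa.
apply: rpart_ext => p a; rewrite mem_rpart_gfa => ap.
rewrite 2![LHS]comp_lfunE id_lfunE (gfa_fcomulE ap) !lfun_sum -[RHS](cas_suml ap).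
apply: eq_bigr => j jp; have [lp rp] := (casl_part jp, casr_part jp).
have alp := gfa_part_mul HX ap lp.
rewrite (ttens_map_tpr _ _ (mR _ _ alp) (mR _ _ rp)) id_lfunE (gfa_fcounitE alp).
rewrite tprZl lfunZ gfa_eta_mul1; congr (_ *: _).
exact: lunitorE (rpartP _ _ (mR _ _ rp)).
Qed.

Lemma gfa_fcomulr1 : (runitor R \o ttens_map \1 gfa_fcounit \o gfa_fcomul = \1)%VF.
Proof.
have mR p (a : R) : a \in part p -> a \in rpart R p by rewrite mem_rpart_gfa.
apply: rpart_ext => p a; rewrite mem_rpart_gfa => ap.
rewrite 2![LHS]comp_lfunE id_lfunE (gfa_fcomulEr ap) !lfun_sum -[RHS](cas_sumr ap).
apply: eq_bigr => j jp; have [lp rp] := (casl_part jp, casr_part jp).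
have rap := gfa_part_mul HX rp ap.
rewrite (ttens_map_tpr _ _ (mR _ _ lp) (mR _ _ rap)) id_lfunE (gfa_fcounitE rap).
rewrite tprZr lfunZ gfa_eta_mul1; congr (_ *: _).
exact: runitorE (rpartP _ _ (mR _ _ lp)).
Qed.

(** The braiding takes E_j (x) F_j a to phi(h)(F_j a) (x) E_j, and twisted
    commutativity turns phi(h)(F_j a) = F_j phi(h)(a) into a F_j. *)
Lemma gfa_fcomulC : (braiding R R \o gfa_fcomul = gfa_fcomul)%VF.
Proof.
apply: rpart_ext => p a; rewrite mem_rpart_gfa => ap.
rewrite [LHS]comp_lfunE {1}(gfa_fcomulEr ap) (gfa_fcomulE ap) lfun_sum.
rewrite -(cas_swap (B := fun b c => tprR (a ∙ b) c)).
- apply: eq_bigr => j jp; have [lp rp] := (casl_part jp, casr_part jp).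
  have [sj tj] := vgroupP _ _ jp; have jVp := vgroupV jp.
  rewrite (gfa_braiding jp (casl_sector j) (gfa_part_mul HX rp ap)).
  rewrite (gfa_act_mul HX) ?sj //; congr (tprR _ _).
  (* F_j has degree h^-1, and phi(h^-1) is the identity in that degree. *)
  have rj : φ j.1 (casr j) = casr j.
    rewrite -[in LHS](gfa_act_self HX jVp (casr_sector j)).
    by rewrite (gfa_act_comp HX) ?gsrc_inv ?gtgt_inv ?tj ?sj // (vgroupgV jp) (gfa_act_id HX rp).
  have ap' : φ j.1 a \in part p by rewrite -tj gfa_act_part ?sj.
  rewrite rj (gfa_mulC_part jVp (casr_sector j) ap') (gfa_act_comp HX) ?gsrc_inv ?tj ?sj //.
  by rewrite (vgroupVg jp) (gfa_act_id HX ap).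
- by move=> b c u v; rewrite (gfa_mul_linearr HX) tpr_linearl.
by move=> b c u v; rewrite tpr_linearr.
Qed.

Lemma gfa_frobl : (gfa_fcomul \o gfa_fmul
  = ttens_map gfa_fmul \1 \o rassocV R R R \o ttens_map \1 gfa_fcomul)%VF.
Proof.
have mR p (a : R) : a \in part p -> a \in rpart R p by rewrite mem_rpart_gfa.
apply: ttens_ext => p a b; rewrite !mem_rpart_gfa => ap bp.
rewrite [LHS]comp_lfunE 2![RHS]comp_lfunE (gfa_fmulE ap bp).
rewrite (ttens_map_tpr _ _ (mR _ _ ap) (mR _ _ bp)) id_lfunE (gfa_fcomulE bp).
rewrite tpr_sumr (gfa_fcomulE (gfa_part_mul HX ap bp)) !lfun_sum.
apply: eq_bigr => j jp; have [lp rp] := (casl_part jp, casr_part jp).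
have blp := gfa_part_mul HX bp lp.
rewrite (rassocV_tpr (mR _ _ ap) (mR _ _ blp) (mR _ _ rp)).
rewrite (ttens_map_tpr _ _ (tpr_in_part (mR _ _ ap) (mR _ _ blp)) (mR _ _ rp)) id_lfunE.
by rewrite (gfa_fmulE ap blp) (gfa_mulA HX).
Qed.

Lemma gfa_frobr : (gfa_fcomul \o gfa_fmul
  = ttens_map \1 gfa_fmul \o rassoc R R R \o ttens_map gfa_fcomul \1)%VF.
Proof.
have mR p (a : R) : a \in part p -> a \in rpart R p by rewrite mem_rpart_gfa.
apply: ttens_ext => p a b; rewrite !mem_rpart_gfa => ap bp.
rewrite [LHS]comp_lfunE 2![RHS]comp_lfunE (gfa_fmulE ap bp).
rewrite (ttens_map_tpr _ _ (mR _ _ ap) (mR _ _ bp)) id_lfunE (gfa_fcomulEr ap).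
rewrite tpr_suml (gfa_fcomulEr (gfa_part_mul HX ap bp)) !lfun_sum.
apply: eq_bigr => j jp; have [lp rp] := (casl_part jp, casr_part jp).
have rap := gfa_part_mul HX rp ap.
rewrite (rassoc_tpr (mR _ _ lp) (mR _ _ rap) (mR _ _ bp)).
rewrite (ttens_map_tpr _ _ (mR _ _ lp) (tpr_in_part (mR _ _ rap) (mR _ _ bp))) id_lfunE.
by rewrite (gfa_fmulE rap bp) (gfa_mulA HX).
Qed.

Definition gfa_frobenius : frobenius R :=
  Frobenius gfa_fmul_dlinear gfa_fcomul_dlinear gfa_funit_dlinear gfa_fcounit_dlinear
    gfa_fmulA gfa_fmul1 gfa_fmulr1 gfa_fmulC gfa_fcomulA gfa_fcomul1 gfa_fcomulr1
    gfa_fcomulC gfa_frobl gfa_frobr.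
Local Notation F := gfa_frobenius.

Lemma assoc_mul_gfa a b : assoc_mul F a b = a ∙ b.
Proof.
rewrite -[RHS]sum_gfa_proj; apply: eq_bigr => p _.
rewrite /rcomp !gfa_ract_unit1 gfa_mul_proj.
exact: gfa_fmulE (gfa_proj_in p a) (gfa_proj_in p b).
Qed.

Lemma assoc_one_gfa : assoc_one F = one.
Proof.
rewrite assoc_oneE -[RHS]sum_gfa_proj; apply: eq_bigr => p _; exact: gfa_funitE.
Qed.

Lemma assoc_eps_gfa a : assoc_eps F a = η a one.
Proof.
rewrite -{2}(sum_gfa_proj a) gfa_eta_suml; apply: eq_bigr => p _.
rewrite /rcomp gfa_ract_unit1.
rewrite [fcounit F _](gfa_fcounitE (gfa_proj_in p a)).
by rewrite dcoefZ dcoef_dt1 eqxx mulr1.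
Qed.

Lemma gfa_self_invariant : self_invariant R.
Proof.
apply: rsector_all_ext => p g gp a ag; rewrite (sum_ract_self gp ag) id_lfunE.
have [sg _] := vgroupP _ _ gp; rewrite (mem_rsector_gfa _ gp) in ag.
by rewrite assoc_act_gfa ?sg ?(gfa_sector_part gp ag) // (gfa_act_self HX gp ag).
Qed.

Lemma gfa_trace_condition : trace_condition F.
Proof.
move=> p g h gp hp c cgh; have [gVp hVp] := (vgroupV gp, vgroupV hp).
have ghp : (g * (h * (g^-1 * h^-1)))%gpd \in vgroup p by rewrite !vgroupM.
rewrite -rsectorE // in cgh.
rewrite (lftr_sector_mul_act F gp hp cgh) (lftr_sector_act_mul F gp hp cgh).
rewrite (mem_rsector_gfa _ ghp) in cgh.
have [sg tg] := vgroupP _ _ gp; have [sh th] := vgroupP _ _ hp.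
have lE a : linfun (gfa_mul X c) a = c ∙ a by rewrite linfunE //; apply: gfa_mul_linearr.
rewrite (rsector_gfa gp) (rsector_gfa hp).
transitivity (lftr_on (sector g) (linfun (gfa_mul X c) \o φ h)%VF).
  apply: lftr_on_ext => a ag; have ap := gfa_sector_part gp ag.
  rewrite [LHS]comp_lfunE [RHS]comp_lfunE lE lfun_assoc_mulE assoc_mul_gfa.
  by rewrite assoc_act_gfa ?sh.
rewrite (gfa_trace HX gp hp cgh); symmetry; apply: lftr_on_ext => a ah.
have ap := gfa_sector_part hp ah; have cp := gfa_sector_part ghp cgh.
rewrite [LHS]comp_lfunE [RHS]comp_lfunE lE lfun_assoc_mulE assoc_mul_gfa.
by rewrite assoc_act_gfa // gsrc_inv tg (gfa_part_mul HX cp ap).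
Qed.

Lemma assoc_data_gfa : gfa_eq (assoc_data F) X.
Proof.
split=> /=.
- exact: assoc_mul_gfa.
- exact: assoc_one_gfa.
- by move=> a b; rewrite /assoc_eta assoc_mul_gfa assoc_eps_gfa gfa_eta_mul1.
- exact: rpart_gfa.
- by move=> p g gp; apply: rsector_gfa gp.
by move=> x a; rewrite -[limg _]/(rpart R _) mem_rpart_gfa; apply: assoc_act_gfa.
Qed.

End AlgebraToFrobenius.

Theorem theorem3p4 (k : fieldType) (k_char0 : [pchar k] =i pred0)
    (G : finGroupoid) :
  (forall (A : rep k G) (F : frobenius A),
     self_invariant A -> trace_condition F -> is_gfa (assoc_data F))
  /\
  (forall (A : vectType k) (X : gfa_data G A), is_gfa X ->
     exists (M : dmodule G A) (F : frobenius (Rep M)),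
       [/\ self_invariant (Rep M), trace_condition F
         & gfa_eq (assoc_data F) X]).
Proof.
split=> [A F|A X HX]; first exact: frobenius_gfa.
exists (gfa_mod HX), (gfa_frobenius HX); split.
- exact: gfa_self_invariant.
- exact: gfa_trace_condition.
exact: assoc_data_gfa.
Qed.
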